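(* Let $T>0$, $\eta\in(0,1]$, $L,\tilde H\in\mathcal{M}_d(\mathbb{C})$ with $\tilde H=\tilde H^\dagger$, let $A$ be a pairwise interaction operator with kernel $a$, and let $\rho_0\in\mathcal{S}(\mathbb{H})$. For a graphon $\mathrm{W}$ consider the system, indexed by $u\in I=[0,1]$, on $[0,T]$, $$\begin{aligned}\mathrm{d}\gamma_t^{u} &= -\mathrm{i}\Big[\tilde{H} + \int_{0}^{1}\mathrm{W}(u,v)A^{\mathbb{E}[\gamma_t^{v}]}\,\mathrm{d}v,\ \gamma_t^{u} \Big]\mathrm{d}t+ \Big(L\gamma_t^{u}L^{\dagger} - \tfrac{1}{2}\{L^{\dagger}L, \gamma_t^{u}\}\Big)\mathrm{d}t\\ &\quad + \sqrt{\eta}\Big(L\gamma_t^{u} + \gamma_t^{u}L^{\dagger} - \mathrm{tr}\big((L+L^{\dagger})\gamma_t^{u}\big)\gamma_t^{u}\Big)\mathrm{d}W_t^{u},\qquad \gamma_0^u=\rho_0.\end{aligned}$$ Let $\tilde\gamma=(\tilde\gamma^u)_{u\in I}$ and $\hat\gamma=(\hat\gamma^u)_{u\in I}$ be the solutions of this system associated with graphons $\mathrm{W}=\tilde{\mathrm{W}}$ and $\mathrm{W}=\hat{\mathrm{W}}$ respectively, with the same initial conditions and driven by the same Brownian motions $(W^u)_{u\in I}$. Then there exists a constant $C=C(T,\eta,\|\tilde H\|,\|A\|,\|L\|)$ such that $$\mathbb{E}\Big[\int_{I}\sup_{t\in[0,T]}\big\|\tilde\gamma_t^u-\hat\gamma_t^u\big\|^2\,\mathrm{d}u\Big]\le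 C\,\|\tilde{\mathrm{W}}-\hat{\mathrm{W}}\|_{\square}.$$
   Context: The dimension $d\ge 1$ is fixed; $\mathfrak{X}=\{1,\dots,d\}$ with counting measure and $\mathbb{H}=L^2(\mathfrak{X};\mathbb{C})\cong\mathbb{C}^d$. $\mathcal{S}(\mathbb{H})=\{\rho\in\mathcal{M}_d(\mathbb{C}):\rho\ge0,\ \mathrm{tr}(\rho)=1,\ \rho=\rho^\dagger\}$ is the set of density matrices; $^\dagger$ is the adjoint, $[X,Y]=XY-YX$, $\{X,Y\}=XY+YX$, and $\|O\|=\sqrt{\mathrm{tr}(OO^\dagger)}$ is the Frobenius norm. A graphon is a symmetric measurable function $\mathrm{W}:I^2\to[0,1]$, $I=[0,1]$. A kernel is a bounded symmetric measurable function $\mathrm{W}:I^2\to\mathbb{R}$, and its cut norm is $\|\mathrm{W}\|_{\square}=\sup_{B_1,B_2}\big|\int_{B_1\times B_2}\mathrm{W}(u,v)\,\mathrm{d}u\,\mathrm{d}v\big|$, the supremum being over Borel sets $B_1,B_2\subset I$. The pairwise interaction operator $A:L^2(\mathfrak{X}^2;\mathbb{C})\to L^2(\mathfrak{X}^2;\mathbb{C})$ is $Af(x,y)=\sum_{\tilde x,\tilde y\in\mathfrak{X}}a(x,y;\tilde x,\tilde y)f(\tilde x,\tilde y)$, where the kernel $a$ satisfies $a(x,y;\tilde x,\tilde y)=a(y,x;\tilde y,\tilde x)$ and $a(x,y;\tilde x,\tilde y)=\overline{a(\tilde x,\tilde y;x,y)}$. For $\rho\in\mathcal{S}(\mathbb{H})$,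 with matrix entries $\rho(y,y')$, the matrix $A^\rho\in\mathcal{M}_d(\mathbb{C})$ has entries $A^{\rho}(x,x')=\sum_{y,y'\in\mathfrak{X}}a(x,y;x',y')\overline{\rho(y,y')}$. $(W^u)_{u\in I}$ is a family of standard real Brownian motions on a filtered probability space satisfying the usual conditions. A solution of the system is a family $(\gamma^u)_{u\in I}$ of continuous adapted $\mathcal{S}(\mathbb{H})$-valued processes on $[0,T]$ satisfying the integrated equation for every $u\in I$, with $(t,v)\mapsto\mathbb{E}[\gamma^v_t]$ measurable (the system is well posed with $\mathcal{S}(\mathbb{H})$-valued solutions). It is understood that the measurability in $(u,\omega)$ is such that the integral over $u$ in the conclusion is meaningful and may be interchanged with the expectation. *)

(* Defs.v *)
From mathcomp Require Import all_boot all_order all_algebra.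
From mathcomp Require Import complex.
From mathcomp Require Import all_classical all_reals all_analysis.
From mathcomp Require Import measurable_realfun.

Set Implicit Arguments.
Unset Strict Implicit.
Unset Printing Implicit Defensive.

Import Order.TTheory GRing.Theory Num.Theory.
Import numFieldNormedType.Exports.

Local Open Scope classical_set_scope.
Local Open Scope ring_scope.
Local Open Scope complex_scope.
Local Open Scope sesquilinear_scope.

Definition commutator (R : realType) (d : nat) (X Y : 'M[R[i]]_d) : 'M[R[i]]_d :=
  X *m Y - Y *m X.

Definition anticommutator (R : realType) (d : nat) (X Y : 'M[R[i]]_d) :
    'M[R[i]]_d :=
  X *m Y + Y *m X.

Definition frobenius (R : realType) (n : nat) (X : 'M[R[i]]_n) : R :=
  Num.sqrt (complex.Re (\tr (X *m X ^t*))).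

(* The order on R[i] is partial: [0 <= z] says that z is real and
   nonnegative. *)
Definition density_matrix (R : realType) (d : nat) (rho : 'M[R[i]]_d) : Prop :=
  [/\ forall x : 'cV[R[i]]_d, 0 <= (x ^t* *m rho *m x) ord0 ord0,
      \tr rho = 1
    & rho ^t* = rho].

Definition pair_kernel (R : realType) (d : nat) : Type :=
  'I_d -> 'I_d -> 'I_d -> 'I_d -> R[i].

(* [a x y x' y'] stands for a(x, y; x', y'). *)
Definition is_pair_kernel (R : realType) (d : nat) (a : pair_kernel R d) : Prop :=
  (forall x y x' y', a x y x' y' = a y x y' x') /\
  (forall x y x' y', a x y x' y' = (a x' y' x y)^*%C).

(* A function f(x, y) of two points of {1, ..., d} is encoded as a d x d
   matrix. *)
Definition pair_operator (R : realType) (d : nat) (a : pair_kernel R d)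
    (f : 'M[R[i]]_d) : 'M[R[i]]_d :=
  \matrix_(x, y) \sum_(x' < d) \sum_(y' < d) a x y x' y' * f x' y'.

(* Frobenius norm of the operator A, through its matrix of size d^2 in the
   canonical basis. *)
Definition pair_operator_norm (R : realType) (d : nat) (a : pair_kernel R d) : R :=
  frobenius (lin_mx (pair_operator a)).

(* The matrix A^rho. *)
Definition mean_field (R : realType) (d : nat) (a : pair_kernel R d)
    (rho : 'M[R[i]]_d) : 'M[R[i]]_d :=
  \matrix_(x, x') \sum_(y < d) \sum_(y' < d) a x y x' y' * ((rho y y')^*)%C.

Definition unit_itv (R : realType) : set R := `[0, 1].
Arguments unit_itv : clear implicits.

Definition time_itv (R : realType) (T : R) : set R := `[0, T].

Definition graphon (R : realType) (W : R -> R -> R) : Prop :=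
  [/\ measurable_fun (unit_itv R `*` unit_itv R) (fun p : R * R => W p.1 p.2),
      forall u v, unit_itv R u -> unit_itv R v -> W u v = W v u
    & forall u v, unit_itv R u -> unit_itv R v -> 0 <= W u v <= 1].

Definition cut_norm (R : realType) (W : R -> R -> R) : \bar R :=
  ereal_sup [set r : \bar R | exists B1 B2 : set R,
    [/\ measurable B1, measurable B2, B1 `<=` unit_itv R, B2 `<=` unit_itv R
      & r = `| \int[(@lebesgue_measure R \x @lebesgue_measure R)%E]_(p in B1 `*` B2)
                 (W p.1 p.2)%:E |%E]].

Definition cintegral (R : realType) (dT : measure_display) (T : measurableType dT)
    (mu : {measure set T -> \bar R}) (D : set T) (f : T -> R[i]) : R[i] :=
  (\int[mu]_(x in D) complex.Re (f x)) +i* (\int[mu]_(x in D) complex.Im (f x)).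

Definition mxintegral (R : realType) (d : nat) (dT : measure_display)
    (T : measurableType dT) (mu : {measure set T -> \bar R}) (D : set T)
    (f : T -> 'M[R[i]]_d) : 'M[R[i]]_d :=
  \matrix_(i, j) cintegral mu D (fun x => f x i j).

Definition mxexpectation (R : realType) (d : nat) (dO : measure_display)
    (Omega : measurableType dO) (P : probability Omega R)
    (X : Omega -> 'M[R[i]]_d) : 'M[R[i]]_d :=
  mxintegral P setT X.

(* Processes and filtrations are indexed by R; only nonnegative times
   matter. *)
Record filtration_usual (R : realType) (dO : measure_display)
    (Omega : measurableType dO) (P : probability Omega R)
    (F : R -> set (set Omega)) : Prop := FiltrationUsual {
  fu_sigma : forall t : R, 0 <= t -> sigma_algebra setT (F t);
  fu_measurable : forall t : R, 0 <= t -> F t `<=` measurable;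
  fu_mono : forall s t : R, 0 <= s -> s <= t -> F s `<=` F t;
  fu_right_cont : forall t : R, 0 <= t ->
    F t = \bigcap_(s in [set s : R | t < s]) F s;
  fu_complete : forall A, P.-negligible A -> F 0 A
}.

Definition measurable_wrt (R : realType) (Omega : Type) (G : set (set Omega))
    (X : Omega -> R) : Prop :=
  forall B : set R, measurable B -> G (X @^-1` B).

Record brownian_motion (R : realType) (dO : measure_display)
    (Omega : measurableType dO) (P : probability Omega R)
    (F : R -> set (set Omega)) (B : R -> Omega -> R) : Prop := BrownianMotion {
  bm_start : {ae P, forall w, B 0 w = 0};
  bm_continuous : forall w, {within `[0, +oo[, continuous (B ^~ w)};
  bm_adapted : forall t : R, 0 <= t -> measurable_wrt (F t) (B t);
  (* [normal_prob m s] is parametrized by the standard deviation s. *)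
  bm_gaussian : forall (s t : R) (S : set R), 0 <= s -> s < t -> measurable S ->
    P ((B t \- B s) @^-1` S) = normal_prob 0 (Num.sqrt (t - s)) S;
  bm_independent : forall (s t : R) (S : set R) (E : set Omega),
    0 <= s -> s < t -> measurable S -> F s E ->
    P (E `&` (B t \- B s) @^-1` S)
    = (P E * P ((B t \- B s)%R @^-1` S))%E
}.

(* The elementary process sum_k xi_k 1_]t_k, t_(k+1)], k < n. *)
Record elementary (R : realType) (Omega : Type) : Type := Elementary {
  el_size : nat;
  el_time : nat -> R;
  el_coef : nat -> Omega -> R
}.

Definition is_elementary (R : realType) (Omega : Type)
    (F : R -> set (set Omega)) (T : R) (e : elementary R Omega) : Prop :=
  [/\ forall k, (k <= el_size e)%N -> 0 <= el_time e k <= T,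
      forall k, (k < el_size e)%N -> el_time e k <= el_time e k.+1,
      forall k, (k < el_size e)%N ->
        measurable_wrt (F (el_time e k)) (el_coef e k)
    & forall k, (k < el_size e)%N ->
        exists M : R, forall w, `|el_coef e k w| <= M].

Definition elementary_process (R : realType) (Omega : Type)
    (e : elementary R Omega) (s : R) (w : Omega) : R :=
  \sum_(k < el_size e)
    el_coef e k w * \1_(`]el_time e k, el_time e k.+1]) s.

Definition elementary_integral (R : realType) (Omega : Type)
    (B : R -> Omega -> R) (e : elementary R Omega) (t : R) (w : Omega) : R :=
  \sum_(k < el_size e)
    el_coef e k w * (B (Num.min (el_time e k.+1) t) w
                     - B (Num.min (el_time e k) t) w).

(* [Y] is a continuous version on [0, T] of the Ito integral of [H] against
   [B]: [H] is jointly measurable, adapted and square integrable, and [Y] is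
   the L^2-limit of the integrals of elementary processes that approximate [H]
   in L^2(dP dt). *)
Definition is_ito_integral (R : realType) (dO : measure_display)
    (Omega : measurableType dO) (P : probability Omega R)
    (F : R -> set (set Omega)) (B : R -> Omega -> R) (T : R)
    (H Y : R -> Omega -> R) : Prop :=
  [/\ measurable_fun (time_itv T `*` [set: Omega])
        (fun p : R * Omega => H p.1 p.2),
      forall t : R, 0 <= t <= T -> measurable_wrt (F t) (H t),
      (\int[P]_w \int[@lebesgue_measure R]_(s in time_itv T)
         ((H s w) ^+ 2)%:E < +oo)%E,
      (forall w, {within time_itv T, continuous (Y ^~ w)}) /\
      (forall t : R, 0 <= t <= T -> measurable_wrt (F t) (Y t))
    & exists e : nat -> elementary R Omega,
      [/\ forall n, is_elementary F T (e n),
          (fun n => \int[P]_w \int[@lebesgue_measure R]_(s in time_itv T)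
             ((H s w - elementary_process (e n) s w) ^+ 2)%:E)%E
            @ \oo --> 0%E
        & forall t : R, 0 <= t <= T ->
          (fun n => \int[P]_w
             ((Y t w - elementary_integral B (e n) t w) ^+ 2)%:E)%E
            @ \oo --> 0%E]].

Definition is_ito_mxintegral (R : realType) (d : nat) (dO : measure_display)
    (Omega : measurableType dO) (P : probability Omega R)
    (F : R -> set (set Omega)) (B : R -> Omega -> R) (T : R)
    (H Y : R -> Omega -> 'M[R[i]]_d) : Prop :=
  forall i j : 'I_d,
    is_ito_integral P F B T (fun t w => complex.Re (H t w i j))
                            (fun t w => complex.Re (Y t w i j)) /\
    is_ito_integral P F B T (fun t w => complex.Im (H t w i j))
                            (fun t w => complex.Im (Y t w i j)).

(* The effective Hamiltonian H + int_0^1 W(u, v) A^(m v) dv, where m v plays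
   the role of E[gamma_t^v]. *)
Definition hamiltonian (R : realType) (d : nat) (H : 'M[R[i]]_d)
    (a : pair_kernel R d) (W : R -> R -> R) (m : R -> 'M[R[i]]_d) (u : R) :
    'M[R[i]]_d :=
  H + mxintegral (@lebesgue_measure R) (unit_itv R)
        (fun v => (W u v)%:C *: mean_field a (m v)).

Definition drift (R : realType) (d : nat) (L K rho : 'M[R[i]]_d) : 'M[R[i]]_d :=
  - ('i%C *: commutator K rho)
  + (L *m rho *m L ^t* - 2^-1 *: anticommutator (L ^t* *m L) rho).

Definition diffusion (R : realType) (d : nat) (eta : R) (L rho : 'M[R[i]]_d) :
    'M[R[i]]_d :=
  (Num.sqrt eta)%:C *:
    (L *m rho + rho *m L ^t* - \tr ((L + L ^t*) *m rho) *: rho).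

(* [gamma u t w] is the value of gamma_t^u at the sample point w. *)
Record is_solution (R : realType) (d : nat) (dO : measure_display)
    (Omega : measurableType dO) (P : probability Omega R)
    (F : R -> set (set Omega)) (B : R -> R -> Omega -> R) (T eta : R)
    (H L : 'M[R[i]]_d) (a : pair_kernel R d) (rho0 : 'M[R[i]]_d)
    (W : R -> R -> R) (gamma : R -> R -> Omega -> 'M[R[i]]_d) : Prop :=
  IsSolution {
  sol_density : forall u (t : R) w, unit_itv R u -> 0 <= t <= T ->
    density_matrix (gamma u t w);
  sol_continuous : forall u w i j, unit_itv R u ->
    {within time_itv T, continuous (fun t => complex.Re (gamma u t w i j))} /\
    {within time_itv T, continuous (fun t => complex.Im (gamma u t w i j))};
  sol_adapted : forall u (t : R) i j, unit_itv R u -> 0 <= t <= T ->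
    measurable_wrt (F t) (fun w => complex.Re (gamma u t w i j)) /\
    measurable_wrt (F t) (fun w => complex.Im (gamma u t w i j));
  sol_mean_measurable : forall i j,
    measurable_fun (time_itv T `*` unit_itv R) (fun p : R * R =>
      complex.Re (mxexpectation P (gamma p.2 p.1) i j)) /\
    measurable_fun (time_itv T `*` unit_itv R) (fun p : R * R =>
      complex.Im (mxexpectation P (gamma p.2 p.1) i j));
  sol_equation : forall u, unit_itv R u ->
    exists2 Y : R -> Omega -> 'M[R[i]]_d,
      is_ito_mxintegral P F (B u) T
        (fun t w => diffusion eta L (gamma u t w)) Y
    & {ae P, forall w, forall t : R, 0 <= t <= T ->
        gamma u t w
        = rho0
          + mxintegral (@lebesgue_measure R) (time_itv t) (fun s =>
              drift L
                (hamiltonian H a W (fun v => mxexpectation P (gamma v s)) u)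
                (gamma u s w))
          + Y t w}
}.

Definition sup_sq_dist (R : realType) (d : nat) (Omega : Type) (T : R)
    (g1 g2 : R -> R -> Omega -> 'M[R[i]]_d) (u : R) (w : Omega) : \bar R :=
  ereal_sup [set ((frobenius (g1 u t w - g2 u t w)) ^+ 2)%:E | t in time_itv T].

(* The integral over u in [0, 1] of the random field D makes sense and commutes
   with the expectation.  Joint measurability in (u, w) is sufficient by
   Tonelli's theorem, but is not required. *)
Record integral_expectation_exchange (R : realType) (dO : measure_display)
    (Omega : measurableType dO) (P : probability Omega R)
    (D : R -> Omega -> \bar R) : Prop := IntegralExpectationExchange {
  iee_section : {ae P, forall w,
    measurable_fun (unit_itv R) (D ^~ w : R -> \bar R)};
  iee_random : forall u, unit_itv R u -> measurable_fun setT (D u);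
  iee_integral : measurable_fun setT
    ((fun w => \int[@lebesgue_measure R]_(u in unit_itv R) D u w)%E :
       Omega -> \bar R);
  iee_expectation : measurable_fun (unit_itv R)
    ((fun u => \int[P]_w D u w)%E : R -> \bar R);
  iee_exchange :
    (\int[P]_w \int[@lebesgue_measure R]_(u in unit_itv R) D u w
     = \int[@lebesgue_measure R]_(u in unit_itv R) \int[P]_w D u w)%E
}.

(* Main.v *)
Require Import Defs.
From HB Require Import structures.
From mathcomp Require Import all_boot all_order all_algebra.
From mathcomp Require Import complex.
From mathcomp Require Import all_classical all_reals all_analysis.
From mathcomp Require Import measurable_realfun.
From mathcomp Require Import ring lra.

(** Fix a label [u].  By the equation, the difference [delta] of the two solutions
    is a time integral of the difference of the drifts plus an Ito integral of the
    difference of the diffusion coefficients.  Density matrices have entries of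
    modulus at most one, so on them both coefficients are Lipschitz
    ([drift_lipschitz], [diffusion_lipschitz]), and the drifts also differ through
    the two Hamiltonians, which are [A] applied to the averaged states
    [int W(u, v) E gamma^v dv].  The difference of the averaged states is at most
    the sum of a graphon term, [int (W1 - W2)(u, v) E gamma1^v dv], and of a mean
    term, controlled by the average over [v] of the squared distance between
    [E gamma1^v] and [E gamma2^v] ([averaged_gap]).  Their squares add up to the
    [forcing] of the label [u].

    Doob's inequality bounds the expected maximum of the squared distance along a
    finite grid by a multiple of the time integral of the expected squared distance
    [gap] and of the forcing ([maximal_gap_le]).  Gronwall's inequality removes [gap]
    from the right-hand side ([gap_le]), and refining the grid replaces the maximum
    by the supremum ([expected_sup_le]).

    The forcing still contains the mean term.  By Jensen's inequality the means are
    at most as far apart as the states, so integration over the labels and a second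
    use of Gronwall's inequality bound the mean term by the total graphon term
    ([mean_gap_le_total]).

    The cut norm enters at the end.  The entries of [E gamma1^v] are bounded by one,
    and an integral operator with kernel [w] maps the unit ball of bounded functions
    into integrable functions with norm at most four times the cut norm of [w]
    ([operator_cut_bound]).  The graphon terms are themselves bounded by one, so
    their squares are at most their absolute values: this is why the squared distance
    is linear in the cut norm ([total_forcing_le]).

    Stochastic integration is built from the definition as an L2-limit of elementary
    integrals.  Independence of the increments from the past yields the isometry
    ([simple_isometry]) and the martingale property ([simple_martingale]) of simple
    integrals, and Doob's inequality then follows from the algebraic inequality
    [doob_pathwise].  It passes to the limit for the difference of two Ito integrals
    ([ito_doob]).  The finite second moment of the standard normal law enters
    the constants as [normal_moment2]. *)

Set Implicit Arguments.
Unset Strict Implicit.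
Unset Printing Implicit Defensive.

Import Order.TTheory GRing.Theory Num.Theory.
Import numFieldNormedType.Exports.

Local Open Scope classical_set_scope.
Local Open Scope ring_scope.
Local Open Scope complex_scope.
Local Open Scope sesquilinear_scope.

(** * Gronwall's inequality for measurable functions *)

Section gronwall.
Variable R : realType.
Local Notation mu := (@lebesgue_measure R).

Lemma integral_expR_le (c t : R) : 0 < c -> 0 <= t ->
  (\int[mu]_(s in `[0%R, t]) (expR (c * s))%:E <= (expR (c * t) / c)%:E)%E.
Proof.
move=> c0; rewrite le_eqVlt => /predU1P[<-|t0].
  by rewrite set_itv1 integral_set1 lee_fin divr_ge0 ?expR_ge0// ltW.
pose F (s : R) := expR (c * s) / c.
have dF (x : R) : is_derive x 1 F (expR (c * x)).
  have -> : F = (fun s => c^-1 * expR (c * s)) by apply/funext => s; rewrite mulrC.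
  have h : is_derive x 1 (fun s : R => c * s) c.
    have := @is_deriveZ R R R id c x 1 1 (is_derive_id _ _).
    by rewrite [_ *: _]mulr1.
  have h2 := is_derive1_comp (is_derive_expR (c * x)) h.
  have := @is_deriveZ R R R _ c^-1 x 1 _ h2.
  by rewrite [_ *: _]mulrCA mulVf ?mulr1// gt_eqF.
have cF : continuous F.
  by move=> x; apply: differentiable_continuous; apply/derivable1_diffP; case: (dF x).
rewrite (@continuous_FTC2 R (fun s => expR (c * s)) F 0 t)//.
- by rewrite -EFinB lee_fin /F gerBl divr_ge0 ?expR_ge0// ltW.
- apply: continuous_subspaceT => x; apply: continuous_comp; last exact: continuous_expR.
  exact: mulrl_continuous.
- split.
  + by move=> x _; case: (dF x).
  + by apply: cvg_at_right_filter; exact: cF.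
  + by apply: cvg_at_left_filter; exact: cF.
- by move=> x _; rewrite derive1E; case: (dF x).
Qed.

(** The weight [expR (- 2 k s)] halves the integral term, so the weighted supremum
    of [g], finite because [g] is bounded, absorbs it. *)
Lemma gronwall (k T beta M : R) (g : R -> R) : 0 < k -> 0 <= beta ->
  measurable_fun `[0, T] g ->
  (forall t : R, 0 <= t <= T -> 0 <= g t <= M) ->
  (forall t : R, 0 <= t <= T ->
    ((g t)%:E <= beta%:E + k%:E * \int[mu]_(s in `[0%R, t]) (g s)%:E)%E) ->
  forall t : R, 0 <= t <= T -> g t <= 2 * beta * expR (2 * k * T).
Proof.
move=> k0 beta0 mg gM gi.
pose A := [set g s * expR (- (2 * k * s)) | s in `[0, T]].
have subA (s : R) : 0 <= s <= T -> A (g s * expR (- (2 * k * s))).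
  by move=> sT; exists s => //=; rewrite in_itv.
have ubA : has_ubound A.
  exists M => y [s /=]; rewrite in_itv/= => sT <-{y}.
  have /andP[gs0 gsM] := gM _ sT; have /andP[s0 _] := sT.
  rewrite (le_trans _ gsM)// ler_piMr// -[leRHS]expR0 ler_expR oppr_le0.
  by rewrite !mulr_ge0// ltW.
set m := sup A.
have gm (s : R) : 0 <= s <= T -> g s <= m * expR (2 * k * s).
  move=> sT; have := ub_le_sup ubA (subA _ sT).
  by rewrite -/m expRN ler_pdivrMr ?expR_gt0.
move=> t tT; have /andP[t0 tleT] := tT.
have m0 : 0 <= m.
  have /andP[gt0 _] := gM _ tT.
  by apply: le_trans (ub_le_sup ubA (subA _ tT)); rewrite mulr_ge0 ?expR_ge0.
have half (s : R) : 0 <= s <= T -> g s <= beta + m * expR (2 * k * s) / 2.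
  move=> sT; have /andP[s0 sleT] := sT.
  rewrite -lee_fin; apply: le_trans (gi _ sT) _; rewrite EFinD leeD2l//.
  have sub (x : R) : x \in `[0, s] -> 0 <= x <= T.
    by rewrite in_itv/= => /andP[-> /le_trans ->].
  apply: (@le_trans _ _ (k%:E *
      \int[mu]_(x in `[0%R, s]) (m * expR (2 * k * x))%:E)%E).
    apply: lee_wpmul2l; first by rewrite lee_fin ltW.
    apply: ge0_le_integral => //=.
    - by move=> x /sub /gM /andP[? _]; rewrite lee_fin.
    - apply/measurable_EFinP; apply: measurable_funS mg => //.
    - apply/measurable_EFinP; apply: measurable_funM => //.
      apply: measurable_funTS; apply: measurableT_comp => //; exact: measurable_funM.
    - by move=> x /sub /gm; rewrite lee_fin.
  under eq_integral do rewrite EFinM.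
  rewrite ge0_integralZl//=; last first.
    apply/measurable_EFinP.
    apply: measurable_funTS; apply: measurableT_comp => //; exact: measurable_funM.
  rewrite muleA; apply: (@le_trans _ _
      (k%:E * m%:E * (expR (2 * k * s) / (2 * k))%:E)%E).
    by rewrite lee_wpmul2l ?integral_expR_le ?mulr_gt0// mule_ge0 ?lee_fin// ltW.
  rewrite -!EFinM lee_fin le_eqVlt; apply/orP; left; apply/eqP.
  by field; rewrite gt_eqF.
have mle : m <= beta + m / 2.
  apply: ge_sup; first by exists (g t * expR (- (2 * k * t))); exact: subA.
  move=> y [s /=]; rewrite in_itv/= => sT <-{y}; have /andP[s0 _] := sT.
  rewrite expRN ler_pdivrMr ?expR_gt0// mulrDl; apply: le_trans (half _ sT) _.
  rewrite mulrAC lerD2r ler_peMr// -[leLHS]expR0 ler_expR.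
  by rewrite !mulr_ge0// ltW.
have m2 : m <= 2 * beta by lra.
apply: le_trans (gm _ tT) _; apply: ler_pM => //; rewrite ?expR_ge0//.
by rewrite ler_expR ler_wpM2l// mulr_ge0// ltW.
Qed.

End gronwall.

(** * A pathwise maximal inequality *)

Section pathwise_doob.
Variable R : realDomainType.

Fixpoint runmax (M : nat -> R) (n : nat) : R :=
  if n is m.+1 then Num.max (runmax M m) (M n) else Num.max 0 (M 0).

Lemma runmax_ge0 M n : 0 <= runmax M n.
Proof. by elim: n => [|n IH] /=; rewrite le_max ?lexx ?IH. Qed.

Lemma le_runmax M n i : (i <= n)%N -> M i <= runmax M n.
Proof.
elim: n => [|n IH]/=; first by rewrite leqn0 => /eqP ->; rewrite le_max lexx orbT.
by rewrite leq_eqVlt => /predU1P[->|/IH h]; rewrite le_max ?lexx ?orbT ?h.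
Qed.

(** Summation by parts: the running maximum only increases at times when it
    coincides with the path. *)
Lemma runmax_sum_le M n :
  runmax M n ^+ 2 + 2 * \sum_(i < n) runmax M i * (M i.+1 - M i)
    <= 2 * (runmax M n * M n).
Proof.
elim: n => [|n IH].
  rewrite big_ord0 mulr0 addr0 /=; case: (leP 0 (M 0)) => h.
    by have := sqr_ge0 (M 0); lra.
  by rewrite expr0n/= mul0r mulr0.
rewrite big_ord_recr/=; move: IH; set S := runmax M n; set Q := \sum_(i < n) _.
have S0 : 0 <= S by exact: runmax_ge0.
move=> IH; case: (leP S (M n.+1)) => h; last by lra.
have h2 : 0 <= (M n.+1 - S) * (M n.+1 - S) by rewrite mulr_ge0 ?subr_ge0.
lra.
Qed.

(** Young's inequality absorbs half of the square of the running maximum into the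
    left-hand side of [runmax_sum_le]. *)
Lemma runmax_sqr_le M n :
  runmax M n ^+ 2
    <= 4 * M n ^+ 2 - 4 * \sum_(i < n) runmax M i * (M i.+1 - M i).
Proof.
have h := runmax_sum_le M n; have h2 := sqr_ge0 (runmax M n - 2 * M n).
rewrite sqrrB in h2; lra.
Qed.

(** Doob's L2 inequality path by path, from [runmax_sqr_le] for [M] and for [- M].
    For a martingale the last sum is a martingale transform, of mean zero. *)
Lemma doob_pathwise M n i : (i <= n)%N ->
  M i ^+ 2 <= 8 * M n ^+ 2
    - 4 * \sum_(i < n) (runmax M i - runmax (\- M) i) * (M i.+1 - M i).
Proof.
move=> ilen.
have -> : \sum_(i < n) (runmax M i - runmax (\- M) i) * (M i.+1 - M i) =
    \sum_(i < n) runmax M i * (M i.+1 - M i) +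
    \sum_(i < n) runmax (\- M) i * ((\- M) i.+1 - (\- M) i).
  by rewrite -big_split/=; apply: eq_bigr => j _; ring.
have h1 := runmax_sqr_le M n; have h2 := runmax_sqr_le (\- M) n.
have le1 := le_runmax M ilen; have le2 := le_runmax (\- M) ilen.
have p1 := runmax_ge0 M n; have p2 := runmax_ge0 (\- M) n.
rewrite sqrrN in h2.
suff : M i ^+ 2 <= runmax M n ^+ 2 + runmax (\- M) n ^+ 2 by lra.
rewrite /= in le2; case: (leP 0 (M i)) => h.
  have : M i ^+ 2 <= runmax M n ^+ 2 by rewrite lerXn2r// nnegrE.
  by have := sqr_ge0 (runmax (\- M) n); lra.
have : (- M i) ^+ 2 <= runmax (\- M) n ^+ 2.
  by rewrite lerXn2r// nnegrE// oppr_ge0 ltW.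
by rewrite sqrrN; have := sqr_ge0 (runmax M n); lra.
Qed.

End pathwise_doob.

(** * Real coordinates and the norm of complex matrices *)

Section finite_sums.
Variable R : realType.

Lemma sqr_sum_le (I : finType) (x : I -> R) :
  (\sum_i x i) ^+ 2 <= #|I|%:R * \sum_i x i ^+ 2.
Proof.
rewrite expr2 mulr_suml.
under eq_bigr do rewrite mulr_sumr.
apply: (@le_trans _ _ (\sum_i \sum_j (x i ^+ 2 + x j ^+ 2) / 2)).
  apply: ler_sum => i _; apply: ler_sum => j _.
  by have h := sqr_ge0 (x i - x j); nra.
under eq_bigr do rewrite -mulr_suml big_split/= sumr_const.
rewrite -mulr_suml big_split/= sumr_const -sumrMnl -[X in X / _]mulr2n.
rewrite -[X in X / _]mulr_natr mulfK ?pnatr_eq0// mulr_natl.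
by rewrite -sumrMnl.
Qed.

Lemma sum_mul_le (I : finType) (x y : I -> R) :
  (forall i, 0 <= x i) -> (forall i, 0 <= y i) ->
  \sum_i x i * y i <= (\sum_i x i) * \sum_i y i.
Proof.
move=> x0 y0; rewrite mulr_suml; apply: ler_sum => i _.
by rewrite ler_wpM2l// (bigD1 i)//= lerDl sumr_ge0.
Qed.

End finite_sums.

Section squared_norm.
Variables (R : realType) (d : nat).
Implicit Types (X Y Z : 'M[R[i]]_d) (z w : R[i]).

Definition abs_sq z : R := complex.Re z ^+ 2 + complex.Im z ^+ 2.

Lemma abs_sq_ge0 z : 0 <= abs_sq z.
Proof. by rewrite addr_ge0// sqr_ge0. Qed.

Lemma abs_sqM z w : abs_sq (z * w) = abs_sq z * abs_sq w.
Proof. by case: z w => [a b] [a' b']; rewrite /abs_sq/=; ring. Qed.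

Lemma abs_sq_conj z : abs_sq (z^*)%C = abs_sq z.
Proof. by case: z => a b; rewrite /abs_sq/=; ring. Qed.

Lemma ReD z w : complex.Re (z + w) = complex.Re z + complex.Re w.
Proof. by case: z; case: w. Qed.

Lemma ImD z w : complex.Im (z + w) = complex.Im z + complex.Im w.
Proof. by case: z; case: w. Qed.

Lemma Re_sum (I : finType) (f : I -> R[i]) :
  complex.Re (\sum_i f i) = \sum_i complex.Re (f i).
Proof. by apply: (big_morph _ ReD). Qed.

Lemma Im_sum (I : finType) (f : I -> R[i]) :
  complex.Im (\sum_i f i) = \sum_i complex.Im (f i).
Proof. by apply: (big_morph _ ImD). Qed.

Lemma abs_sq_sum (I : finType) (f : I -> R[i]) :
  abs_sq (\sum_i f i) <= #|I|%:R * \sum_i abs_sq (f i).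
Proof.
by rewrite /abs_sq Re_sum Im_sum big_split/= mulrDr lerD// sqr_sum_le.
Qed.

(** The real and imaginary parts of the entries are the real coordinates in
    which the equation is a finite system of scalar equations. *)
Definition coord : finType := ('I_d * 'I_d * bool)%type.

Definition comp (c : coord) X : R :=
  if c.2 then complex.Re (X c.1.1 c.1.2) else complex.Im (X c.1.1 c.1.2).

Definition sqnorm X : R := \sum_(c : coord) comp c X ^+ 2.

Lemma sqnormE X : sqnorm X = \sum_i \sum_j abs_sq (X i j).
Proof.
rewrite /sqnorm pair_big/= -(pair_big xpredT xpredT
  (fun p (b : bool) => comp (p, b) X ^+ 2))/=.
by apply: eq_bigr => p _; rewrite big_bool.
Qed.

Lemma sqnorm_ge0 X : 0 <= sqnorm X.
Proof. by apply: sumr_ge0 => c _; exact: sqr_ge0. Qed.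

Lemma compD c X Y : comp c (X + Y) = comp c X + comp c Y.
Proof. by rewrite /comp mxE; case: ifP => _; rewrite ?ReD ?ImD. Qed.

Lemma compN c X : comp c (- X) = - comp c X.
Proof. by rewrite /comp mxE; case: ifP => _; case: (X _ _). Qed.

Lemma compB c X Y : comp c (X - Y) = comp c X - comp c Y.
Proof. by rewrite compD compN. Qed.

Lemma comp_sqr_le c X : comp c X ^+ 2 <= sqnorm X.
Proof.
by rewrite /sqnorm (bigD1 c)//= lerDl sumr_ge0// => k _; exact: sqr_ge0.
Qed.

Lemma abs_sq_le i j X : abs_sq (X i j) <= sqnorm X.
Proof.
rewrite sqnormE (bigD1 i)//= (bigD1 j)//= -addrA lerDl addr_ge0// sumr_ge0// => *.
  exact: abs_sq_ge0.
by apply: sumr_ge0 => *; exact: abs_sq_ge0.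
Qed.

Lemma frobenius_sqr X : frobenius X ^+ 2 = sqnorm X.
Proof.
have e : sqnorm X = complex.Re (\tr (X *m X ^t*)).
  rewrite sqnormE /mxtrace Re_sum; apply: eq_bigr => i _.
  rewrite mxE Re_sum; apply: eq_bigr => j _.
  by rewrite !mxE; case: (X i j) => a b; rewrite /abs_sq/=; ring.
by rewrite /frobenius sqr_sqrtr -e// sqnorm_ge0.
Qed.

Lemma sqnormD X Y : sqnorm (X + Y) <= 2 * sqnorm X + 2 * sqnorm Y.
Proof.
rewrite /sqnorm !mulr_sumr -big_split/=; apply: ler_sum => c _.
rewrite compD; have h := sqr_ge0 (comp c X - comp c Y); nra.
Qed.

Lemma sqnormN X : sqnorm (- X) = sqnorm X.
Proof. by apply: eq_bigr => c _; rewrite compN sqrrN. Qed.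

Lemma sqnormB X Y : sqnorm (X - Y) <= 2 * sqnorm X + 2 * sqnorm Y.
Proof. by rewrite -(sqnormN Y) sqnormD. Qed.

Lemma sqnormZ z X : sqnorm (z *: X) = abs_sq z * sqnorm X.
Proof.
rewrite !sqnormE mulr_sumr; apply: eq_bigr => i _; rewrite mulr_sumr.
by apply: eq_bigr => j _; rewrite mxE abs_sqM.
Qed.

Lemma sqnorm_adjoint X : sqnorm (X ^t*) = sqnorm X.
Proof.
rewrite !sqnormE exchange_big/=; apply: eq_bigr => i _; apply: eq_bigr => j _.
by rewrite !mxE abs_sq_conj.
Qed.

(** The Frobenius norm is submultiplicative; the weaker form with the factor [d]
    only takes the squared triangle inequality for each entry of the product. *)
Lemma sqnormM X Y : sqnorm (X *m Y) <= d%:R * (sqnorm X * sqnorm Y).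
Proof.
rewrite [sqnorm (X *m Y)]sqnormE.
apply: (@le_trans _ _
  (\sum_i \sum_j (d%:R * \sum_k abs_sq (X i k) * abs_sq (Y k j)))).
  apply: ler_sum => i _; apply: ler_sum => j _; rewrite mxE.
  apply: le_trans (abs_sq_sum _) _; rewrite card_ord ler_wpM2l//.
  by apply: ler_sum => k _; rewrite abs_sqM.
under eq_bigr do rewrite -mulr_sumr.
rewrite -mulr_sumr ler_wpM2l//.
under eq_bigr do rewrite exchange_big/=.
rewrite exchange_big/=.
under eq_bigr do under eq_bigr do rewrite -mulr_sumr.
under eq_bigr do rewrite -mulr_suml.
rewrite !sqnormE [X in _ <= X * _]exchange_big/=.
by apply: sum_mul_le => i; apply: sumr_ge0 => j _; exact: abs_sq_ge0.
Qed.

Lemma abs_sq_trace X : abs_sq (\tr X) <= d%:R * sqnorm X.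
Proof.
apply: le_trans (abs_sq_sum _) _; rewrite card_ord ler_wpM2l// sqnormE.
apply: ler_sum => i _; rewrite (bigD1 i)//= lerDl sumr_ge0// => j _.
exact: abs_sq_ge0.
Qed.

End squared_norm.

(** * Density matrices are bounded *)

Section density.
Variables (R : realType) (d : nat).
Implicit Types (X Y Z : 'M[R[i]]_d).

Lemma sqnormMl X Y x y : sqnorm X <= x -> sqnorm Y <= y ->
  sqnorm (X *m Y) <= d%:R * (x * y).
Proof.
move=> Xx Yy; apply: le_trans (sqnormM _ _) _; rewrite ler_wpM2l//.
by rewrite ler_pM// sqnorm_ge0.
Qed.

Let bilin (rho : 'M[R[i]]_d) (x y : 'cV[R[i]]_d) : R[i] := (x ^t* *m rho *m y) ord0 ord0.

Let bilin_delta (rho : 'M[R[i]]_d) i j : bilin rho (delta_mx i ord0) (delta_mx j ord0) = rho i j.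
Proof.
rewrite /bilin; have -> : (delta_mx i ord0 : 'cV[R[i]]_d) ^t* = delta_mx ord0 i.
  apply/matrixP => k l; rewrite !mxE.
  by rewrite andbC; case: (_ && _); rewrite ?conjC1 ?conjC0.
by rewrite -rowE -colE !mxE.
Qed.

Let bilinDl (rho : 'M[R[i]]_d) x x' y : bilin rho (x + x') y = bilin rho x y + bilin rho x' y.
Proof.
rewrite /bilin; have -> : (x + x') ^t* = x ^t* + x' ^t*.
  by apply/matrixP => k l; rewrite !mxE rmorphD.
by rewrite !mulmxDl mxE.
Qed.

Let bilinDr (rho : 'M[R[i]]_d) x y y' : bilin rho x (y + y') = bilin rho x y + bilin rho x y'.
Proof. by rewrite /bilin mulmxDr mxE. Qed.

Let bilinZl (rho : 'M[R[i]]_d) z x y : bilin rho (z *: x) y = z^* * bilin rho x y.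
Proof.
rewrite /bilin; have -> : (z *: x) ^t* = z^* *: x ^t*.
  by apply/matrixP => k l; rewrite !mxE rmorphM.
by rewrite -!scalemxAl mxE.
Qed.

Let bilinZr (rho : 'M[R[i]]_d) z x y : bilin rho x (z *: y) = z * bilin rho x y.
Proof. by rewrite /bilin -scalemxAr mxE. Qed.

Let density_diag (rho : 'M[R[i]]_d) i : density_matrix rho ->
  0 <= complex.Re (rho i i) <= 1.
Proof.
move=> [pos tr1 _].
have ge0 k : 0 <= complex.Re (rho k k).
  have := pos (delta_mx k ord0); rewrite -/(bilin _ _ _) bilin_delta.
  by rewrite lecE => /andP[].
rewrite ge0/=; have := congr1 (@complex.Re R) tr1; rewrite Re_sum => /= <-.
by rewrite (bigD1 i)//= lerDl sumr_ge0.
Qed.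

(** Positivity on the vectors [e_i + zeta e_j] with [zeta] a fourth root of
    unity. *)
Lemma density_comp_le1 (rho : 'M[R[i]]_d) (c : coord d) : density_matrix rho -> `|comp c rho| <= 1.
Proof.
move=> rhoP; have [pos _ herm] := rhoP.
have key z : 0 <= complex.Re (rho c.1.1 c.1.1) + complex.Re (z * rho c.1.1 c.1.2)
    + complex.Re (z^* * rho c.1.2 c.1.1) + complex.Re (z^* * (z * rho c.1.2 c.1.2)).
  have := pos (delta_mx c.1.1 ord0 + z *: delta_mx c.1.2 ord0).
  rewrite -/(bilin _ _ _) !(bilinDl, bilinDr, bilinZl, bilinZr, bilin_delta).
  rewrite lecE => /andP[_] /=; by rewrite mulrDr !ReD/= !addrA.
have rhoC : rho c.1.2 c.1.1 = (rho c.1.1 c.1.2)^*.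
  by rewrite -{1}herm !mxE.
have /andP[i0 i1] := density_diag c.1.1 rhoP.
have /andP[j0 j1] := density_diag c.1.2 rhoP.
have k1 := key 1; have k2 := key (-1); have k3 := key 'i%C; have k4 := key (- 'i%C).
move: k1 k2 k3 k4; rewrite rhoC /comp.
case: (rho c.1.1 c.1.2) => a b; move: i0 i1 j0 j1.
case: (rho c.1.1 c.1.1) => a1 b1; case: (rho c.1.2 c.1.2) => a2 b2.
rewrite /= => *.
by case: c.2 => /=; rewrite ler_norml; apply/andP; split; lra.
Qed.

Lemma sqnorm_density (rho : 'M[R[i]]_d) : density_matrix rho -> sqnorm rho <= #|coord d|%:R.
Proof.
move=> rhoP; rewrite -sum1_card natr_sum; apply: ler_sum => c _.
by rewrite -real_normK ?num_real// expr_le1// density_comp_le1.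
Qed.

End density.

(** * Lipschitz bounds for the coefficients of the equation *)

Section coefficients.
Variables (R : realType) (d : nat).
Implicit Types (X Y Z K L rho : 'M[R[i]]_d) (a : pair_kernel R d) (c : coord d).

Lemma sqnorm_commutator X Y :
  sqnorm (commutator X Y) <= 4 * d%:R * (sqnorm X * sqnorm Y).
Proof.
apply: le_trans (sqnormB _ _) _.
have := sqnormM X Y; have := sqnormM Y X; lra.
Qed.

Lemma sqnorm_anticommutator X Y :
  sqnorm (anticommutator X Y) <= 4 * d%:R * (sqnorm X * sqnorm Y).
Proof.
apply: le_trans (sqnormD _ _) _.
have := sqnormM X Y; have := sqnormM Y X; lra.
Qed.

Definition diffusion_lip (l : R) : R :=
  8 * d%:R * l + 32 * d%:R ^+ 2 * l * #|coord d|%:R.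

Let subr_scaled (V : lmodType R[i]) (z h : R[i]) (x1 x2 y1 y2 z1 z2 : V) :
  - (z *: x1) + (y1 - h *: z1) - (- (z *: x2) + (y2 - h *: z2)) =
  - (z *: (x1 - x2)) + (y1 - y2 - h *: (z1 - z2)).
Proof.
rewrite !scalerBr !opprB opprD opprK addrACA; congr (_ + _); first exact: addrC.
by rewrite opprB [X in _ + X = _]addrC addrACA; congr (_ + _); exact: addrC.
Qed.

(** The only nonlinear term is quadratic, and density matrices form a bounded
    set. *)
Lemma diffusion_lipschitz (eta : R) L rho1 rho2 : 0 <= eta <= 1 ->
  density_matrix rho1 -> density_matrix rho2 ->
  sqnorm (diffusion eta L rho1 - diffusion eta L rho2)
    <= diffusion_lip (sqnorm L) * sqnorm (rho1 - rho2).
Proof.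
move=> /andP[eta0 eta1] /sqnorm_density r1 /sqnorm_density r2.
set del := rho1 - rho2; set S := L + L ^t*.
have -> : diffusion eta L rho1 - diffusion eta L rho2 =
    (Num.sqrt eta)%:C *: (L *m del + del *m L ^t* -
      (\tr (S *m del) *: rho1 + \tr (S *m rho2) *: del)).
  rewrite /diffusion -scalerBr -/S /del; congr (_ *: _).
  rewrite !mulmxBr !mulmxBl [\tr (S *m rho1 - _)]raddfB/= scalerBl scalerBr.
  move: (L *m rho1) (L *m rho2) (rho1 *m _) (rho2 *m _) (_ *: rho1) (_ *: rho2).
  move: (_ *: rho1) => e a1 a2 b1 b2 c1 c2.
  apply/matrixP => i j; rewrite !mxE; ring.
rewrite sqnormZ {1}/abs_sq/= expr0n/= addr0 sqr_sqrtr//.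
have S4 : sqnorm S <= 4 * sqnorm L.
  by apply: le_trans (sqnormD _ _) _; rewrite sqnorm_adjoint; lra.
have x0 := sqnorm_ge0 del; have l0 := sqnorm_ge0 L.
have d0 : 0 <= d%:R :> R by [].
have M0 : 0 <= #|coord d|%:R :> R by [].
rewrite -[leRHS]mul1r ler_pM// ?sqnorm_ge0//.
apply: le_trans (sqnormB _ _) _.
have h1 : sqnorm (L *m del + del *m L ^t*) <= 4 * d%:R * (sqnorm L * sqnorm del).
  apply: le_trans (sqnormD _ _) _.
  have := sqnormM L del; have := sqnormM del (L ^t*); rewrite sqnorm_adjoint; lra.
have h2 : sqnorm (\tr (S *m del) *: rho1 + \tr (S *m rho2) *: del) <=
    16 * (d%:R ^+ 2 * sqnorm L * #|coord d|%:R * sqnorm del).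
  apply: le_trans (sqnormD _ _) _; rewrite !sqnormZ.
  have t Z : abs_sq (\tr (S *m Z)) <= d%:R * (d%:R * (4 * sqnorm L * sqnorm Z)).
    by apply: le_trans (abs_sq_trace _) _; rewrite ler_wpM2l// sqnormMl.
  have t1 := ler_pM (abs_sq_ge0 _) (sqnorm_ge0 _) (t del) r1.
  have t2 : abs_sq (\tr (S *m rho2)) <=
      d%:R * (d%:R * (4 * sqnorm L * #|coord d|%:R)).
    apply: le_trans (t rho2) _; do 2 rewrite ler_wpM2l//.
    by rewrite ler_wpM2l// mulr_ge0.
  have t3 := ler_pM (abs_sq_ge0 _) (sqnorm_ge0 _) t2 (lexx (sqnorm del)).
  apply: le_trans (lerD (ler_wpM2l _ t1) (ler_wpM2l _ t3)) _ => //.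
  rewrite le_eqVlt; apply/orP; left; apply/eqP; ring.
apply: le_trans (lerD (ler_wpM2l _ h1) (ler_wpM2l _ h2)) _ => //.
rewrite /diffusion_lip le_eqVlt; apply/orP; left; apply/eqP; ring.
Qed.

Definition drift_lip (l k : R) : R := 16 * d%:R * k + 8 * d%:R ^+ 2 * l ^+ 2.

(** The difference is a commutator of [K1 - K2] with the bounded matrix [rho1], plus
    a linear map of [rho1 - rho2] with coefficients [K2] and [L].  Through [K1 - K2]
    the graphons and the means enter. *)
Lemma drift_lipschitz L K1 K2 rho1 rho2 :
  density_matrix rho1 ->
  sqnorm (drift L K1 rho1 - drift L K2 rho2)
    <= 16 * d%:R * #|coord d|%:R * sqnorm (K1 - K2)
       + drift_lip (sqnorm L) (sqnorm K2) * sqnorm (rho1 - rho2).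
Proof.
move=> /sqnorm_density r1; set del := rho1 - rho2.
have -> : drift L K1 rho1 - drift L K2 rho2 =
    - ('i%C *: (commutator (K1 - K2) rho1 + commutator K2 del)) +
    (L *m del *m L ^t* - 2^-1 *: anticommutator (L ^t* *m L) del).
  have eC : commutator K1 rho1 - commutator K2 rho2 =
      commutator (K1 - K2) rho1 + commutator K2 del.
    rewrite /commutator /del !(mulmxBr, mulmxBl) [RHS]addrACA subrKA -opprD subrKA.
    by rewrite !opprB addrACA [RHS]addrACA [- _ - _]addrC.
  have eA X : anticommutator X rho1 - anticommutator X rho2 = anticommutator X del.
    by rewrite /anticommutator /del mulmxBr mulmxBl opprD addrACA.
  have eL : L *m rho1 *m L ^t* - L *m rho2 *m L ^t* = L *m del *m L ^t*.
    by rewrite /del mulmxBr mulmxBl.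
  by rewrite -eL -(eA (L ^t* *m L)) -eC; exact: subr_scaled.
apply: le_trans (sqnormD _ _) _; rewrite sqnormN sqnormZ.
have -> : abs_sq ('i%C : R[i]) = 1 by rewrite /abs_sq/= expr0n expr1n/= add0r.
rewrite mul1r.
have x0 := sqnorm_ge0 del; have l0 := sqnorm_ge0 L; have k0 := sqnorm_ge0 K2.
have e0 := sqnorm_ge0 (K1 - K2).
have d0 : 0 <= d%:R :> R by [].
have M0 : 0 <= #|coord d|%:R :> R by [].
have h1 : sqnorm (commutator (K1 - K2) rho1 + commutator K2 del) <=
    2 * (4 * d%:R * (sqnorm (K1 - K2) * #|coord d|%:R))
    + 2 * (4 * d%:R * (sqnorm K2 * sqnorm del)).
  apply: le_trans (sqnormD _ _) _; apply: lerD; rewrite ler_wpM2l//.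
    apply: le_trans (sqnorm_commutator _ _) _.
    by rewrite ler_wpM2l ?mulr_ge0// ler_wpM2l.
  exact: sqnorm_commutator.
have h2 : sqnorm (L *m del *m L ^t*) <=
    d%:R * (d%:R * (sqnorm L * sqnorm del) * sqnorm L).
  by rewrite sqnormMl ?sqnormM// sqnorm_adjoint.
have h3 : sqnorm (2^-1 *: anticommutator (L ^t* *m L) del) <=
    4^-1 * (4 * d%:R * (d%:R * (sqnorm L * sqnorm L) * sqnorm del)).
  rewrite sqnormZ; have -> : abs_sq (2^-1 : R[i]) = 4^-1.
    have -> : (2^-1 : R[i]) = (2^-1)%:C.
      by rewrite -[2 in LHS](rmorph_nat (@real_complex R)) -fmorphV.
    by rewrite /abs_sq/= expr0n/= addr0; field.
  rewrite ler_wpM2l// ?invr_ge0//.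
  apply: le_trans (sqnorm_anticommutator _ _) _.
  rewrite ler_wpM2l ?mulr_ge0// ler_wpM2r//.
  by apply: le_trans (sqnormM _ _) _; rewrite sqnorm_adjoint.
have h4 := le_trans (sqnormB _ _) (lerD (ler_wpM2l (ler0n _ 2) h2) (ler_wpM2l (ler0n _ 2) h3)).
apply: le_trans (lerD (ler_wpM2l _ h1) (ler_wpM2l _ h4)) _ => //.
by rewrite /drift_lip le_eqVlt; apply/orP; left; apply/eqP; field.
Qed.

(** Matrix of the real-linear map [rho |-> A^rho] in the coordinates [comp]. *)
Definition mean_field_coef a c c' : R :=
  let z := a c.1.1 c'.1.1 c.1.2 c'.1.2 in
  if c.2 then (if c'.2 then complex.Re z else complex.Im z)
  else (if c'.2 then complex.Im z else - complex.Re z).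

Lemma comp_mean_field a c X :
  comp c (mean_field a X) = \sum_c' mean_field_coef a c c' * comp c' X.
Proof.
pose G (p : 'I_d * 'I_d) (b : bool) := mean_field_coef a c (p, b) * comp (p, b) X.
rewrite (eq_bigr (fun c' : coord d => G c'.1 c'.2)); last by case.
rewrite -(pair_big xpredT xpredT G)/= /comp mxE.
rewrite -(pair_big xpredT xpredT (fun y y' => \sum_b G (y, y') b))/=.
case E : c.2; rewrite ?Re_sum ?Im_sum; apply: eq_bigr => y _;
  rewrite ?Re_sum ?Im_sum; apply: eq_bigr => y' _;
  rewrite big_bool/= /G /mean_field_coef /comp E/=;
  case: (a _ _ _ _) => ? ?; case: (X y y') => ? ? /=; ring.
Qed.

(** Up to sign, a coefficient is the real or imaginary part of an entry of the
    matrix of [A]. *)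
Lemma mean_field_coef_le a c c' :
  mean_field_coef a c c' ^+ 2 <= pair_operator_norm a ^+ 2.
Proof.
have h : abs_sq (a c.1.1 c'.1.1 c.1.2 c'.1.2) <= pair_operator_norm a ^+ 2.
  rewrite /pair_operator_norm frobenius_sqr.
  have := abs_sq_le (mxvec_index c.1.2 c'.1.2) (mxvec_index c.1.1 c'.1.1)
    (lin_mx (pair_operator a)).
  rewrite /lin_mx mxE/= mxvecE vec_mx_delta mxE.
  rewrite (bigD1 c.1.2)//= (bigD1 c'.1.2)//= mxE !eqxx mulr1.
  rewrite [X in _ + X + _]big1 ?addr0; last first.
    by move=> y /negbTE yE; rewrite mxE yE andbF mulr0.
  rewrite [X in _ + X]big1 ?addr0//.
  by move=> x /negbTE xE; apply: big1 => y _; rewrite mxE xE mulr0.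
apply: le_trans h; rewrite /mean_field_coef /abs_sq.
by case: c.2; case: c'.2 => /=; rewrite ?sqrrN ?lerDl ?lerDr sqr_ge0.
Qed.

Lemma sqnorm_mean_field a X :
  sqnorm (mean_field a X)
    <= #|coord d|%:R ^+ 2 * pair_operator_norm a ^+ 2 * sqnorm X.
Proof.
rewrite {1}/sqnorm; apply: (@le_trans _ _ (\sum_(c : coord d)
    #|coord d|%:R * (pair_operator_norm a ^+ 2 * sqnorm X))).
  apply: ler_sum => c _; rewrite comp_mean_field.
  apply: le_trans (sqr_sum_le _) _; rewrite ler_wpM2l// mulr_sumr.
  by apply: ler_sum => c' _; rewrite exprMn ler_wpM2r ?sqr_ge0// mean_field_coef_le.
by rewrite sumr_const -[leLHS]mulr_natl [_%:R ^+ 2]expr2 -!mulrA.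
Qed.

Lemma mean_fieldB a X Y : mean_field a (X - Y) = mean_field a X - mean_field a Y.
Proof.
apply/matrixP => i j; rewrite !mxE -sumrB; apply: eq_bigr => k _.
by rewrite -sumrB; apply: eq_bigr => l _; rewrite !mxE rmorphB mulrBr.
Qed.

End coefficients.

Ltac nonneg := repeat first [done | apply: sqr_ge0 | apply: addr_ge0 | apply: mulr_ge0].

Lemma drift_lip_ge0 (R : realType) d (l k : R) : 0 <= k -> 0 <= drift_lip d l k.
Proof. by move=> k0; rewrite /drift_lip; nonneg. Qed.

Lemma diffusion_lip_ge0 (R : realType) d (l : R) : 0 <= l -> 0 <= diffusion_lip d l.
Proof. by move=> l0; rewrite /diffusion_lip; nonneg. Qed.

(** * Moments of centred normal laws *)

Section normal_moments.
Variable R : realType.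
Local Notation mu := (@lebesgue_measure R).

Lemma integral_normal_prob (s : R) (f : R -> \bar R) :
  measurable_fun setT f -> (forall x, 0 <= f x)%E ->
  (\int[normal_prob 0 s]_x f x = \int[mu]_x (f x * (normal_pdf 0 s x)%:E))%E.
Proof.
move=> mf f0.
pose nu : {finite_measure set _ -> \bar R} := normal_prob 0 s.
have dom : nu `<< mu := normal_prob_dominates 0 s.
have -> : (\int[normal_prob 0 s]_x f x = \int[nu]_x f x)%E by [].
rewrite -(Radon_Nikodym_SigmaFinite.change_of_variables dom)//.
apply: ae_eq_integral => //.
- apply: emeasurable_funM => //; apply: (measurable_int mu).
  exact: Radon_Nikodym_SigmaFinite.f_integrable.
- apply: emeasurable_funM => //=; apply/measurableT_comp => //=.
  exact: measurable_normal_pdf.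
- apply: ae_eqe_mul2l => /=; apply: integral_ae_eq => //=.
  + exact: Radon_Nikodym_SigmaFinite.f_integrable.
  + by apply/measurableT_comp => //; exact: measurable_normal_pdf.
  + by move=> E _ mE; rewrite -Radon_Nikodym_SigmaFinite.f_integral.
Qed.

Definition normal_var : \bar R := (\int[normal_prob 0 1]_x (x ^+ 2)%:E)%E.

(** Substitution [x = s y]. *)
Lemma normal_var_scale (s : R) : 0 < s ->
  (\int[normal_prob 0 s]_x (x ^+ 2)%:E = (s ^+ 2)%:E * normal_var)%E.
Proof.
move=> s0; have s1 : s != 0 by rewrite gt_eqF.
have sq0 (x : R) : (0 <= (x ^+ 2)%:E)%E by rewrite lee_fin sqr_ge0.
have msq : measurable_fun [set: R] (fun x : R => (x ^+ 2)%:E).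
  by apply/measurable_EFinP; exact: measurable_funX.
rewrite /normal_var !integral_normal_prob//.
pose G (x : R) := x ^+ 2 * normal_pdf 0 s x.
pose F (x : R) := s * x.
have dF (x : R) : is_derive x 1 F s.
  have := @is_deriveZ R R R id s x 1 1 (is_derive_id _ _).
  by rewrite [_ *: _]mulr1.
have F' : F^`()%classic = cst s.
  by apply/funext => x; rewrite derive1E; case: (dF x).
have G0 x : 0 <= G x by rewrite mulr_ge0 ?sqr_ge0// normal_pdf_ge0.
transitivity (\int[mu]_x (G x)%:E)%E; first by apply: eq_integral => x _; rewrite EFinM.
rewrite (increasing_ge0_integration_by_substitutionT (F := F))//.
- rewrite -ge0_integralZl//=; last 2 first.
  + apply: emeasurable_funM => //; apply/measurable_EFinP.
    exact: measurable_normal_pdf.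
  + by move=> x _; rewrite mule_ge0// lee_fin normal_pdf_ge0.
  apply: eq_integral => x _; rewrite F' /= /G /F -!EFinM; congr _%:E.
  rewrite !normal_pdfE// /normal_fun /normal_peak !fctE/= !subr0.
  have -> : - (s * x) ^+ 2 / (s ^+ 2 *+ 2) = - x ^+ 2 / (1 ^+ 2 *+ 2).
    rewrite expr1n -[s ^+ 2 *+ 2]mulr_natr -[1 *+ 2]/(2:R).
    by field.
  have -> : Num.sqrt (s ^+ 2 * pi *+ 2) = s * Num.sqrt (1 ^+ 2 * pi *+ 2).
    by rewrite expr1n mul1r -mulrnAr sqrtrM ?sqr_ge0// sqrtr_sqr ger0_norm// ltW.
  have p0 : Num.sqrt (1 ^+ 2 * pi *+ 2) != 0 :> R.
    by rewrite gt_eqF// sqrtr_gt0 expr1n mul1r pmulrn_lgt0// pi_gt0.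
  move: p0; set p := Num.sqrt _; set e := expR _ => p0.
  by field; rewrite p0 s1.
- by move=> x y xy; rewrite /F ltr_pM2l.
- by rewrite F' => ?; exact: cvg_cst.
- by rewrite F'; exact: is_cvg_cst.
- by rewrite F'; exact: is_cvg_cst.
- by apply: gt0_cvgMrNy => //; exact: cvg_id.
- by apply: gt0_cvgMry => //; exact: cvg_id.
- move=> x; apply: cvgM; first exact: exprn_continuous.
  exact: continuous_normal_pdf.
Qed.

(** Half of the exponent absorbs the weight, as
    [x^2 <= 4 e^(x^2/4)], which leaves a multiple of the density of variance 2. *)
Lemma normal_var_fin : normal_var \is a fin_num.
Proof.
have nv0 : (0 <= normal_var)%E.
  by apply: integral_ge0 => x _; rewrite lee_fin sqr_ge0.
rewrite ge0_fin_numE// /normal_var integral_normal_prob//; last 2 first.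
- by apply/measurable_EFinP; exact: measurable_funX.
- by move=> x; rewrite lee_fin sqr_ge0.
pose r : R := Num.sqrt 2.
have r0 : r != 0 by rewrite gt_eqF// sqrtr_gt0.
have r2 : r ^+ 2 = 2 by rewrite sqr_sqrtr.
pose k : R := 4 * normal_peak 1 / normal_peak r.
have key (x : R) : x ^+ 2 * normal_pdf 0 1 x <= k * normal_pdf 0 r x.
  rewrite !normal_pdfE// /normal_fun !subr0 r2.
have := normal_peak_gt0 r0; have := @normal_peak_gt0 R 1 (oner_neq0 _).
rewrite /k; set p1 := normal_peak 1; set pr := normal_peak r => p10 pr0.
have z0 : 0 <= x ^+ 2 by exact: sqr_ge0.
move: (x ^+ 2) z0 => z z0; rewrite mulrCA -[4 * p1]mulrC -!mulrA ler_wpM2l ?(ltW p10)//.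
rewrite mulKf ?gt_eqF//.
pose y := z / 4.
have -> : - z / (1 ^+ 2 *+ 2) = - y + - y.
  by rewrite expr1n -[1 *+ 2]/(2:R) /y; field.
have -> : - z / (2 *+ 2) = - y.
  by rewrite -[2 *+ 2]mulr_natr /y; field.
have -> : z = 4 * y by rewrite /y; field.
rewrite expRD mulrA ler_wpM2r ?expR_ge0//.
rewrite -mulrA ler_piMr// expRN ler_pdivrMr ?expR_gt0// mul1r.
by apply: le_trans (expR_ge1Dx y); rewrite lerDr.
apply: (@le_lt_trans _ _ (\int[mu]_x (k%:E * (normal_pdf 0 r x)%:E))%E); last first.
  rewrite integralZl//=; last exact: integrable_normal_pdf.
  by rewrite integral_normal_pdf mule1 ltry.
apply: ge0_le_integral => //=.
- by move=> x _; rewrite mule_ge0// lee_fin ?sqr_ge0// normal_pdf_ge0.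
- apply: emeasurable_funM; apply/measurable_EFinP; first exact: measurable_funX.
  exact: measurable_normal_pdf.
- apply: emeasurable_funM; apply/measurable_EFinP => //.
  exact: measurable_normal_pdf.
by move=> x _; rewrite -!EFinM lee_fin key.
Qed.

Definition normal_moment2 : R := fine normal_var.

Lemma normal_moment2_ge0 : 0 <= normal_moment2.
Proof. by rewrite fine_ge0// integral_ge0// => x _; rewrite lee_fin sqr_ge0. Qed.

Lemma integral_normal_sqr (s : R) : 0 < s ->
  (\int[normal_prob 0 s]_x (x ^+ 2)%:E = (s ^+ 2 * normal_moment2)%:E)%E.
Proof. by move=> s0; rewrite normal_var_scale// [RHS]EFinM fineK// normal_var_fin. Qed.

Lemma normal_prob_opp (s : R) (A : set R) : 0 < s -> measurable A ->
  normal_prob 0 s (-%R @^-1` A) = normal_prob 0 s A.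
Proof.
move=> s0 mA; rewrite /normal_prob.
have mopp : measurable_fun setT (-%R : R -> measurableTypeR R).
  exact: oppr_measurable.
transitivity (\int[pushforward mu (-%R : R -> measurableTypeR R)]_(x in A)
    (normal_pdf 0 s x)%:E)%E.
  rewrite ge0_integral_pushforward//=.
  - apply: eq_integral => x _; congr _%:E.
    by rewrite !normal_pdfE ?gt_eqF// /normal_fun !subr0 sqrrN.
  - by apply/measurable_EFinP/measurable_funTS; exact: measurable_normal_pdf.
  - by move=> x _; rewrite lee_fin normal_pdf_ge0.
by apply: eq_measure_integral => B mB _; exact: lebesgue_measureN.
Qed.

End normal_moments.

(** * Square-integrable and independent random variables *)

Section real_integrals.
Context d (T : measurableType d) (R : realType) (mu : {measure set T -> \bar R}).
Variables (D : set T) (mD : measurable D).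
Implicit Types (X Y : T -> R).

Lemma measurable_sqrE X : measurable_fun D X ->
  measurable_fun D (fun w => (X w ^+ 2)%:E).
Proof. by move=> mX; apply/measurable_EFinP; exact: measurable_funX. Qed.

Lemma integrableDR X Y :
  mu.-integrable D (EFin \o X) -> mu.-integrable D (EFin \o Y) ->
  mu.-integrable D (EFin \o (fun w => X w + Y w)).
Proof. by move=> iX iY; exact: (integrableD mD iX iY). Qed.

Lemma integrableZR (r : R) X : mu.-integrable D (EFin \o X) ->
  mu.-integrable D (EFin \o (fun w => r * X w)).
Proof. by move=> iX; exact: (integrableZl mD _ iX). Qed.

Lemma integrable_sumR (I : Type) (s : seq I) (X : I -> T -> R) :
  (forall i, mu.-integrable D (EFin \o X i)) ->
  mu.-integrable D (EFin \o (fun w => \sum_(i <- s) X i w)).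
Proof.
move=> iX; rewrite (_ : _ \o _ = (fun w => \sum_(i <- s) (X i w)%:E)%E).
  by apply: integrable_sum => // i _; exact: iX.
by apply/funext => w; rewrite /= sumEFin.
Qed.

Lemma Rintegral_sum (I : Type) (s : seq I) (X : I -> T -> R) :
  (forall i, mu.-integrable D (EFin \o X i)) ->
  \int[mu]_(w in D) (\sum_(i <- s) X i w) = \sum_(i <- s) \int[mu]_(w in D) X i w.
Proof.
move=> iX; elim: s => [|i s IH].
  by under eq_Rintegral do rewrite big_nil; rewrite Rintegral_cst// mul0r big_nil.
under eq_Rintegral do rewrite big_cons.
by rewrite RintegralD// ?big_cons ?IH//; exact: integrable_sumR.
Qed.

Lemma integral_EFin X : mu.-integrable D (EFin \o X) ->
  (\int[mu]_(w in D) (X w)%:E = (\int[mu]_(w in D) X w)%:E)%E.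
Proof. by move=> iX; rewrite fineK// integrable_fin_num. Qed.

Lemma bounded_integrableR (M : R) X : (mu D < +oo)%E -> measurable_fun D X ->
  (forall w, D w -> `|X w| <= M) -> mu.-integrable D (EFin \o X).
Proof.
move=> fin mX XM; apply: measurable_bounded_integrable => //.
exists M; split; first exact: num_real.
by move=> x Mx w Dw; apply: le_trans (XM _ Dw) (ltW Mx).
Qed.

End real_integrals.

Section square_integrable.
Context d (T : measurableType d) (R : realType) (P : probability T R).
Implicit Types (X Y : T -> R).

Definition sqint X : Prop :=
  measurable_fun setT X /\ (\int[P]_w ((X w) ^+ 2)%:E < +oo)%E.

Definition bounded_rv X : Prop :=
  measurable_fun setT X /\ exists M, forall w, `|X w| <= M.

Lemma integrable_dom X Y : measurable_fun setT X ->
  P.-integrable setT (EFin \o Y) -> (forall w, `|X w| <= Y w) ->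
  P.-integrable setT (EFin \o X).
Proof.
move=> mX iY XY; apply: le_integrable iY => //; first exact/measurable_EFinP.
by move=> w _ /=; rewrite lee_fin (le_trans (XY w))// ler_norm.
Qed.

Lemma bounded_integrable X : bounded_rv X -> P.-integrable setT (EFin \o X).
Proof.
move=> [mX [M XM]]; apply: (@integrable_dom _ (fun=> M)) => //.
exact: finite_measure_integrable_cst.
Qed.

Lemma sqint_integrable_sqr X : sqint X ->
  P.-integrable setT (EFin \o (fun w => X w ^+ 2)).
Proof.
move=> [mX Xfin]; apply/integrableP; split; first exact: measurable_sqrE.
by under eq_integral do rewrite /= ger0_norm ?sqr_ge0//.
Qed.

Lemma integrable_sqr_sqint X : measurable_fun setT X ->
  P.-integrable setT (EFin \o (fun w => X w ^+ 2)) -> sqint X.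
Proof.
move=> mX /integrableP[_]; under eq_integral do rewrite /= ger0_norm ?sqr_ge0//.
by split.
Qed.

Lemma integrable_mul X Y : sqint X -> sqint Y ->
  P.-integrable setT (EFin \o (fun w => X w * Y w)).
Proof.
move=> sX sY; have [mX _] := sX; have [mY _] := sY.
apply: (@integrable_dom _ (fun w => X w ^+ 2 + Y w ^+ 2)).
- exact: measurable_funM.
- by apply: integrableDR => //; exact: sqint_integrable_sqr.
move=> w; rewrite normrM -(real_normK (num_real (X w))) -(real_normK (num_real (Y w))).
have := normr_ge0 (X w); have := normr_ge0 (Y w).
move: `|X w| `|Y w| => a b b0 a0; have h := sqr_ge0 (a - b).
rewrite sqrrB in h; have : 0 <= a * b by exact: mulr_ge0.
lra.
Qed.

Lemma sqintD X Y : sqint X -> sqint Y -> sqint (fun w => X w + Y w).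
Proof.
move=> sX sY; have [mX _] := sX; have [mY _] := sY.
apply: integrable_sqr_sqint; first exact: measurable_funD.
apply: (@integrable_dom _ (fun w => X w ^+ 2 + Y w ^+ 2 + (X w ^+ 2 + Y w ^+ 2))).
- by apply: measurable_funX; exact: measurable_funD.
- have i : P.-integrable setT (EFin \o (fun w => X w ^+ 2 + Y w ^+ 2)).
    by apply: integrableDR => //; exact: sqint_integrable_sqr.
  exact: integrableDR.
move=> w; rewrite ger0_norm ?sqr_ge0//; have h := sqr_ge0 (X w - Y w).
by rewrite sqrrB in h; rewrite sqrrD; lra.
Qed.

Lemma sqintM X Y : bounded_rv X -> sqint Y -> sqint (fun w => X w * Y w).
Proof.
move=> [mX [M XM]] sY; have [mY _] := sY.
apply: integrable_sqr_sqint; first exact: measurable_funM.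
apply: (@integrable_dom _ (fun w => M ^+ 2 * Y w ^+ 2)).
- by apply: measurable_funX; exact: measurable_funM.
- by apply: integrableZR => //; exact: sqint_integrable_sqr.
move=> w; rewrite ger0_norm ?sqr_ge0// exprMn ler_wpM2r ?sqr_ge0//.
rewrite -(real_normK (num_real (X w))) lerXn2r// nnegrE.
exact: le_trans (XM w).
Qed.

Lemma bounded_cst (r : R) : bounded_rv (fun=> r).
Proof. by split => //; exists `|r|. Qed.

Lemma bounded_sqint X : bounded_rv X -> sqint X.
Proof.
move=> bX; rewrite (_ : X = fun w => X w * 1); last by apply/funext => w; rewrite mulr1.
apply: sqintM => //; apply: integrable_sqr_sqint => //.
by apply: bounded_integrable; under eq_fun do rewrite expr1n; exact: bounded_cst.
Qed.

Lemma boundedM X Y : bounded_rv X -> bounded_rv Y -> bounded_rv (fun w => X w * Y w).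
Proof.
move=> [mX [M XM]] [mY [N YN]]; split; first exact: measurable_funM.
by exists (M * N) => w; rewrite normrM ler_pM.
Qed.

Lemma sqintN X : sqint X -> sqint (fun w => - X w).
Proof.
move=> sX; rewrite (_ : (fun w => - X w) = fun w => -1 * X w).
  by apply: sqintM => //; exact: bounded_cst.
by apply/funext => w; rewrite mulN1r.
Qed.

Lemma sqintB X Y : sqint X -> sqint Y -> sqint (fun w => X w - Y w).
Proof. by move=> sX sY; apply: sqintD => //; exact: sqintN. Qed.

Lemma sqint_sum (I : Type) (s : seq I) (X : I -> T -> R) :
  (forall i, sqint (X i)) -> sqint (fun w => \sum_(i <- s) X i w).
Proof.
move=> sX; elim: s => [|i s IH].
  by under eq_fun do rewrite big_nil; apply: bounded_sqint; exact: bounded_cst.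
by under eq_fun do rewrite big_cons; exact: sqintD.
Qed.

Lemma sqint_max X Y : sqint X -> sqint Y -> sqint (fun w => Num.max (X w) (Y w)).
Proof.
move=> sX sY; have [mX _] := sX; have [mY _] := sY.
apply: integrable_sqr_sqint; first exact: measurable_maxr.
apply: (@integrable_dom _ (fun w => X w ^+ 2 + Y w ^+ 2)).
- by apply: measurable_funX; exact: measurable_maxr.
- by apply: integrableDR => //; exact: sqint_integrable_sqr.
move=> w; rewrite ger0_norm ?sqr_ge0//.
by case: (leP (X w) (Y w)) => _; rewrite ?lerDl ?lerDr sqr_ge0.
Qed.

End square_integrable.

Section independent.
Context d (T : measurableType d) (R : realType) (P : probability T R).
Implicit Types (X Y : T -> R).

Definition indep X Y : Prop := forall A B : set R, measurable A -> measurable B ->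
  P (X @^-1` A `&` Y @^-1` B) = (P (X @^-1` A) * P (Y @^-1` B))%E.

Lemma indep_sqr X Y : indep X Y -> indep X (fun w => Y w ^+ 2).
Proof.
move=> XY A B mA mB; rewrite -(XY A ((fun x : R => x ^+ 2) @^-1` B))//.
rewrite -[X in measurable X]setTI.
exact: (@measurable_funX _ _ R setT id 2 (@measurable_id _ _ _)).
Qed.

(** The joint law of independent variables is a product measure, so this is
    Fubini's theorem. *)
Lemma integral_indep X Y : indep X Y ->
  P.-integrable setT (EFin \o X) -> P.-integrable setT (EFin \o Y) ->
  P.-integrable setT (EFin \o (fun w => X w * Y w)) /\
  \int[P]_w (X w * Y w) = (\int[P]_w X w) * (\int[P]_w Y w).
Proof.
move=> XY iX iY.
have mX : measurable_fun setT X by apply/measurable_EFinP; exact: measurable_int iX.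
have mY : measurable_fun setT Y by apply/measurable_EFinP; exact: measurable_int iY.
have mXY : measurable_fun setT (fun w => (X w, Y w)) by exact: measurable_fun_pair.
pose X' : {mfun T >-> R} := HB.pack X (isMeasurableFun.Build _ _ _ _ _ mX).
pose Y' : {mfun T >-> R} := HB.pack Y (isMeasurableFun.Build _ _ _ _ _ mY).
pose Z' : {mfun T >-> (R * R)%type} :=
  HB.pack (fun w => (X w, Y w)) (isMeasurableFun.Build _ _ _ _ _ mXY).
have prodE (A : set (R * R)) : measurable A ->
    ((distribution P X') \x (distribution P Y'))%E A = distribution P Z' A.
  by move=> mA; exact: product_measure_unique.
pose f (p : R * R) : \bar R := (p.1 * p.2)%:E.
have mf : measurable_fun setT f.
  by apply/measurable_EFinP; apply: measurable_funM; [exact: measurable_fst|exact: measurable_snd].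
have mE : measurable_fun [set: R] (@EFin R) by exact/measurable_EFinP.
have iPX : (distribution P X').-integrable setT (@EFin R).
  by apply: integrable_pushforward.
have iPY : (distribution P Y').-integrable setT (@EFin R).
  by apply: integrable_pushforward.
have nX : (\int[distribution P X']_x `|x%:E| < +oo)%E by case/integrableP : iPX.
have nY : (\int[distribution P Y']_x `|x%:E| < +oo)%E by case/integrableP : iPY.
have iprod : ((distribution P X') \x (distribution P Y'))%E.-integrable setT f.
  apply/integrable12ltyP => //.
  rewrite (_ : (\int[_]_x _)%E = (\int[distribution P X']_x `|x%:E| *
      \int[distribution P Y']_x `|x%:E|)%E).
    apply: lte_mul_pinfty => //; first exact: integral_ge0.
    by rewrite ge0_fin_numE//; exact: integral_ge0.
  rewrite -ge0_integralZr//=; last 2 first.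
  - by apply/measurable_EFinP; exact: normr_measurable.
  - exact: integral_ge0.
  apply: eq_integral => x _; rewrite -ge0_integralZl//=; last first.
    by apply/measurable_EFinP; exact: normr_measurable.
  by apply: eq_integral => y _; rewrite /f/= normrM EFinM.
have iXY : P.-integrable setT (EFin \o (fun w => X w * Y w)).
  apply/integrableP; split; first by apply/measurable_EFinP; exact: measurable_funM.
  case/integrableP : iprod => _; apply: le_lt_trans.
  rewrite (eq_measure_integral (distribution P Z')); last by move=> A mA _; exact: prodE.
  by rewrite ge0_integral_distribution//; exact: measurableT_comp.
split => //.
rewrite /Rintegral -fineM ?integrable_fin_num//; congr fine.
transitivity (\int[distribution P Z']_z f z)%E; first by rewrite integral_distribution.
rewrite (eq_measure_integral ((distribution P X') \x (distribution P Y'))%E); last first.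
  by move=> A mA _; apply/esym; exact: prodE.
rewrite -integral12_prod_meas1//.
have [c cE] : exists c, (\int[P]_w (Y w)%:E = c%:E)%E.
  by exists (fine (\int[P]_w (Y w)%:E)); rewrite fineK// integrable_fin_num.
have fY : (\int[distribution P Y']_y y%:E = c%:E)%E by rewrite integral_distribution.
rewrite cE -(integral_distribution (X := X') mE)// muleC -integralZl//.
apply: eq_integral => x _; rewrite /fubini_F muleC -fY -integralZl//.
Qed.

End independent.

(** * Brownian increments and the past *)

Section measurable_wrt.
Context (R : realType) dO (Omega : measurableType dO).
Variable G : set (set Omega).
Hypothesis sG : sigma_algebra setT G.
Implicit Types X Y : Omega -> R.

(** Transfers the closure properties of measurable functions to functions that are
    measurable with respect to a smaller sigma-algebra. *)
Lemma measurable_wrtP X :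
  measurable_wrt G X <-> measurable_fun setT (X : g_sigma_algebraType G -> R).
Proof.
split => [mX _ B mB|mX B mB].
  by rewrite setTI; apply: sub_sigma_algebra; exact: mX.
have := mX measurableT B mB; rewrite setTI.
by rewrite /measurable/= sigma_algebra_id.
Qed.

Lemma wrt_cst (r : R) : measurable_wrt G (fun=> r).
Proof. by apply/measurable_wrtP. Qed.

Lemma wrtB X Y : measurable_wrt G X -> measurable_wrt G Y ->
  measurable_wrt G (fun w => X w - Y w).
Proof.
by move=> /measurable_wrtP mX /measurable_wrtP mY; apply/measurable_wrtP; exact: measurable_funB.
Qed.

Lemma wrtM X Y : measurable_wrt G X -> measurable_wrt G Y ->
  measurable_wrt G (fun w => X w * Y w).
Proof.
by move=> /measurable_wrtP mX /measurable_wrtP mY; apply/measurable_wrtP; exact: measurable_funM.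
Qed.

Lemma wrt_max X Y : measurable_wrt G X -> measurable_wrt G Y ->
  measurable_wrt G (fun w => Num.max (X w) (Y w)).
Proof.
by move=> /measurable_wrtP mX /measurable_wrtP mY; apply/measurable_wrtP; exact: measurable_maxr.
Qed.

Lemma wrt_sum (I : Type) (s : seq I) (X : I -> Omega -> R) :
  (forall i, measurable_wrt G (X i)) ->
  measurable_wrt G (fun w => \sum_(i <- s) X i w).
Proof.
move=> mX; apply/measurable_wrtP; apply: measurable_sum => i.
by apply/measurable_wrtP.
Qed.

End measurable_wrt.

Section laws.
Context (R : realType) dO (Omega : measurableType dO) (P : probability Omega R).

Lemma integral_law (X : {mfun Omega >-> measurableTypeR R}) (nu : probability (measurableTypeR R) R)
    (f : R -> R) :
  (forall A, measurable A -> P (X @^-1` A) = nu A) ->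
  measurable_fun setT f -> (forall x, 0 <= f x) ->
  (\int[P]_w (f (X w))%:E = \int[nu]_x (f x)%:E)%E.
Proof.
move=> XE mf f0; transitivity (\int[distribution P X]_x (f x)%:E)%E.
  by rewrite ge0_integral_distribution//; exact/measurable_EFinP.
rewrite [LHS](@eq_measure_integral _ (measurableTypeR R) R setT nu
  (distribution P X) (fun x : R => (f x)%:E))// => A mA _; exact: XE.
Qed.

Lemma Rintegral_law_eq (X Y : {mfun Omega >-> R}) :
  (forall A, measurable A -> P (X @^-1` A) = P (Y @^-1` A)) ->
  P.-integrable setT (EFin \o X) -> P.-integrable setT (EFin \o Y) ->
  \int[P]_w X w = \int[P]_w Y w.
Proof.
move=> XY iX iY; congr fine.
have mE : measurable_fun [set: R] (@EFin R) by exact/measurable_EFinP.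
rewrite -(integral_distribution mE iX) -(integral_distribution mE iY).
rewrite [LHS](@eq_measure_integral _ _ R setT (distribution P Y)
  (distribution P X) (@EFin R))// => A mA _; exact: XY.
Qed.

End laws.

Section brownian_increments.
Context (R : realType) dO (Omega : measurableType dO) (P : probability Omega R).
Variables (F : R -> set (set Omega)) (B : R -> Omega -> R).
Hypothesis FP : filtration_usual P F.
Hypothesis BP : brownian_motion P F B.
Implicit Types X Y Z : Omega -> R.

Local Notation q := (normal_moment2 R).

Lemma wrt_measurable t X : 0 <= t -> measurable_wrt (F t) X -> measurable_fun setT X.
Proof. by move=> t0 mX _ A mA; rewrite setTI; apply: (fu_measurable FP t0); exact: mX. Qed.

Lemma wrt_mono s t X : 0 <= s -> s <= t -> measurable_wrt (F s) X -> measurable_wrt (F t) X.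
Proof. by move=> s0 st mX A mA; apply: (fu_mono FP s0 st); exact: mX. Qed.

Lemma brownian_wrt s t : 0 <= s -> s <= t -> measurable_wrt (F t) (B s).
Proof. by move=> s0 st; apply: (wrt_mono s0 st); exact: (bm_adapted BP). Qed.

Lemma measurable_brownian t : 0 <= t -> measurable_fun setT (B t).
Proof. by move=> t0; apply: (wrt_measurable t0); exact: (bm_adapted BP). Qed.

Let measurable_incr s t : 0 <= s -> s <= t ->
  measurable_fun setT (fun w => B t w - B s w).
Proof.
move=> s0 st; apply: measurable_funB; apply: measurable_brownian => //.
exact: le_trans st.
Qed.

Let gaussian_integral (s t : R) (f : R -> R) : 0 <= s -> s < t ->
  measurable_fun setT f -> (forall x, 0 <= f x) ->
  (\int[P]_w (f (B t w - B s w))%:E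
   = \int[normal_prob 0 (Num.sqrt (t - s))]_x (f x)%:E)%E.
Proof.
move=> s0 st mf f0; have mD := measurable_incr s0 (ltW st).
have mD' : measurable_fun setT (fun w => B t w - B s w : measurableTypeR R) by [].
pose D : {mfun Omega >-> measurableTypeR R} :=
  HB.pack (fun w => B t w - B s w) (isMeasurableFun.Build _ _ _ _ _ mD').
apply: (integral_law (X := D)) => //.
by move=> A mA; exact: (bm_gaussian BP).
Qed.

Lemma integral_incr_sqr s t : 0 <= s -> s <= t ->
  (\int[P]_w ((B t w - B s w) ^+ 2)%:E = (q * (t - s))%:E)%E.
Proof.
move=> s0; rewrite le_eqVlt => /predU1P[->|st].
  by rewrite subrr mulr0; apply: integral0_eq => w _; rewrite subrr expr0n.
have ts : 0 < t - s by rewrite subr_gt0.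
rewrite (gaussian_integral s0 st (f := fun x => x ^+ 2))//; last first.
  by move=> x; exact: sqr_ge0.
by rewrite integral_normal_sqr ?sqrtr_gt0// sqr_sqrtr ?ltW// mulrC.
Qed.

Lemma sqint_incr s t : 0 <= s -> s <= t -> sqint P (fun w => B t w - B s w).
Proof.
by move=> s0 st; split; [exact: measurable_incr|rewrite integral_incr_sqr// ltry].
Qed.

Lemma integrable_sqint X : sqint P X -> P.-integrable setT (EFin \o X).
Proof.
move=> sX; have := integrable_mul sX (bounded_sqint P (bounded_cst _ 1)).
by apply: eq_integrable => // w _ /=; rewrite mulr1.
Qed.

(** An increment and its opposite have the same law, by the symmetry of centred
    normal laws. *)
Lemma expectation_incr s t : 0 <= s -> s <= t -> \int[P]_w (B t w - B s w) = 0.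
Proof.
move=> s0; rewrite le_eqVlt => /predU1P[->|st].
  by under eq_Rintegral do rewrite subrr; rewrite Rintegral_cst// mul0r.
have ts : 0 < Num.sqrt (t - s) by rewrite sqrtr_gt0 subr_gt0.
have mD := measurable_incr s0 (ltW st).
have mN : measurable_fun setT (fun w => - (B t w - B s w)) by exact: measurableT_comp.
have iD := integrable_sqint (sqint_incr s0 (ltW st)).
have : \int[P]_w (B t w - B s w) = \int[P]_w (- (B t w - B s w)).
  pose D : {mfun Omega >-> R} :=
    HB.pack (fun w => B t w - B s w) (isMeasurableFun.Build _ _ _ _ _ mD).
  pose N : {mfun Omega >-> R} :=
    HB.pack (fun w => - (B t w - B s w)) (isMeasurableFun.Build _ _ _ _ _ mN).
  apply: (Rintegral_law_eq (X := D) (Y := N)) => //; last first.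
    exact: integrable_sqint (sqintN (sqint_incr s0 (ltW st))).
  move=> A mA; have := normal_prob_opp ts mA.
  rewrite -(bm_gaussian BP s0 st)//; last first.
    by rewrite -[X in measurable X]setTI; apply: oppr_measurable.
  by rewrite -(bm_gaussian BP s0 st)// => <-.
under [RHS]eq_Rintegral do rewrite -mulN1r.
rewrite RintegralZl// mulN1r; lra.
Qed.

Let indep_incr s t Z : 0 <= s -> s < t -> measurable_wrt (F s) Z ->
  indep P Z (fun w => B t w - B s w).
Proof.
move=> s0 st mZ A C mA mC; apply: (bm_independent BP) => //; exact: mZ.
Qed.

Lemma past_mul_incr s t Z : 0 <= s -> s <= t -> measurable_wrt (F s) Z ->
  P.-integrable setT (EFin \o Z) ->
  P.-integrable setT (EFin \o (fun w => Z w * (B t w - B s w))) /\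
  \int[P]_w (Z w * (B t w - B s w)) = 0.
Proof.
move=> s0 + mZ iZ; rewrite le_eqVlt => /predU1P[<-|st].
  have -> : (fun w => Z w * (B s w - B s w)) = cst 0.
    by apply/funext => w; rewrite subrr mulr0.
  by rewrite Rintegral_cst// mul0r; split => //; exact: finite_measure_integrable_cst.
have [i ->] := integral_indep (indep_incr s0 st mZ) iZ
  (integrable_sqint (sqint_incr s0 (ltW st))).
by rewrite expectation_incr ?mulr0// ltW.
Qed.

Lemma past_mul_incr_sqr s t Z : 0 <= s -> s <= t -> measurable_wrt (F s) Z ->
  P.-integrable setT (EFin \o Z) ->
  P.-integrable setT (EFin \o (fun w => Z w * (B t w - B s w) ^+ 2)) /\
  \int[P]_w (Z w * (B t w - B s w) ^+ 2) = q * (t - s) * \int[P]_w Z w.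
Proof.
move=> s0 + mZ iZ; rewrite le_eqVlt => /predU1P[<-|st].
  have -> : (fun w => Z w * (B s w - B s w) ^+ 2) = cst 0.
    by apply/funext => w; rewrite subrr expr0n mulr0.
  rewrite Rintegral_cst// mul0r subrr mulr0 mul0r; split => //.
  exact: finite_measure_integrable_cst.
have [i ->] := integral_indep (indep_sqr (indep_incr s0 st mZ)) iZ
  (sqint_integrable_sqr (sqint_incr s0 (ltW st))).
by split => //; rewrite mulrC /Rintegral integral_incr_sqr// ltW.
Qed.

End brownian_increments.

(** * Doob's inequality and products of increments *)

Section doob.
Context (R : realType) dO (Omega : measurableType dO) (P : probability Omega R).

Lemma runmax_le (M : nat -> R) n c : 0 <= c ->
  (forall i, (i <= n)%N -> M i <= c) -> runmax M n <= c.
Proof.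
move=> c0; elim: n => [|n IH] Mc /=; first by rewrite ge_max c0 Mc.
by rewrite ge_max Mc// IH// => i ile; apply: Mc; exact: leqW.
Qed.

Lemma measurable_runmax (M : nat -> Omega -> R) n :
  (forall i, (i <= n)%N -> measurable_fun setT (M i)) ->
  measurable_fun setT (fun w => runmax (M ^~ w) n).
Proof.
elim: n => [|n IH] mM /=; first by apply: measurable_maxr => //; exact: mM.
apply: measurable_maxr; last exact: mM.
by apply: IH => i ile; apply: mM; exact: leqW.
Qed.

Lemma sqint_runmax (M : nat -> Omega -> R) n :
  (forall i, (i <= n)%N -> sqint P (M i)) -> sqint P (fun w => runmax (M ^~ w) n).
Proof.
elim: n => [|n IH] sM /=.
  by apply: sqint_max; [apply: bounded_sqint; exact: bounded_cst|exact: sM].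
apply: sqint_max; last exact: sM.
by apply: IH => i ile; apply: sM; exact: leqW.
Qed.

Lemma wrt_runmax (G : nat -> set (set Omega)) (M : nat -> Omega -> R) n :
  (forall i, sigma_algebra setT (G i)) -> (forall i, G i `<=` G i.+1) ->
  (forall i, (i <= n)%N -> measurable_wrt (G i) (M i)) ->
  measurable_wrt (G n) (fun w => runmax (M ^~ w) n).
Proof.
move=> sG GS; elim: n => [|n IH] mM /=.
  by apply: wrt_max => //; [exact: wrt_cst|exact: mM].
apply: wrt_max => //; last exact: mM.
by move=> A mA; apply: GS; apply: IH => // i ile; apply: mM; exact: leqW.
Qed.

(** Expectation of [doob_pathwise]: the weights are functions of the past, so
    the martingale transform has mean zero. *)
Lemma doob_sqr (G : nat -> set (set Omega)) (M : nat -> Omega -> R) n :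
  (forall i, sigma_algebra setT (G i)) -> (forall i, G i `<=` G i.+1) ->
  (forall i, (i <= n)%N -> measurable_wrt (G i) (M i)) ->
  (forall i, (i <= n)%N -> sqint P (M i)) ->
  (forall i Z, (i < n)%N -> measurable_wrt (G i) Z -> sqint P Z ->
    \int[P]_w (Z w * (M i.+1 w - M i w)) = 0) ->
  (\int[P]_w (runmax (fun i => M i w ^+ 2) n)%:E
    <= 8%:E * \int[P]_w (M n w ^+ 2)%:E)%E.
Proof.
move=> sG GS mM sM orth.
pose H i w := runmax (M ^~ w) i - runmax (\- (M ^~ w)) i.
have sN i : sqint P (M i) -> sqint P (\- M i) by exact: sqintN.
have sH (i : 'I_n) : sqint P (H i).
  apply: sqintB; apply: sqint_runmax => j ji.
    by apply: sM; rewrite (leq_trans ji)// ltnW.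
  by apply/sN/sM; rewrite (leq_trans ji)// ltnW.
have mH (i : 'I_n) : measurable_wrt (G i) (H i).
  apply: wrtB => //; apply: wrt_runmax => // j ji.
    by apply: mM; rewrite (leq_trans ji)// ltnW.
  suff : measurable_wrt (G j) (fun w => 0 - M j w) by under eq_fun do rewrite sub0r.
  apply: wrtB => //; first exact: wrt_cst.
  by apply: mM; rewrite (leq_trans ji)// ltnW.
have iS (i : 'I_n) : P.-integrable setT
    (EFin \o (fun w => H i w * (M i.+1 w - M i w))).
  apply: integrable_mul => //; apply: sqintB; apply: sM => //.
  exact: ltnW.
have iM : P.-integrable setT (EFin \o (fun w => M n w ^+ 2)).
  by apply: sqint_integrable_sqr; exact: sM.
pose X w := 8 * M n w ^+ 2 + (-4) * \sum_(i < n) H i w * (M i.+1 w - M i w).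
have XE : \int[P]_w X w = 8 * \int[P]_w (M n w ^+ 2).
  rewrite RintegralD//; last 2 first.
  - exact: integrableZR.
  - by apply: integrableZR => //; exact: integrable_sumR.
  rewrite RintegralZl// RintegralZl//; last exact: integrable_sumR.
  rewrite Rintegral_sum// big1 ?mulr0 ?addr0// => i _.
  exact: orth (ltn_ord i) (mH i) (sH i).
have iX : P.-integrable setT (EFin \o X).
  apply: integrableDR => //; first exact: integrableZR.
  by apply: integrableZR => //; exact: integrable_sumR.
rewrite [in leRHS]integral_EFin// -EFinM -XE -integral_EFin//.
have r0 w : 0 <= runmax (fun i => M i w ^+ 2) n by exact: runmax_ge0.
have rX w : runmax (fun i => M i w ^+ 2) n <= X w.
  have MX i : (i <= n)%N -> M i w ^+ 2 <= X w.
    by move=> ile; have := doob_pathwise (M ^~ w) ile; rewrite /X /H mulNr.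
  by apply: runmax_le => //; apply: le_trans (MX 0 isT); exact: sqr_ge0.
apply: ge0_le_integral => //=.
- by move=> w _; rewrite lee_fin.
- by apply/measurable_EFinP; apply: measurable_runmax => i ile; apply: measurable_funX; case: (sM i ile).
- exact: measurable_int iX.
- by move=> w _; rewrite lee_fin.
Qed.

End doob.

Section simple_integrals.
Context (R : realType) dO (Omega : measurableType dO) (P : probability Omega R).
Variables (F : R -> set (set Omega)) (B : R -> Omega -> R).
Hypothesis FP : filtration_usual P F.
Hypothesis BP : brownian_motion P F B.

Local Notation q := (normal_moment2 R).

(** Length of the intersection of the intervals [a, b] and [c, d]. *)
Definition overlap (a b c d : R) : R := Num.max 0 (Num.min b d - Num.max a c).

Lemma overlapC a b c d : overlap a b c d = overlap c d a b.
Proof. by rewrite /overlap minC [Num.max a c]maxC. Qed.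

(** The longer increment splits at [x]; the part after [x] is independent of the
    rest and centred. *)
Let nested_increments eta c x y : 0 <= c -> c <= x -> x <= y ->
  measurable_wrt (F c) eta -> bounded_rv eta ->
  \int[P]_w (eta w * ((B x w - B c w) * (B y w - B c w)))
  = q * (x - c) * \int[P]_w (eta w).
Proof.
move=> c0 cx xy me be; have x0 := le_trans c0 cx.
have sD := sqint_incr FP BP c0 cx.
have [i1 e1] := past_mul_incr_sqr FP BP c0 cx me (bounded_integrable P be).
have mZ : measurable_wrt (F x) (fun w => eta w * (B x w - B c w)).
  apply: wrtM; first exact: (fu_sigma FP).
    exact: (wrt_mono FP c0 cx).
  apply: wrtB; first exact: (fu_sigma FP).
    exact: (brownian_wrt FP BP).
  exact: (brownian_wrt FP BP).
have [i2 e2] := past_mul_incr FP BP x0 xy mZ (integrable_sqint (sqintM be sD)).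
transitivity (\int[P]_w (eta w * (B x w - B c w) ^+ 2 +
    eta w * (B x w - B c w) * (B y w - B x w))).
  by apply: eq_Rintegral => w _; ring.
by rewrite RintegralD// e1 e2 addr0.
Qed.

(** Only the common part of the two intervals contributes, by independence of the
    increments from the past.  The position of the intervals is arbitrary because
    two elementary processes will be compared on their own partitions. *)
Lemma incr_product a b c d xi zeta : 0 <= a -> a <= b -> 0 <= c -> c <= d ->
  bounded_rv xi -> bounded_rv zeta ->
  (a < b -> measurable_wrt (F a) xi) -> (c < d -> measurable_wrt (F c) zeta) ->
  \int[P]_w ((xi w * (B b w - B a w)) * (zeta w * (B d w - B c w)))
  = q * overlap a b c d * \int[P]_w (xi w * zeta w).
Proof.
wlog ac : a b c d xi zeta / a <= c => [wl a0 ab c0 cd bx bz mx mz|a0].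
  have [/wl|/ltW ca] := leP a c; first exact.
  have := wl _ _ _ _ _ _ ca c0 cd a0 ab bz bx mz mx.
  rewrite overlapC => wlE.
  have -> : \int[P]_w (xi w * zeta w) = \int[P]_w (zeta w * xi w).
    by apply: eq_Rintegral => w _; rewrite mulrC.
  by rewrite -wlE; apply: eq_Rintegral => w _; rewrite mulrC.
move=> ab c0 cd bx bz mx mz.
have zero (h : overlap a b c d = 0) (e : forall w,
     (xi w * (B b w - B a w)) * (zeta w * (B d w - B c w)) = 0) :
   \int[P]_w ((xi w * (B b w - B a w)) * (zeta w * (B d w - B c w)))
   = q * overlap a b c d * \int[P]_w (xi w * zeta w).
  under eq_Rintegral do rewrite e.
  by rewrite Rintegral_cst// mul0r h mulr0 mul0r.
move: (ab) (cd); rewrite !le_eqVlt => /predU1P[aE|ab'].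
  move=> _; apply: zero; last by move=> w; rewrite aE subrr mulr0 mul0r.
  apply/eqP; rewrite /overlap eq_le le_max lexx ge_max lexx/= andbT.
  by rewrite subr_le0 le_max ge_min aE lexx.
move=> /predU1P[cE|cd'].
  apply: zero; last by move=> w; rewrite cE subrr !mulr0.
  apply/eqP; rewrite /overlap eq_le le_max lexx ge_max lexx/= andbT.
  by rewrite subr_le0 le_max !ge_min cE lexx !orbT.
move/(_ ab') in mx; move/(_ cd') in mz.
have b0 := le_trans a0 ab; have d0 := le_trans c0 cd.
have sG t : 0 <= t -> sigma_algebra setT (F t) by exact: (fu_sigma FP).
have mD x y t : 0 <= x -> x <= t -> 0 <= y -> y <= t ->
    measurable_wrt (F t) (fun w => B x w - B y w).
  move=> x0 xt y0 yt; apply: wrtB; first exact: sG (le_trans x0 xt).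
    exact: (brownian_wrt FP BP).
  exact: (brownian_wrt FP BP).
have maxac : Num.max a c = c by apply/max_idPr.
have [bc|cb] := leP b c.
  have -> : overlap a b c d = 0.
    rewrite /overlap maxac; apply/eqP; rewrite eq_le le_max lexx ge_max lexx/= andbT.
    by rewrite subr_le0 ge_min bc.
  rewrite mulr0 mul0r.
  have mZ : measurable_wrt (F c) (fun w => zeta w * (xi w * (B b w - B a w))).
    by do 2 (apply: wrtM; [exact: sG| |]) => //; [exact: (wrt_mono FP a0 ac)|exact: mD].
  have := (past_mul_incr FP BP c0 cd mZ _).2; move=> <-.
    by apply: eq_Rintegral => w _; ring.
  apply: integrable_sqint; apply: sqintM => //; apply: sqintM => //.
  exact: (sqint_incr FP BP).
have meta : measurable_wrt (F c) (fun w => xi w * zeta w).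
  by apply: wrtM => //; [exact: sG|exact: (wrt_mono FP a0 ac)].
have beta := boundedM bx bz.
have mZ : measurable_wrt (F c) (fun w => xi w * zeta w * (B c w - B a w)).
  by apply: wrtM => //; [exact: sG|exact: mD].
have [i1 e1] := past_mul_incr FP BP c0 cd mZ
  (integrable_sqint (sqintM beta (sqint_incr FP BP a0 ac))).
have i2 : P.-integrable setT (EFin \o (fun w =>
    xi w * zeta w * ((B b w - B c w) * (B d w - B c w)))).
  rewrite (_ : (fun w => _) = (fun w =>
    xi w * (B b w - B c w) * (zeta w * (B d w - B c w)))); last first.
    by apply/funext => w; ring.
  by apply: integrable_mul; apply: sqintM => //; apply: (sqint_incr FP BP) => //; exact: ltW.
transitivity (\int[P]_w (xi w * zeta w * (B c w - B a w) * (B d w - B c w) +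
    xi w * zeta w * ((B b w - B c w) * (B d w - B c w)))).
  by apply: eq_Rintegral => w _; ring.
rewrite RintegralD// e1 add0r /overlap maxac.
have [bd|db] := leP b d.
  rewrite (nested_increments c0 (ltW cb) bd meta beta); congr (_ * _ * _).
  by apply/esym/max_idPr; rewrite subr_ge0 ltW.
under eq_Rintegral do rewrite [X in _ * X]mulrC.
rewrite (nested_increments c0 cd (ltW db) meta beta); congr (_ * _ * _).
by apply/esym/max_idPr; rewrite subr_ge0 ltW.
Qed.

End simple_integrals.

(** * The isometry for simple integrals *)

Section simple_isometry.
Context (R : realType) dO (Omega : measurableType dO) (P : probability Omega R).
Variables (F : R -> set (set Omega)) (B : R -> Omega -> R).
Hypothesis FP : filtration_usual P F.
Hypothesis BP : brownian_motion P F B.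

Local Notation q := (normal_moment2 R).
Local Notation mu := (@lebesgue_measure R).

Variables (I : finType) (a b : I -> R) (xi : I -> Omega -> R).

(** The index set is any finite type, so that the intervals of two elementary
    processes can be juxtaposed instead of refined. *)
Definition simple_integral (t : R) (w : Omega) : R :=
  \sum_k xi k w * (B (Num.min (b k) t) w - B (Num.min (a k) t) w).

Definition simple_process (s : R) (w : Omega) : R :=
  \sum_k xi k w * \1_(`]a k, b k]) s.

Definition simple_data : Prop := forall k,
  [/\ 0 <= a k, a k <= b k, measurable_wrt (F (a k)) (xi k) &
      exists M, forall w, `|xi k w| <= M].

Hypothesis data : simple_data.

Let bxi k : bounded_rv (xi k).
Proof. by have [a0 _ mk ?] := data k; split => //; exact: (wrt_measurable FP a0). Qed.

Let mina0 k t : 0 <= t -> 0 <= Num.min (a k) t.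
Proof. by move=> t0; have [a0 _ _ _] := data k; rewrite le_min a0. Qed.

Let minab k t : Num.min (a k) t <= Num.min (b k) t.
Proof.
by have [_ ab _ _] := data k; rewrite le_min !ge_min ab lexx/= orbT.
Qed.

Let mxi k t : Num.min (a k) t < Num.min (b k) t ->
  measurable_wrt (F (Num.min (a k) t)) (xi k).
Proof.
have [_ _ mk _] := data k; have [//|ta] := leP (a k) t.
by rewrite lt_min ltxx andbF.
Qed.

Let len (t : R) k l : R :=
  overlap (Num.min (a k) t) (Num.min (b k) t) (Num.min (a l) t) (Num.min (b l) t).

Lemma sqint_simple_integral t : 0 <= t -> sqint P (simple_integral t).
Proof.
move=> t0; apply: sqint_sum => k; apply: sqintM => //.
by apply: (sqint_incr FP BP); [exact: mina0|exact: minab].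
Qed.

Lemma simple_integral_sqr t : 0 <= t ->
  (\int[P]_w (simple_integral t w ^+ 2)%:E =
   (q * \sum_k \sum_l len t k l * \int[P]_w (xi k w * xi l w))%:E)%E.
Proof.
move=> t0; pose Y k w := xi k w * (B (Num.min (b k) t) w - B (Num.min (a k) t) w).
have sY k : sqint P (Y k).
  by apply: sqintM => //; apply: (sqint_incr FP BP); [exact: mina0|exact: minab].
have sE w : simple_integral t w ^+ 2 = \sum_k \sum_l Y k w * Y l w.
  rewrite expr2 mulr_suml; apply: eq_bigr => k _.
  by rewrite mulr_sumr.
have iY k l : P.-integrable setT (EFin \o (fun w => Y k w * Y l w)).
  exact: integrable_mul.
under eq_integral do rewrite sE.
rewrite integral_EFin//; last first.
  by apply: integrable_sumR => // k; exact: integrable_sumR.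
congr _%:E; rewrite Rintegral_sum// => [|k]; last exact: integrable_sumR.
rewrite mulr_sumr; apply: eq_bigr => k _.
rewrite Rintegral_sum// mulr_sumr; apply: eq_bigr => l _.
by rewrite (incr_product FP BP (mina0 k t0) (minab k t) (mina0 l t0) (minab l t)
  (bxi k) (bxi l) (@mxi k t) (@mxi l t)) mulrA.
Qed.

Let itvI k l (t : R) :
  `[0, t]%classic `&` (`]a k, b k]%classic `&` `]a l, b l]%classic) =
  `]Num.max (Num.min (a k) t) (Num.min (a l) t),
    Num.min (Num.min (b k) t) (Num.min (b l) t)]%classic.
Proof.
have [ak0 _ _ _] := data k; have [al0 _ _ _] := data l.
apply/seteqP; split => x /=; rewrite !in_itv/=.
  move=> [/andP[x0 xt] [/andP[akx xbk] /andP[alx xbl]]].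
  by rewrite gt_max !le_min !gt_min akx alx xbk xbl xt.
rewrite gt_max !le_min => /andP[/andP[kx lx] /andP[/andP[-> xt] /andP[-> _]]].
move: kx lx; rewrite !gt_min ![t < x]ltNge xt !orbF => akx alx.
by rewrite akx alx (le_trans ak0 (ltW akx)).
Qed.

Lemma integral_simple_process_sqr t w : 0 <= t ->
  (\int[mu]_(s in `[0%R, t]) (simple_process s w ^+ 2)%:E =
   (\sum_k \sum_l len t k l * (xi k w * xi l w))%:E)%E.
Proof.
move=> t0.
pose J k l : set R := `]a k, b k]%classic `&` `]a l, b l]%classic.
have mJ k l : measurable (J k l) by exact: measurableI.
have sE s : simple_process s w ^+ 2 =
    \sum_k \sum_l (xi k w * xi l w) * \1_(J k l) s.
  rewrite expr2 mulr_suml; apply: eq_bigr => k _.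
  rewrite mulr_sumr; apply: eq_bigr => l _.
  by rewrite /J indicI/=; ring.
have fin : (mu `[0%R, t] < +oo)%E by rewrite lebesgue_measure_itv/=; case: ifP; rewrite ?ltry// -EFinB ltry.
have i1 k l : mu.-integrable `[0, t] (EFin \o \1_(J k l)).
  apply: (@bounded_integrableR _ _ _ _ _ _ 1) => //.
    by apply: measurable_indic; exact: mJ.
  by move=> s ?; rewrite /= indicE; case: (_ \in _); rewrite ?normr1 ?normr0.
have iJ k l : mu.-integrable `[0, t]
    (EFin \o (fun s => (xi k w * xi l w) * \1_(J k l) s)).
  exact: integrableZR.
under eq_integral do rewrite sE.
rewrite integral_EFin//; last first.
  by apply: integrable_sumR => // k; exact: integrable_sumR.
congr _%:E; rewrite Rintegral_sum// => [|k]; last exact: integrable_sumR.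
apply: eq_bigr => k _; rewrite Rintegral_sum//; apply: eq_bigr => l _.
rewrite RintegralZl// mulrC; congr (_ * _).
rewrite /Rintegral integral_indic//=; last exact: mJ.
rewrite setIC itvI lebesgue_measure_itv/= lte_fin.
rewrite /len /overlap; case: ltP => h /=.
  by apply/esym/max_idPr; rewrite subr_ge0 ltW.
by apply/esym/max_idPl; rewrite subr_le0.
Qed.

(** Both sides are the same quadratic form in the coefficients, with the lengths
    [len] of the overlaps as its matrix: on the left by [incr_product], on the right
    as integrals of products of indicators. *)
Lemma simple_isometry t : 0 <= t ->
  (\int[P]_w (simple_integral t w ^+ 2)%:E =
   q%:E * \int[P]_w \int[mu]_(s in `[0%R, t]) (simple_process s w ^+ 2)%:E)%E.
Proof.
move=> t0; rewrite simple_integral_sqr// EFinM; congr (_ * _)%E.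
under eq_integral do rewrite integral_simple_process_sqr//.
have ixx k l : P.-integrable setT (EFin \o (fun w => xi k w * xi l w)).
  by apply: bounded_integrable; exact: boundedM.
have iz k l : P.-integrable setT (EFin \o (fun w => len t k l * (xi k w * xi l w))).
  exact: integrableZR.
rewrite integral_EFin//; last first.
  by apply: integrable_sumR => // k; exact: integrable_sumR.
congr _%:E; rewrite Rintegral_sum// => [|k]; last exact: integrable_sumR.
apply: eq_bigr => k _; rewrite Rintegral_sum//; apply: eq_bigr => l _.
by rewrite RintegralZl.
Qed.

Lemma simple_integral_wrt t : 0 <= t -> measurable_wrt (F t) (simple_integral t).
Proof.
move=> t0; apply: wrt_sum => [|k]; first exact: (fu_sigma FP).
have [a0 ab mk _] := data k; have [at_|ta] := ltP (a k) t.
  apply: wrtM; first exact: (fu_sigma FP).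
    exact: (wrt_mono FP a0 (ltW at_)).
  apply: wrtB; first exact: (fu_sigma FP).
    apply: (brownian_wrt FP BP); first by rewrite le_min (le_trans a0 ab) t0.
    by rewrite ge_min lexx orbT.
  by apply: (brownian_wrt FP BP) => //; exact: ltW.
rewrite (_ : (fun w => _) = fun=> 0); first by apply: wrt_cst; exact: (fu_sigma FP).
apply/funext => w; have -> : Num.min (b k) t = t by apply/min_idPr; exact: le_trans ab.
by rewrite subrr mulr0.
Qed.

(** Truncation of all intervals to the times between [s] and [t] leaves increments
    which are centred and independent of [Z] and of the coefficients. *)
Lemma simple_martingale s t Z : 0 <= s -> s <= t -> measurable_wrt (F s) Z ->
  sqint P Z -> \int[P]_w (Z w * (simple_integral t w - simple_integral s w)) = 0.
Proof.
move=> s0 st mZ sZ; have t0 := le_trans s0 st.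
pose al k := Num.min (Num.max (a k) s) t; pose be k := Num.min (Num.max (b k) s) t.
have shift w x : B (Num.min x t) w - B (Num.min x s) w =
    B (Num.min (Num.max x s) t) w - B s w.
  have [xs|sx] := leP x s; last by [].
  by rewrite (min_idPl (le_trans xs st)) (min_idPl st) !subrr.
have sE w : Z w * (simple_integral t w - simple_integral s w) =
    \sum_k (Z w * xi k w) * (B (be k) w - B (al k) w).
  rewrite -sumrB mulr_sumr; apply: eq_bigr => k _.
  rewrite -mulrBr mulrA; congr (_ * _).
  by have := shift w (a k); have := shift w (b k); rewrite /al /be; lra.
have each k : P.-integrable setT (EFin \o (fun w => (Z w * xi k w) * (B (be k) w - B (al k) w))) /\
    \int[P]_w ((Z w * xi k w) * (B (be k) w - B (al k) w)) = 0.
  have [a0 ab mk _] := data k.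
  have al0 : 0 <= al k by rewrite le_min t0 le_max a0.
  have albe : al k <= be k.
    by rewrite /al /be le_min !ge_min ge_max !le_max ab !lexx/= !orbT.
  have := albe; rewrite le_eqVlt => /predU1P[->|lt].
    have -> : (fun w => Z w * xi k w * (B (be k) w - B (be k) w)) = cst 0.
      by apply/funext => w; rewrite subrr mulr0.
    by rewrite Rintegral_cst// mul0r; split => //; exact: finite_measure_integrable_cst.
  have alE : al k = Num.max (a k) s.
    rewrite /al; apply/min_idPl; move: lt; rewrite /al /be.
    by case: (leP (Num.max (a k) s) t) => // _; rewrite lt_min ltxx andbF.
  apply: (past_mul_incr FP BP al0 albe); last first.
    apply: integrable_sqint; under eq_fun do rewrite mulrC; exact: sqintM.
  rewrite alE; apply: wrtM; first by apply: (fu_sigma FP); rewrite le_max a0.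
    by apply: (wrt_mono FP s0) => //; rewrite le_max lexx orbT.
  by apply: (wrt_mono FP a0) => //; rewrite le_max lexx.
under eq_Rintegral do rewrite sE.
rewrite Rintegral_sum// => [|k]; last exact: (each k).1.
by rewrite big1// => k _; exact: (each k).2.
Qed.

Lemma simple_doob (t : nat -> R) n : 0 <= t 0%N ->
  (forall i, t i <= t i.+1) ->
  (\int[P]_w (runmax (fun i => simple_integral (t i) w ^+ 2) n)%:E <=
   (8 * q)%:E *
     \int[P]_w \int[mu]_(s in `[0%R, t n]) (simple_process s w ^+ 2)%:E)%E.
Proof.
move=> t00 tS.
have t0 i : 0 <= t i by elim: i => // i IH; exact: le_trans (tS i).
rewrite EFinM -muleA -simple_isometry//.
apply: (doob_sqr (G := fun i => F (t i))).
- by move=> i; exact: (fu_sigma FP).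
- by move=> i; exact: (fu_mono FP).
- by move=> i _; exact: simple_integral_wrt.
- by move=> i _; exact: sqint_simple_integral.
- by move=> i Z _; exact: simple_martingale.
Qed.

End simple_isometry.

(** * Iterated integrals over measurable sets *)

Section tonelli_on_sets.
Local Open Scope ereal_scope.
Context d1 d2 (T1 : measurableType d1) (T2 : measurableType d2) (R : realType).
Variables (m1 : {sigma_finite_measure set T1 -> \bar R}).
Variables (m2 : {sigma_finite_measure set T2 -> \bar R}).
Variables (D1 : set T1) (D2 : set T2).
Hypotheses (mD1 : measurable D1) (mD2 : measurable D2).

Section nonneg.
Variable f : T1 * T2 -> \bar R.
Hypothesis f0 : forall x y, D1 x -> D2 y -> 0 <= f (x, y).
Hypothesis mf : measurable_fun (D1 `*` D2) f.

Let g := f \_ (D1 `*` D2).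

Let g0 p : 0 <= g p.
Proof.
rewrite /g patchE; case: ifPn => //; rewrite inE => -[].
by case: p => x y /=; exact: f0.
Qed.

Let mg : measurable_fun setT g.
Proof.
by apply/(measurable_restrictT _ _).1 => //; exact: measurableX.
Qed.

Let gE1 x : D1 x -> \int[m2]_y g (x, y) = \int[m2]_(y in D2) f (x, y).
Proof.
move=> D1x; rewrite [RHS]integral_mkcond; apply: eq_integral => y _.
rewrite /g !patchE; congr (if _ then _ else _).
by apply/idP/idP; rewrite !inE => // -[].
Qed.

Let gE2 y : D2 y -> \int[m1]_x g (x, y) = \int[m1]_(x in D1) f (x, y).
Proof.
move=> D2y; rewrite [RHS]integral_mkcond; apply: eq_integral => x _.
rewrite /g !patchE; congr (if _ then _ else _).
by apply/idP/idP; rewrite !inE => // -[].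
Qed.

Lemma measurable_integral_snd :
  measurable_fun D1 (fun x => \int[m2]_(y in D2) f (x, y)).
Proof.
apply: (eq_measurable_fun (fubini_F m2 g)).
  by move=> x; rewrite inE => D1x; rewrite /fubini_F gE1.
by apply: measurable_funTS; exact: measurable_fun_fubini_tonelli_F.
Qed.

Lemma measurable_integral_fst :
  measurable_fun D2 (fun y => \int[m1]_(x in D1) f (x, y)).
Proof.
apply: (eq_measurable_fun (fubini_G m1 g)).
  by move=> y; rewrite inE => D2y; rewrite /fubini_G gE2.
by apply: measurable_funTS; exact: measurable_fun_fubini_tonelli_G.
Qed.

(** Tonelli's theorem on the whole product for the extension of [f] by zero. *)
Lemma tonelli_on :
  \int[m1]_(x in D1) \int[m2]_(y in D2) f (x, y)
  = \int[m2]_(y in D2) \int[m1]_(x in D1) f (x, y).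
Proof.
transitivity (\int[m1]_x \int[m2]_y g (x, y)).
  rewrite integral_mkcond; apply: eq_integral => x _; rewrite patchE.
  case: ifPn => xD; first by rewrite gE1//; move: xD; rewrite inE.
  by apply/esym/integral0_eq => y _; rewrite /g patchE ifN//; apply: contra xD; rewrite !inE => -[].
rewrite (fubini_tonelli g mg g0).
rewrite [RHS]integral_mkcond; apply: eq_integral => y _; rewrite patchE.
case: ifPn => yD; first by rewrite gE2//; move: yD; rewrite inE.
by apply: integral0_eq => x _; rewrite /g patchE ifN//; apply: contra yD; rewrite !inE => -[].
Qed.

End nonneg.

Lemma measurable_Rintegral_snd (f : T1 * T2 -> R) :
  measurable_fun (D1 `*` D2) f ->
  measurable_fun D1 (fun x => (\int[m2]_(y in D2) f (x, y))%R).
Proof.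
move=> mf.
apply: (eq_measurable_fun (fun x => fine (\int[m2]_(y in D2) (EFin \o f)^\+ (x, y) -
    \int[m2]_(y in D2) (EFin \o f)^\- (x, y)))).
  move=> x _; rewrite /Rintegral [in RHS]integralE; congr (fine (_ - _));
    by apply: eq_integral => y _; rewrite ?funeposE ?funenegE.
apply: measurableT_comp; first exact: fine_measurable.
apply: emeasurable_funB; apply: measurable_integral_snd => //.
  by apply: measurable_funepos; exact/measurable_EFinP.
by apply: measurable_funeneg; exact/measurable_EFinP.
Qed.

Lemma measurable_Rintegral_fst (f : T1 * T2 -> R) :
  measurable_fun (D1 `*` D2) f ->
  measurable_fun D2 (fun y => (\int[m1]_(x in D1) f (x, y))%R).
Proof.
move=> mf.
apply: (eq_measurable_fun (fun y => fine (\int[m1]_(x in D1) (EFin \o f)^\+ (x, y) -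
    \int[m1]_(x in D1) (EFin \o f)^\- (x, y)))).
  move=> y _; rewrite /Rintegral [in RHS]integralE; congr (fine (_ - _));
    by apply: eq_integral => x _; rewrite ?funeposE ?funenegE.
apply: measurableT_comp; first exact: fine_measurable.
apply: emeasurable_funB; apply: measurable_integral_fst => //.
  by apply: measurable_funepos; exact/measurable_EFinP.
by apply: measurable_funeneg; exact/measurable_EFinP.
Qed.

End tonelli_on_sets.

(** * Doob's inequality for the difference of two Ito integrals *)

Section weighted_sums.
Local Open Scope ereal_scope.
Context d (T : measurableType d) (R : realType) (mu : {measure set T -> \bar R}).
Variables (D : set T) (mD : measurable D).

Lemma le_integral_sum3 (c : R) (f g h k : T -> \bar R) : (0 <= c)%R ->
  measurable_fun D f -> measurable_fun D g -> measurable_fun D h ->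
  measurable_fun D k ->
  (forall x, D x -> 0 <= f x) -> (forall x, D x -> 0 <= g x) ->
  (forall x, D x -> 0 <= h x) -> (forall x, D x -> 0 <= k x) ->
  (forall x, D x -> f x <= c%:E * (g x + h x + k x)) ->
  \int[mu]_(x in D) f x <= c%:E *
    (\int[mu]_(x in D) g x + \int[mu]_(x in D) h x + \int[mu]_(x in D) k x).
Proof.
move=> c0 mf mg mh mk f0 g0 h0 k0 fle.
have mgh : measurable_fun D (fun x => g x + h x) by exact: emeasurable_funD.
have gh0 x : D x -> 0 <= g x + h x by move=> Dx; rewrite adde_ge0 ?g0 ?h0.
rewrite -ge0_integralD// -ge0_integralD// -ge0_integralZl//; last 2 first.
- exact: emeasurable_funD.
- by move=> x Dx; rewrite adde_ge0 ?gh0 ?k0.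
apply: ge0_le_integral => //; apply: emeasurable_funM => //.
exact: emeasurable_funD.
Qed.

End weighted_sums.

Section ito_doob.
Context (R : realType) dO (Omega : measurableType dO) (P : probability Omega R).
Variables (F : R -> set (set Omega)) (B : R -> Omega -> R).
Hypothesis FP : filtration_usual P F.
Hypothesis BP : brownian_motion P F B.

Local Notation q := (normal_moment2 R).
Local Notation mu := (@lebesgue_measure R).

Lemma measurable_time_itv (t : R) : measurable (time_itv t).
Proof. exact: measurable_itv. Qed.

Let mTO (t : R) : measurable (time_itv t `*` [set: Omega]).
Proof. by apply: measurableX => //; exact: measurable_time_itv. Qed.

Lemma sub_time_itv (s t : R) : s <= t -> time_itv s `<=` time_itv t.
Proof.
by move=> st x; rewrite /time_itv /= !in_itv/= => /andP[-> /le_trans ->].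
Qed.

Definition sq_process (X : R -> Omega -> R) (t : R) : \bar R :=
  (\int[P]_w \int[mu]_(s in time_itv t) (X s w ^+ 2)%:E)%E.

Definition measurable_process (t : R) (X : R -> Omega -> R) : Prop :=
  measurable_fun (time_itv t `*` [set: Omega]) (fun p : R * Omega => X p.1 p.2).

Lemma measurable_inner_sqr t X : measurable_process t X ->
  measurable_fun setT (fun w => \int[mu]_(s in time_itv t) (X s w ^+ 2)%:E)%E.
Proof.
move=> mX; apply: (measurable_integral_fst mu (measurable_time_itv t) measurableT
  (f := fun p : R * Omega => (X p.1 p.2 ^+ 2)%:E)).
- by move=> x y _ _; rewrite lee_fin sqr_ge0.
- exact: measurable_sqrE.
Qed.

Lemma measurable_process_section t X w : measurable_process t X ->
  measurable_fun (time_itv t) (X ^~ w).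
Proof.
move=> mX; apply: (@measurable_comp _ _ _ _ _ _ (time_itv t `*` [set: Omega])
  (fun p : R * Omega => X p.1 p.2) _ (fun s : R => (s, w))) => //.
by move=> _ [s ts <-].
by apply: measurable_funTS; apply: measurable_fun_pair.
Qed.

Lemma measurable_processS s t X : s <= t -> measurable_process t X ->
  measurable_process s X.
Proof.
move=> st; apply: measurable_funS => // -[x w] [/= xs _]; split => //=.
exact: sub_time_itv xs.
Qed.

Lemma measurable_processB t X Y : measurable_process t X ->
  measurable_process t Y -> measurable_process t (fun s w => X s w - Y s w).
Proof. exact: measurable_funB. Qed.

Lemma sq_processS s t X : s <= t -> measurable_process t X ->
  (sq_process X s <= sq_process X t)%E.
Proof.
move=> st mX; apply: ge0_le_integral => //.
- by move=> w _; apply: integral_ge0 => x _; rewrite lee_fin sqr_ge0.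
- by apply: measurable_inner_sqr; exact: measurable_processS mX.
- exact: measurable_inner_sqr.
move=> w _; apply: ge0_subset_integral => //; try exact: measurable_time_itv.
- by apply: measurable_sqrE; exact: measurable_process_section mX.
- by move=> x _; rewrite lee_fin sqr_ge0.
- exact: sub_time_itv.
Qed.

Lemma sqr_sum3 (x y z : R) : (x + y + z) ^+ 2 <= 3 * (x ^+ 2 + y ^+ 2 + z ^+ 2).
Proof.
have h1 := sqr_ge0 (x - y); have h2 := sqr_ge0 (x - z); have h3 := sqr_ge0 (y - z).
rewrite !sqrrB in h1 h2 h3; rewrite !sqrrD; lra.
Qed.

Lemma sq_process_sum3 t (W X Y Z : R -> Omega -> R) :
  measurable_process t W -> measurable_process t X -> measurable_process t Y ->
  measurable_process t Z -> (forall s w, W s w = X s w + Y s w + Z s w) ->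
  (sq_process W t <= 3%:E * (sq_process X t + sq_process Y t + sq_process Z t))%E.
Proof.
move=> mW mX mY mZ WE.
apply: le_integral_sum3 => //; try exact: measurable_inner_sqr;
  try by move=> w _; apply: integral_ge0 => x _; rewrite lee_fin sqr_ge0.
move=> w _; apply: le_integral_sum3 => //; first exact: measurable_time_itv;
  try (by apply: measurable_sqrE; exact: measurable_process_section);
  try by move=> x _; rewrite lee_fin sqr_ge0.
by move=> s _; rewrite -!EFinD -EFinM lee_fin WE sqr_sum3.
Qed.

Section elementary.
Variables (T : R) (e : elementary R Omega).
Hypothesis eP : is_elementary F T e.

Let I : finType := 'I_(el_size e).

Lemma elementary_simple_data :
  simple_data F (fun k : I => el_time e k) (fun k : I => el_time e k.+1)
    (fun k : I => el_coef e k).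
Proof.
have [tT tS mc bc] := eP; move=> k; split.
- by have /andP[] := tT k (ltnW (ltn_ord k)).
- exact: tS.
- exact: mc.
- exact: bc.
Qed.

Lemma measurable_elementary t : measurable_process t (elementary_process e).
Proof.
apply: measurable_funTS; apply: measurable_sum => k; apply: measurable_funM.
  have [k0 _ mk _] := elementary_simple_data k.
  by apply: measurableT_comp; [exact: (wrt_measurable FP k0)|exact: measurable_snd].
by apply: measurableT_comp; [exact: measurable_indic|exact: measurable_fst].
Qed.

Lemma sqint_elementary_integral t : 0 <= t -> sqint P (elementary_integral B e t).
Proof. by move=> t0; exact: (sqint_simple_integral FP BP elementary_simple_data t0). Qed.

End elementary.

(** The difference of two elementary integrals is the simple integral over the
    juxtaposed family of intervals, so that [simple_doob] applies. *)
Lemma elementary_doob T (e1 e2 : elementary R Omega) (t : nat -> R) n :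
  is_elementary F T e1 -> is_elementary F T e2 ->
  0 <= t 0%N -> (forall i, t i <= t i.+1) ->
  (\int[P]_w (runmax (fun i => (elementary_integral B e1 (t i) w
                       - elementary_integral B e2 (t i) w) ^+ 2) n)%:E <=
   (8 * q)%:E * sq_process
     (fun s w => elementary_process e1 s w - elementary_process e2 s w)%R (t n))%E.
Proof.
move=> /elementary_simple_data d1 /elementary_simple_data d2 t0 tS.
pose I : finType := ('I_(el_size e1) + 'I_(el_size e2))%type.
pose a (k : I) := match k with inl k => el_time e1 k | inr k => el_time e2 k end.
pose b (k : I) := match k with inl k => el_time e1 k.+1 | inr k => el_time e2 k.+1 end.
pose xi (k : I) := match k with inl k => el_coef e1 k | inr k => fun w => - el_coef e2 k w end.
have data : simple_data F a b xi.
  case=> k; first exact: d1.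
  have [a0 ab mk [M kM]] := d2 k; split => //; last first.
    by exists M => w; rewrite /= normrN.
  have -> : xi (inr k) = fun w => 0 - el_coef e2 k w.
    by apply/funext => w; rewrite sub0r.
  by apply: wrtB => //; [exact: (fu_sigma FP)|apply: wrt_cst; exact: (fu_sigma FP)].
have IE s w : simple_integral B a b xi s w =
    elementary_integral B e1 s w - elementary_integral B e2 s w.
  rewrite /simple_integral big_sumType/=; congr (_ + _).
  by rewrite -sumrN; apply: eq_bigr => k _; rewrite mulNr.
have PE s w : simple_process a b xi s w =
    elementary_process e1 s w - elementary_process e2 s w.
  rewrite /simple_process big_sumType/=; congr (_ + _).
  by rewrite -sumrN; apply: eq_bigr => k _; rewrite mulNr.
have := simple_doob FP BP data n t0 tS.
rewrite /sq_process; under [X in (_ <= _ * X)%E -> _]eq_integral do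
  under eq_integral do rewrite PE.
apply: le_trans; rewrite le_eqVlt; apply/orP; left; apply/eqP.
apply: eq_integral => w _; congr (runmax _ n)%:E.
by apply/funext => i; rewrite IE.
Qed.

(** At the finitely many times [t i] both integrals are L2-limits of elementary
    integrals, whose difference obeys [elementary_doob].  The two approximations,
    in the maximum and in the integrand, cost a factor 3 each, and 72 = 3 * 3 * 8. *)
Lemma ito_doob T H1 H2 Y1 Y2 (t : nat -> R) n :
  is_ito_integral P F B T H1 Y1 -> is_ito_integral P F B T H2 Y2 ->
  0 <= t 0%N -> (forall i, t i <= t i.+1) -> (forall i, t i <= T) ->
  (\int[P]_w (runmax (fun i => (Y1 (t i) w - Y2 (t i) w) ^+ 2) n)%:E <=
   (72 * q)%:E * sq_process (fun s w => H1 s w - H2 s w)%R (t n))%E.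
Proof.
move=> [mH1 aH1 _ [_ aY1] [e1 [e1P eH1 eY1]]] [mH2 aH2 _ [_ aY2] [e2 [e2P eH2 eY2]]].
move=> t00 tS tT.
have t0 i : 0 <= t i by elim: i => // i IH; exact: le_trans (tS i).
have tiT i : 0 <= t i <= T by rewrite t0 tT.
have mY1 i : measurable_fun setT (Y1 (t i)).
  exact: (wrt_measurable FP (t0 i) (aY1 _ (tiT i))).
have mY2 i : measurable_fun setT (Y2 (t i)).
  exact: (wrt_measurable FP (t0 i) (aY2 _ (tiT i))).
have mI1 m i : measurable_fun setT (elementary_integral B (e1 m) (t i)).
  by have [] := sqint_elementary_integral (e1P m) (t0 i).
have mI2 m i : measurable_fun setT (elementary_integral B (e2 m) (t i)).
  by have [] := sqint_elementary_integral (e2P m) (t0 i).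
pose E1 m i := (\int[P]_w ((Y1 (t i) w - elementary_integral B (e1 m) (t i) w) ^+ 2)%:E)%E.
pose E2 m i := (\int[P]_w ((Y2 (t i) w - elementary_integral B (e2 m) (t i) w) ^+ 2)%:E)%E.
pose D1 m := sq_process (fun s w => H1 s w - elementary_process (e1 m) s w)%R T.
pose D2 m := sq_process (fun s w => H2 s w - elementary_process (e2 m) s w)%R T.
set X := sq_process _ (t n).
have X0 : (0 <= X)%E.
  by apply: integral_ge0 => w _; apply: integral_ge0 => s _; rewrite lee_fin sqr_ge0.
have q0 := normal_moment2_ge0 R.
(* An upper bound of the left-hand side for every [m], which converges to the
   right-hand side. *)
pose S m := (3%:E * (\sum_(i < n.+1) E1 m i + \sum_(i < n.+1) E2 m i +
   (8 * q)%:E * (3%:E * (D1 m + D2 m + X))))%E.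
have cS : S @ \oo --> (3%:E * (0 + 0 + (8 * q)%:E * (3%:E * (0 + 0 + X))))%E.
  have cE (E : nat -> nat -> \bar R) : (forall m i, 0 <= E m i)%E ->
      (forall i, E ^~ i @ \oo --> 0%E) ->
      (fun m => \sum_(i < n.+1) E m i)%E @ \oo --> 0%E.
    move=> E0 cE; have := @cvg_nnesum nat \oo _ R 'I_n.+1 (index_enum 'I_n.+1)
      (fun i m => E m i) (fun=> 0%E) xpredT.
    by rewrite big1//; apply=> // i _; exact: nearW.
  have c1 : (fun m => \sum_(i < n.+1) E1 m i)%E @ \oo --> 0%E.
    apply: cE => [m i|i]; last exact: eY1.
    by apply: integral_ge0 => w _; rewrite lee_fin sqr_ge0.
  have c2 : (fun m => \sum_(i < n.+1) E2 m i)%E @ \oo --> 0%E.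
    apply: cE => [m i|i]; last exact: eY2.
    by apply: integral_ge0 => w _; rewrite lee_fin sqr_ge0.
  have c12 := cvgeD (isT : (0 : \bar R) +? 0)%E c1 c2.
  have d12 := cvgeD (isT : (0 : \bar R) +? 0)%E eH1 eH2.
  apply: cvgeZl; first by [].
  apply: cvgeD; [by []|exact: c12|].
  apply: cvgeZl; first by [].
  apply: cvgeZl; first by [].
  by apply: cvgeD; [|exact: d12|exact: cvg_cst].
have -> : ((72 * q)%:E * X = 3%:E * (0 + 0 + (8 * q)%:E * (3%:E * (0 + 0 + X))))%E.
  by rewrite !adde0 !add0e !muleA -!EFinM; congr (_%:E * _)%E; ring.
apply: (cvge_ge _ cS); apply: nearW => m; rewrite /S.
pose dI i w := elementary_integral B (e1 m) (t i) w - elementary_integral B (e2 m) (t i) w.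
apply: (@le_trans _ _ (3%:E * (\sum_(i < n.+1) E1 m i + \sum_(i < n.+1) E2 m i +
    \int[P]_w (runmax (fun i => dI i w ^+ 2) n)%:E))%E).
  rewrite /E1 /E2 -ge0_integral_sum//; last 2 first.
  - by move=> i; apply: measurable_sqrE; exact: measurable_funB.
  - by move=> i w _; rewrite lee_fin sqr_ge0.
  rewrite -ge0_integral_sum//; last 2 first.
  - by move=> i; apply: measurable_sqrE; exact: measurable_funB.
  - by move=> i w _; rewrite lee_fin sqr_ge0.
  apply: le_integral_sum3 => //.
  - apply/measurable_EFinP; apply: measurable_runmax => i _.
    by apply: measurable_funX; exact: measurable_funB.
  - by apply: emeasurable_sum => i; apply: measurable_sqrE; exact: measurable_funB.
  - by apply: emeasurable_sum => i; apply: measurable_sqrE; exact: measurable_funB.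
  - apply/measurable_EFinP; apply: measurable_runmax => i _.
    by apply: measurable_funX; exact: measurable_funB.
  - by move=> w _; rewrite lee_fin runmax_ge0.
  - by move=> w _; apply: sume_ge0 => i _; rewrite lee_fin sqr_ge0.
  - by move=> w _; apply: sume_ge0 => i _; rewrite lee_fin sqr_ge0.
  - by move=> w _; rewrite lee_fin runmax_ge0.
  move=> w _; rewrite !sumEFin -!EFinD -EFinM lee_fin; apply: runmax_le.
    by rewrite mulr_ge0// !addr_ge0 ?runmax_ge0// sumr_ge0// => i _; exact: sqr_ge0.
  move=> i ile.
  have -> : Y1 (t i) w - Y2 (t i) w =
      (Y1 (t i) w - elementary_integral B (e1 m) (t i) w)
      + - (Y2 (t i) w - elementary_integral B (e2 m) (t i) w) + dI i w.
    by rewrite /dI; ring.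
  apply: le_trans (sqr_sum3 _ _ _) _; rewrite sqrrN ler_wpM2l//.
  have i1 : (i < n.+1)%N by [].
  apply: lerD; last exact: (le_runmax (fun i => dI i w ^+ 2) ile).
  by apply: lerD; rewrite (bigD1 (Ordinal i1))//= lerDl sumr_ge0// => j _; exact: sqr_ge0.
rewrite lee_wpmul2l//; apply: leeD => //.
apply: le_trans (elementary_doob n (e1P m) (e2P m) t00 tS) _.
have me1 s := measurable_elementary (e1P m) s.
have me2 s := measurable_elementary (e2P m) s.
have mH1n := measurable_processS (tT n) mH1.
have mH2n := measurable_processS (tT n) mH2.
apply: lee_wpmul2l; first by rewrite lee_fin mulr_ge0.
apply: (@le_trans _ _ (3%:E * (sq_process (fun s w => H1 s w - elementary_process (e1 m) s w)%R (t n)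
   + sq_process (fun s w => H2 s w - elementary_process (e2 m) s w)%R (t n) + X))%E).
  have -> : sq_process (fun s w => H1 s w - elementary_process (e1 m) s w)%R (t n) =
      sq_process (fun s w => elementary_process (e1 m) s w - H1 s w)%R (t n).
    by apply: eq_integral => w _; apply: eq_integral => s _; rewrite -sqrrN opprB.
  apply: sq_process_sum3; last by move=> s w; ring.
  - exact: (measurable_processB (me1 _) (me2 _)).
  - exact: (measurable_processB (me1 _) mH1n).
  - exact: (measurable_processB mH2n (me2 _)).
  - exact: (measurable_processB mH1n mH2n).
apply: lee_wpmul2l; first by rewrite lee_fin.
apply: leeD; last exact: lexx.
apply: leeD.
  exact: (sq_processS (tT n) (measurable_processB mH1 (me1 T))).
exact: (sq_processS (tT n) (measurable_processB mH2 (me2 T))).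
Qed.

End ito_doob.

(** * The cut norm bounds an integral operator *)

Section fubini_on_sets.
Context d1 d2 (T1 : measurableType d1) (T2 : measurableType d2) (R : realType).
Variables (m1 : {sigma_finite_measure set T1 -> \bar R}).
Variables (m2 : {sigma_finite_measure set T2 -> \bar R}).
Variables (D1 : set T1) (D2 : set T2) (f : T1 * T2 -> R) (M : R).
Hypotheses (mD1 : measurable D1) (mD2 : measurable D2).
Hypotheses (fin1 : (m1 D1 < +oo)%E) (fin2 : (m2 D2 < +oo)%E).
Hypothesis mf : measurable_fun (D1 `*` D2) f.
Hypothesis fM : forall x y, D1 x -> D2 y -> `|f (x, y)| <= M.

Let g : T1 * T2 -> \bar R := (EFin \o f) \_ (D1 `*` D2).

Let ig : (m1 \x m2)%E.-integrable setT g.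
Proof.
apply/(integrable_mkcond _ _).1; first exact: measurableX.
apply: (@bounded_integrableR _ _ _ _ _ _ M) => //; first exact: measurableX.
  rewrite [X in (X < _)%E]product_measure1E// lte_mul_pinfty//.
  by rewrite ge0_fin_numE.
by case=> x y [/=]; exact: fM.
Qed.

Let int1 x : D1 x -> m2.-integrable D2 (fun y => (f (x, y))%:E).
Proof.
move=> D1x; apply: (@bounded_integrableR _ _ _ _ _ _ M) => //.
  apply: (@measurable_comp _ _ _ _ _ _ (D1 `*` D2) f _ (fun y => (x, y))) => //.
  - exact: measurableX.
  - by move=> _ [y D2y <-].
  - by apply: measurable_funTS; exact: measurable_fun_pair.
by move=> y; exact: fM.
Qed.

Let int2 y : D2 y -> m1.-integrable D1 (fun x => (f (x, y))%:E).
Proof.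
move=> D2y; apply: (@bounded_integrableR _ _ _ _ _ _ M) => //.
  apply: (@measurable_comp _ _ _ _ _ _ (D1 `*` D2) f _ (fun x => (x, y))) => //.
  - exact: measurableX.
  - by move=> _ [x D1x <-].
  - by apply: measurable_funTS; exact: measurable_fun_pair.
by move=> x D1x; exact: fM.
Qed.

Lemma Rintegral_snd_le x : D1 x ->
  `|\int[m2]_(y in D2) f (x, y)| <= M * fine (m2 D2).
Proof.
move=> D1x; apply: le_trans (le_normr_Rintegral mD2 (int1 D1x)) _.
rewrite -Rintegral_cst//; apply: le_Rintegral => //.
- exact: integrable_norm (int1 D1x).
- by apply: (@bounded_integrableR _ _ _ _ _ _ `|M|).
- by move=> y; exact: fM.
Qed.

Lemma Rintegral_fst_le y : D2 y ->
  `|\int[m1]_(x in D1) f (x, y)| <= M * fine (m1 D1).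
Proof.
move=> D2y; apply: le_trans (le_normr_Rintegral mD1 (int2 D2y)) _.
rewrite -Rintegral_cst//; apply: le_Rintegral => //.
- exact: integrable_norm (int2 D2y).
- by apply: (@bounded_integrableR _ _ _ _ _ _ `|M|).
- by move=> x D1x; exact: fM.
Qed.

Lemma integrable_Rintegral_snd :
  m1.-integrable D1 (EFin \o (fun x => \int[m2]_(y in D2) f (x, y))).
Proof.
apply: (@bounded_integrableR _ _ _ _ _ _ (M * fine (m2 D2))) => //.
  exact: measurable_Rintegral_snd.
exact: Rintegral_snd_le.
Qed.

Lemma integrable_Rintegral_fst :
  m2.-integrable D2 (EFin \o (fun y => \int[m1]_(x in D1) f (x, y))).
Proof.
apply: (@bounded_integrableR _ _ _ _ _ _ (M * fine (m1 D1))) => //.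
  exact: measurable_Rintegral_fst.
exact: Rintegral_fst_le.
Qed.

Let gsnd : (\int[m1]_x \int[m2]_y g (x, y) =
  (\int[m1]_(x in D1) (\int[m2]_(y in D2) f (x, y))%R)%:E)%E.
Proof.
rewrite -integral_EFin//; last exact: integrable_Rintegral_snd.
rewrite [RHS]integral_mkcond; apply: eq_integral => x _; rewrite patchE.
case: ifPn => xD.
  have D1x : D1 x by move: xD; rewrite inE.
  rewrite /= -integral_EFin//; last exact: int1.
  rewrite [RHS]integral_mkcond; apply: eq_integral => y _.
  rewrite /g !patchE; congr (if _ then _ else _).
  by apply/idP/idP; rewrite !inE => // -[].
apply: integral0_eq => y _; rewrite /g patchE ifN//.
by apply: contra xD; rewrite !inE => -[].
Qed.

Let gfst : (\int[m2]_y \int[m1]_x g (x, y) =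
  (\int[m2]_(y in D2) (\int[m1]_(x in D1) f (x, y))%R)%:E)%E.
Proof.
rewrite -integral_EFin//; last exact: integrable_Rintegral_fst.
rewrite [RHS]integral_mkcond; apply: eq_integral => y _; rewrite patchE.
case: ifPn => yD.
  have D2y : D2 y by move: yD; rewrite inE.
  rewrite /= -integral_EFin//; last exact: int2.
  rewrite [RHS]integral_mkcond; apply: eq_integral => x _.
  rewrite /g !patchE; congr (if _ then _ else _).
  by apply/idP/idP; rewrite !inE => // -[].
apply: integral0_eq => x _; rewrite /g patchE ifN//.
by apply: contra yD; rewrite !inE => -[].
Qed.

Lemma integral_prod_snd : (\int[(m1 \x m2)%E]_(p in D1 `*` D2) (f p)%:E =
  (\int[m1]_(x in D1) (\int[m2]_(y in D2) f (x, y))%R)%:E)%E.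
Proof. by rewrite integral_mkcond -gsnd (integral12_prod_meas1 ig). Qed.

Lemma Rfubini_on :
  \int[m1]_(x in D1) \int[m2]_(y in D2) f (x, y)
  = \int[m2]_(y in D2) \int[m1]_(x in D1) f (x, y).
Proof. by apply/EFin_inj; rewrite -gsnd -gfst; exact: (Fubini ig). Qed.

End fubini_on_sets.

Section cut_norm_bound.
Variable R : realType.
Local Notation mu := (@lebesgue_measure R).
Local Notation I := (unit_itv R).

Lemma measurable_unit_itv : measurable I.
Proof. exact: measurable_itv. Qed.

Lemma unit_itv_measure : mu I = 1%E.
Proof. by rewrite lebesgue_measure_itv/= lte_fin ltr01 sube0. Qed.

Lemma sub_unit_itv_fin (A : set R) : measurable A -> A `<=` I -> (mu A < +oo)%E.
Proof.
move=> mA AI; apply: (@le_lt_trans _ _ (mu I)); last by rewrite unit_itv_measure ltry.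
by apply: le_measure; rewrite ?inE//; exact: measurable_unit_itv.
Qed.

Let diff_le (x y c : R) : `|x| <= c -> `|y| <= c -> x - y <= 2 * c.
Proof. by rewrite !ler_norml => /andP[_ xc] /andP[cy _]; lra. Qed.

Let signed_part (f : R -> R) : set R := [set x | I x /\ 0 <= f x].
Let other_part (f : R -> R) : set R := [set x | I x /\ f x < 0].

(** The two sets are those where [f] is nonnegative and where it is negative. *)
Lemma Rintegral_norm_split (f : R -> R) M : measurable_fun I f ->
  (forall x, I x -> `|f x| <= M) ->
  exists A B : set R, [/\ measurable A, measurable B, A `<=` I, B `<=` I &
    \int[mu]_(x in I) `|f x| = \int[mu]_(x in A) f x - \int[mu]_(x in B) f x].
Proof.
move=> mf fM; exists (signed_part f), (other_part f).
have mA : measurable (signed_part f).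
  have := mf measurable_unit_itv `[0, +oo[%classic (measurable_itv _).
  congr measurable; apply/seteqP; split => x /=; rewrite in_itv/= andbT => -[]//.
have mB : measurable (other_part f).
  have := mf measurable_unit_itv `]-oo, 0[%classic (measurable_itv _).
  congr measurable; apply/seteqP; split => x /=; rewrite in_itv/= => -[]//.
have AI : signed_part f `<=` I by move=> x [].
have BI : other_part f `<=` I by move=> x [].
have IE : I = signed_part f `|` other_part f.
  apply/seteqP; split => x; last by case=> -[].
  by move=> Ix; case: (leP 0 (f x)) => h; [left|right].
have iA (h : R -> R) N : measurable_fun I h -> (forall x, I x -> `|h x| <= N) ->
    forall A, measurable A -> A `<=` I -> mu.-integrable A (EFin \o h).
  move=> mh hN A mA' AI'; apply: (@bounded_integrableR _ _ _ _ _ _ N) => //.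
  - exact: sub_unit_itv_fin.
  - exact: (measurable_funS measurable_unit_itv AI' mh).
  - by move=> x /AI'; exact: hN.
have mnf : measurable_fun I (fun x => `|f x|) by exact: measurableT_comp.
have nfM x : I x -> `| `|f x| | <= M by rewrite normr_id; exact: fM.
split => //.
rewrite {1}IE Rintegral_setU//; last 2 first.
- by rewrite -IE; apply: (iA _ M mnf nfM) => //; exact: measurable_unit_itv.
- by apply/disj_setPS => x [[_ h] [_]]; rewrite ltNge h.
congr (_ + _).
  by apply: eq_Rintegral => x; rewrite inE => -[_ h]; rewrite ger0_norm.
rewrite -mulN1r -RintegralZl//; last exact: iA fM _ mB BI.
by apply: eq_Rintegral => x; rewrite inE => -[_ h]; rewrite ltr0_norm// mulN1r.
Qed.

(** The cut norm controls the norm of the integral operator from bounded functions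
    to integrable ones: the extremal test functions are signs, each the difference
    of two indicators, which gives a factor 2 for each of the two variables. *)
Lemma operator_cut_bound (w : R -> R -> R) (m : R -> R) (c : R) :
  measurable_fun (I `*` I) (fun p : R * R => w p.1 p.2) ->
  (forall u v, I u -> I v -> `|w u v| <= 1) ->
  measurable_fun I m -> (forall v, I v -> `|m v| <= 1) ->
  (forall A B : set R, measurable A -> measurable B -> A `<=` I -> B `<=` I ->
    (`| \int[(mu \x mu)%E]_(p in A `*` B) (w p.1 p.2)%:E | <= c%:E)%E) ->
  \int[mu]_(u in I) `|\int[mu]_(v in I) (w u v * m v)| <= 4 * c.
Proof.
move=> mw w1 mm m1 wc; have mI := measurable_unit_itv.
have finI : (mu I < +oo)%E by rewrite unit_itv_measure ltry.
pose f (p : R * R) := w p.1 p.2 * m p.2.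
have mf : measurable_fun (I `*` I) f.
  apply: measurable_funM => //.
  apply: (@measurable_comp _ _ _ _ _ _ I m) => //; last exact: measurable_funTS measurable_snd.
  by move=> _ [[u v] [/= _ Iv] <-].
have f1 u v : I u -> I v -> `|f (u, v)| <= 1.
  by move=> Iu Iv; rewrite normrM mulr_ile1// ?w1 ?m1.
have mXS (A B : set R) : A `<=` I -> B `<=` I -> A `*` B `<=` I `*` I.
  by move=> AI BI [u v] [/= /AI ? /BI].
have cutE A B : measurable A -> measurable B -> A `<=` I -> B `<=` I ->
    `|\int[mu]_(v in B) \int[mu]_(u in A) w u v| <= c.
  move=> mA mB AI BI; have finA := sub_unit_itv_fin mA AI.
  have finB := sub_unit_itv_fin mB BI.
  have mwAB : measurable_fun (A `*` B) (fun p : R * R => w p.1 p.2).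
    by apply: measurable_funS mw; [exact: measurableX|exact: mXS].
  have wAB u v : A u -> B v -> `|w u v| <= 1 by move=> /AI Iu /BI; exact: w1.
  have := wc A B mA mB AI BI.
  rewrite (@integral_prod_snd _ _ _ _ R mu mu A B (fun p : R * R => w p.1 p.2) 1 mA mB finA finB mwAB wAB) lee_fin.
  by rewrite (@Rfubini_on _ _ _ _ R mu mu A B (fun p : R * R => w p.1 p.2) 1 mA mB finA finB mwAB wAB).
pose Phi u := \int[mu]_(v in I) f (u, v).
have half A : measurable A -> A `<=` I -> `|\int[mu]_(u in A) Phi u| <= 2 * c.
  move=> mA AI; have finA := sub_unit_itv_fin mA AI.
  have mfA : measurable_fun (A `*` I) f.
    by apply: measurable_funS mf; [exact: measurableX|exact: mXS].
  have fA u v : A u -> I v -> `|f (u, v)| <= 1 by move=> /AI; exact: f1.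
  have mwA : measurable_fun (A `*` I) (fun p : R * R => w p.1 p.2).
    by apply: measurable_funS mw; [exact: measurableX|exact: mXS].
  have wA u v : A u -> I v -> `|w u v| <= 1 by move=> /AI; exact: w1.
  rewrite /Phi (@Rfubini_on _ _ _ _ R mu mu A I f 1 mA mI finA finI mfA fA).
  pose Psi v := \int[mu]_(u in A) w u v.
  have mPsi : measurable_fun I Psi.
    exact: (@measurable_Rintegral_fst _ _ _ _ R mu A I mA mI (fun p : R * R => w p.1 p.2)).
  have PsiM v : I v -> `|Psi v| <= 1 * fine (mu A).
    exact: (@Rintegral_fst_le _ _ _ _ R mu A I (fun p : R * R => w p.1 p.2) 1 mA mI finA mwA wA).
  have [C [D [mC mD CI DI E]]] := Rintegral_norm_split mPsi PsiM.
  apply: (@le_trans _ _ (\int[mu]_(v in I) `|Psi v|)); last first.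
    rewrite E; apply: diff_le; first exact: (cutE _ _ mA mC AI CI).
    exact: (cutE _ _ mA mD AI DI).
  have iI := @integrable_Rintegral_fst _ _ _ _ R mu mu A I f 1 mA mI finA finI mfA fA.
  apply: le_trans (@le_normr_Rintegral _ _ R mu I _ mI iI) _.
  apply: le_Rintegral => //; first exact: integrable_norm iI.
    apply: (@bounded_integrableR _ _ _ _ _ _ (1 * fine (mu A))) => //.
      exact: measurableT_comp.
    by move=> v Iv; rewrite normr_id; exact: PsiM.
  move=> v Iv; rewrite /f/=.
  have -> : \int[mu]_(u in A) (w u v * m v) = Psi v * m v.
    rewrite RintegralZr//; apply: (@bounded_integrableR _ _ _ _ _ _ 1) => //.
      apply: (@measurable_comp _ _ _ _ _ _ (A `*` I) (fun p : R * R => w p.1 p.2) _ (fun u => (u, v))) => //.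
      - exact: measurableX.
      - by move=> _ [u Au <-].
      - by apply: measurable_funTS; exact: measurable_fun_pair.
    by move=> u Au; exact: wA.
  by rewrite normrM ler_piMr// m1.
have mPhi : measurable_fun I Phi by exact: measurable_Rintegral_snd.
have PhiM u : I u -> `|Phi u| <= 1 * fine (mu I).
  exact: (@Rintegral_snd_le _ _ _ _ R mu I I f 1 mI mI finI mf f1).
have [C [D [mC mD CI DI E]]] := Rintegral_norm_split mPhi PhiM.
apply: le_trans (_ : _ <= 2 * (2 * c)) _; last lra.
by rewrite [X in X <= _]E; apply: diff_le; exact: half.
Qed.

End cut_norm_bound.

(** * Continuous processes on finite grids *)

Section time_grid.
Variables (R : realType) (T : R).
Hypothesis T0 : 0 < T.

Definition grid_step (n : nat) : R := T / n.+1%:R.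

Definition grid (n i : nat) : R := Num.min (i%:R * grid_step n) T.

Lemma grid_step_gt0 n : 0 < grid_step n.
Proof. by rewrite divr_gt0. Qed.

Lemma grid0 n : grid n 0 = 0.
Proof. by rewrite /grid mul0r; apply/min_idPl; exact: ltW. Qed.

Lemma grid_last n : grid n n.+1 = T.
Proof. by rewrite /grid mulrC divfK ?minxx// pnatr_eq0. Qed.

Lemma grid_mono n i : grid n i <= grid n i.+1.
Proof.
rewrite /grid le_min !ge_min lexx orbT andbT ler_pM2r ?grid_step_gt0//.
by rewrite ler_nat leqnSn.
Qed.

Lemma grid_leT n i : grid n i <= T.
Proof. by rewrite ge_min lexx orbT. Qed.

Lemma grid_time n i : 0 <= grid n i <= T.
Proof.
by rewrite grid_leT andbT le_min (ltW T0) andbT mulr_ge0// ltW// grid_step_gt0.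
Qed.

Definition grid_index (n : nat) (s : R) : nat := Num.truncn (s / grid_step n).

Lemma grid_index_itv n s : 0 <= s ->
  (grid_index n s)%:R * grid_step n <= s < (grid_index n s).+1%:R * grid_step n.
Proof.
move=> s0; have d0 := grid_step_gt0 n.
rewrite -ler_pdivlMr// -ltr_pdivrMr//; apply: Num.Theory.truncn_itv.
by rewrite divr_ge0// ltW.
Qed.

Lemma grid_index_le n s : 0 <= s <= T -> (grid_index n s <= n.+1)%N.
Proof.
move=> /andP[s0 sT]; have /andP[h _] := grid_index_itv n s0.
have := le_trans h sT; rewrite -ler_pdivlMr ?grid_step_gt0//.
rewrite /grid_step invf_div mulrCA divff ?gt_eqF// mulr1 ler_nat.
by [].
Qed.

Lemma grid_indexE n s : 0 <= s <= T ->
  grid n (grid_index n s) = (grid_index n s)%:R * grid_step n.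
Proof.
move=> /andP[s0 sT]; apply/min_idPl; have /andP[h _] := grid_index_itv n s0.
exact: le_trans sT.
Qed.

Lemma cvg_grid_index s : 0 <= s <= T ->
  (fun n => grid n (grid_index n s)) @ \oo --> s.
Proof.
move=> sT; have /andP[s0 _] := sT.
apply: (@squeeze_cvgr _ _ _ _ (fun n => s - grid_step n) (fun=> s)).
- apply: nearW => n; have := grid_index_itv n s0; rewrite grid_indexE//.
  by rewrite -natr1 mulrDl mul1r => /andP[-> h]; rewrite andbT lerBlDr ltW.
- rewrite -[X in _ --> X]subr0; apply: cvgB; first exact: cvg_cst.
  rewrite -(mulr0 T); apply: cvgM; first exact: cvg_cst.
  exact: cvg_harmonic.
- exact: cvg_cst.
Qed.

Lemma cvg_on_grid (f : R -> R) s : {within time_itv T, continuous f} ->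
  0 <= s <= T -> (fun n => f (grid n (grid_index n s))) @ \oo --> f s.
Proof.
move=> /subspace_continuousP cf sT.
have sI : time_itv T s by rewrite /time_itv /= in_itv.
apply: (cvg_comp (fun n => grid n (grid_index n s)) f _ (cf s sI)).
move=> U nU.
have h : \forall n \near \oo,
  time_itv T (grid n (grid_index n s)) -> U (grid n (grid_index n s)).
  exact: (cvg_grid_index sT nU).
suff : \forall n \near \oo, U (grid n (grid_index n s)) by [].
apply: filterS h => n; apply.
by have := grid_time n (grid_index n s); rewrite /time_itv /= in_itv.
Qed.

(** A process with continuous paths is the pointwise limit of its values at the
    last point of a grid. *)
Lemma continuous_process_measurable dO (Omega : measurableType dO)
    (X : R -> Omega -> R) :
  (forall w, {within time_itv T, continuous (X ^~ w)}) ->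
  (forall t, 0 <= t <= T -> measurable_fun setT (X t)) ->
  measurable_fun (time_itv T `*` [set: Omega]) (fun p : R * Omega => X p.1 p.2).
Proof.
move=> cX mX.
pose A n (k : nat) : set R := [set s | k%:R * grid_step n <= s < k.+1%:R * grid_step n].
have mA n k : measurable (A n k).
  have -> : A n k = `[k%:R * grid_step n, k.+1%:R * grid_step n[%classic.
    by apply/seteqP; split => x; rewrite /A /= in_itv.
  exact: measurable_itv.
pose h n (p : R * Omega) := \sum_(k < n.+2) \1_(A n k) p.1 * X (grid n k) p.2.
apply: (@measurable_fun_cvg _ _ _ _ h).
  move=> n; apply: measurable_funTS; apply: measurable_sum => k; apply: measurable_funM.
    by apply: measurableT_comp; [exact: measurable_indic|exact: measurable_fst].
  by apply: measurableT_comp; [apply: mX; exact: grid_time|exact: measurable_snd].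
move=> [s w] [/= sI _].
have sT : 0 <= s <= T by move: sI; rewrite /time_itv /= in_itv.
have /andP[s0 _] := sT.
rewrite (_ : (fun n => h n (s, w)) = (fun n => X (grid n (grid_index n s)) w)).
  exact: (cvg_on_grid (cX w) sT).
apply/funext => n; rewrite /h/=.
have kn : (grid_index n s < n.+2)%N by rewrite ltnS grid_index_le.
rewrite (bigD1 (Ordinal kn))//= big1 ?addr0.
  rewrite indicE mem_set ?mul1r//; exact: grid_index_itv.
move=> k kE; rewrite indicE memNset ?mul0r// => /andP[h1 h2].
move/eqP: kE; apply; apply/val_inj => /=; apply/esym/Num.Theory.truncn_def.
by rewrite ler_pdivlMr ?grid_step_gt0// ltr_pdivrMr ?grid_step_gt0// h1.
Qed.

Lemma le_limn_einf (u v : (\bar R)^nat) : (forall n, (u n <= v n)%E) ->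
  (limn_einf u <= limn_einf v)%E.
Proof.
move=> uv; rewrite !limn_einf_lim; apply: lee_lim.
- exact: is_cvg_einfs.
- exact: is_cvg_einfs.
apply: nearW => n; apply: le_ereal_inf_tmp => _ [k /= nk <-].
by apply: le_trans (uv k); apply: ereal_inf_lbound; exists k.
Qed.

(** By continuity the supremum over time is at most the lower limit of the maxima
    along the grids, to which Fatou's lemma applies. *)
Lemma integral_sup_le dO (Omega : measurableType dO) (P : probability Omega R)
    (f : R -> Omega -> R) (K : \bar R) :
  (forall w, {within time_itv T, continuous (f ^~ w)}) ->
  (forall t, 0 <= t <= T -> measurable_fun setT (f t)) ->
  (forall t w, 0 <= t <= T -> 0 <= f t w) ->
  measurable_fun setT (fun w => ereal_sup [set (f t w)%:E | t in time_itv T]) ->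
  (forall n, (\int[P]_w (runmax (fun i => f (grid n i) w) n.+1)%:E <= K)%E) ->
  (\int[P]_w ereal_sup [set (f t w)%:E | t in time_itv T] <= K)%E.
Proof.
move=> cf mf f0 msup fK.
pose M n w : \bar R := (runmax (fun i => f (grid n i) w) n.+1)%:E.
have mM n : measurable_fun setT (M n).
  apply/measurable_EFinP; apply: measurable_runmax => i _.
  by apply: mf; exact: grid_time.
have M0 n w : setT w -> (0 <= M n w)%E by rewrite lee_fin runmax_ge0.
have supM w : (ereal_sup [set (f t w)%:E | t in time_itv T] <= limn_einf (M ^~ w))%E.
  apply: ge_ereal_sup => _ [t tI <-].
  have tT : 0 <= t <= T by move: tI; rewrite /time_itv /= in_itv.
  have ct : (fun n => (f (grid n (grid_index n t)) w)%:E) @ \oo --> (f t w)%:E.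
    by apply: cvg_EFin; [exact: nearW|exact: (cvg_on_grid (cf w) tT)].
  have [<- _] := cvg_limn_einf_sup ct.
  apply: le_limn_einf => n; rewrite lee_fin.
  exact: (le_runmax (fun i => f (grid n i) w) (grid_index_le n tT)).
apply: (@le_trans _ _ (\int[P]_w limn_einf (M ^~ w))%E).
  apply: ge0_le_integral => //.
  - move=> w _; apply: le_trans (_ : (0 <= (f 0 w)%:E)%E) _.
      by rewrite lee_fin f0// lexx ltW.
    by apply: ereal_sup_ubound; exists 0 => //; rewrite /time_itv /= in_itv/= lexx ltW.
  - apply: measurableT_comp => //; apply: (measurable_fun_limn_esup (f := fun n w => - M n w)%E).
    by move=> n; exact: measurableT_comp.
apply: le_trans (fatou P measurableT mM M0) _.
apply: le_trans (le_limn_einf fK) _.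
by have [-> _] := cvg_limn_einf_sup (cvg_cst K : (fun _ : nat => K) @ \oo --> K).
Qed.

End time_grid.

(** * Matrix-valued integrands and the mean-field Hamiltonian *)

Section jensen.
Context d (T : measurableType d) (R : realType) (mu : {measure set T -> \bar R}).
Variables (D : set T) (mD : measurable D).

(** Jensen's inequality: the integral of [(g - A / M) ^+ 2] is nonnegative, for [A]
    the integral of [g]. *)
Lemma sqr_Rintegral_le (M : R) (g : T -> R) : 0 < M -> (mu D <= M%:E)%E ->
  mu.-integrable D (EFin \o g) -> mu.-integrable D (EFin \o (fun x => g x ^+ 2)) ->
  (\int[mu]_(x in D) g x) ^+ 2 <= M * \int[mu]_(x in D) g x ^+ 2.
Proof.
move=> M0 DM ig ig2; set A := \int[mu]_(x in D) g x.
have fin : (mu D < +oo)%E by apply: le_lt_trans DM _; exact: ltry.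
have mM : fine (mu D) <= M by rewrite -lee_fin fineK// ge0_fin_numE.
have ic r : mu.-integrable D (EFin \o (fun=> r : R)).
  by apply: (@bounded_integrableR _ _ _ _ _ _ `|r|).
have : 0 <= \int[mu]_(x in D) (g x - A / M) ^+ 2.
  by apply: Rintegral_ge0 => x _; exact: sqr_ge0.
have -> : \int[mu]_(x in D) (g x - A / M) ^+ 2 = \int[mu]_(x in D) g x ^+ 2
     + (- (2 * (A / M)) * A + (A / M) ^+ 2 * fine (mu D)).
  rewrite -(Rintegral_cst mu mD) -(RintegralZl _ mD ig) -RintegralD//; last first.
    exact: integrableZR.
  rewrite -RintegralD//; last by apply: integrableDR => //; exact: integrableZR.
  by apply: eq_Rintegral => x _; ring.
have h : (A / M) ^+ 2 * fine (mu D) <= (A / M) ^+ 2 * M.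
  by rewrite ler_wpM2l// sqr_ge0.
have -> : - (2 * (A / M)) * A = - 2 * (A ^+ 2 / M) by ring.
have e : (A / M) ^+ 2 * M = A ^+ 2 / M by field; rewrite gt_eqF.
rewrite e in h; move=> h2.
rewrite -ler_pdivrMl// mulrC; lra.
Qed.

End jensen.

Section measurable_matrices.
Context d (T : measurableType d) (R : realType) (n : nat) (D : set T).
Implicit Types (f g : T -> 'M[R[i]]_n) (c : coord n).

Definition measurable_mx f : Prop :=
  forall i j, measurable_fun D (fun x => complex.Re (f x i j)) /\
              measurable_fun D (fun x => complex.Im (f x i j)).

Lemma measurable_mxP f :
  measurable_mx f <-> forall c, measurable_fun D (fun x => comp c (f x)).
Proof.
split=> [mf [[i j] b]|mf i j]; first by case: b; case: (mf i j).
by split; [exact: (mf (i, j, true))|exact: (mf (i, j, false))].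
Qed.

Lemma measurable_mx_cst (A : 'M[R[i]]_n) : measurable_mx (fun=> A).
Proof. by move=> i j; split. Qed.

Lemma measurable_mxD f g : measurable_mx f -> measurable_mx g ->
  measurable_mx (fun x => f x + g x).
Proof.
move=> /measurable_mxP mf /measurable_mxP mg; apply/measurable_mxP => c.
by under eq_fun do rewrite compD; exact: measurable_funD.
Qed.

Lemma measurable_mxN f : measurable_mx f -> measurable_mx (fun x => - f x).
Proof.
move=> /measurable_mxP mf; apply/measurable_mxP => c.
by under eq_fun do rewrite compN; exact: measurableT_comp.
Qed.

Lemma measurable_mxB f g : measurable_mx f -> measurable_mx g ->
  measurable_mx (fun x => f x - g x).
Proof. by move=> mf mg; apply: measurable_mxD => //; exact: measurable_mxN. Qed.

Lemma measurable_mxZ (z : R[i]) f : measurable_mx f -> measurable_mx (fun x => z *: f x).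
Proof.
move=> mf i j; have [mr mi] := mf i j; case: z => a b.
split.
  rewrite (_ : (fun x => _) = fun x => a * complex.Re (f x i j) - b * complex.Im (f x i j)).
    by apply: measurable_funB; exact: measurable_funM.
  by apply/funext => x; rewrite mxE; case: (f x i j).
rewrite (_ : (fun x => _) = fun x => a * complex.Im (f x i j) + b * complex.Re (f x i j)).
  by apply: measurable_funD; exact: measurable_funM.
by apply/funext => x; rewrite mxE; case: (f x i j).
Qed.

Lemma measurable_mxM f g : measurable_mx f -> measurable_mx g ->
  measurable_mx (fun x => f x *m g x).
Proof.
move=> mf mg i j; split.
  rewrite (_ : (fun x => _) = fun x => \sum_k
      (complex.Re (f x i k) * complex.Re (g x k j) -
       complex.Im (f x i k) * complex.Im (g x k j))).
    apply: measurable_sum => k; have [? ?] := mf i k; have [? ?] := mg k j.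
    by apply: measurable_funB; exact: measurable_funM.
  apply/funext => x; rewrite mxE Re_sum; apply: eq_bigr => k _.
  by case: (f x i k) => ? ?; case: (g x k j).
rewrite (_ : (fun x => _) = fun x => \sum_k
    (complex.Re (f x i k) * complex.Im (g x k j) +
     complex.Im (f x i k) * complex.Re (g x k j))).
  apply: measurable_sum => k; have [? ?] := mf i k; have [? ?] := mg k j.
  by apply: measurable_funD; exact: measurable_funM.
apply/funext => x; rewrite mxE Im_sum; apply: eq_bigr => k _.
by case: (f x i k) => ? ?; case: (g x k j).
Qed.

Lemma measurable_sqnorm f : measurable_mx f -> measurable_fun D (fun x => sqnorm (f x)).
Proof.
move=> /measurable_mxP mf; apply: measurable_sum => c.
exact: measurable_funX.
Qed.

Lemma measurable_drift (L : 'M[R[i]]_n) f g : measurable_mx f -> measurable_mx g ->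
  measurable_mx (fun x => drift L (f x) (g x)).
Proof.
move=> mf mg; have mc A := measurable_mx_cst A.
apply: measurable_mxD.
  apply: measurable_mxN; apply: measurable_mxZ.
  by apply: measurable_mxB; exact: measurable_mxM.
apply: measurable_mxB.
  by apply: measurable_mxM => //; exact: measurable_mxM.
apply: measurable_mxZ; apply: measurable_mxD; apply: measurable_mxM => //;
  exact: measurable_mxM.
Qed.

Lemma measurable_mean_field (a : pair_kernel R n) f : measurable_mx f ->
  measurable_mx (fun x => mean_field a (f x)).
Proof.
move=> /measurable_mxP mf; apply/measurable_mxP => c.
under eq_fun do rewrite comp_mean_field.
by apply: measurable_sum => c'; exact: measurable_funM.
Qed.

End measurable_matrices.

Section matrix_integrals.
Variable R : realType.

Lemma comp_inj n (X Y : 'M[R[i]]_n) : (forall c, comp c X = comp c Y) -> X = Y.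
Proof.
move=> XY; apply/matrixP => i j; have := XY (i, j, true); have := XY (i, j, false).
by rewrite /comp/=; case: (X i j) (Y i j) => [? ?] [? ?] /= -> ->.
Qed.

Lemma comp_mxintegral n d (T : measurableType d) (mu : {measure set T -> \bar R})
    (D : set T) (f : T -> 'M[R[i]]_n) c :
  comp c (mxintegral mu D f) = \int[mu]_(x in D) comp c (f x).
Proof. by rewrite /comp mxE; case: ifP. Qed.

Lemma compZ n (r : R) (X : 'M[R[i]]_n) c : comp c (r%:C *: X) = r * comp c X.
Proof.
rewrite /comp !mxE; case: ifP => _; case: (X _ _) => x y /=; rewrite mul0r.
  by rewrite subr0.
by rewrite addr0.
Qed.

Local Notation mu := (@lebesgue_measure R).
Local Notation I := (unit_itv R).

(** [A^rho] is linear in [rho], so the interaction acts on the averaged state. *)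
Lemma hamiltonianE n (H : 'M[R[i]]_n) (a : pair_kernel R n) (W : R -> R -> R)
    (m : R -> 'M[R[i]]_n) (u M : R) :
  measurable_fun I (W u) -> measurable_mx I m ->
  (forall v, I v -> `|W u v| <= 1) -> (forall v c, I v -> `|comp c (m v)| <= M) ->
  hamiltonian H a W m u =
  H + mean_field a (mxintegral mu I (fun v => (W u v)%:C *: m v)).
Proof.
move=> mW /measurable_mxP mm W1 mM; congr (_ + _); apply: comp_inj => c.
have mI := @measurable_unit_itv R.
have finI : (mu I < +oo)%E by rewrite unit_itv_measure ltry.
rewrite comp_mxintegral comp_mean_field.
have iWm c' : mu.-integrable I (EFin \o (fun v => W u v * comp c' (m v))).
  apply: (@bounded_integrableR _ _ _ _ _ _ M) => //.
    exact: (measurable_funM mW (mm c')).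
  move=> v Iv; rewrite normrM -[leRHS]mul1r ler_pM//; first exact: W1.
  exact: mM.
transitivity (\int[mu]_(v in I) \sum_c' mean_field_coef a c c' * (W u v * comp c' (m v))).
  apply: eq_Rintegral => v _; rewrite compZ comp_mean_field mulr_sumr.
  by apply: eq_bigr => c' _; rewrite mulrCA.
rewrite Rintegral_sum//; last by move=> c'; exact: integrableZR.
apply: eq_bigr => c' _; rewrite RintegralZl// comp_mxintegral; congr (_ * _).
by apply: eq_Rintegral => v _; rewrite compZ.
Qed.

End matrix_integrals.

(** * Regularity of one solution *)

Section one_solution.
Context (R : realType) (d : nat) dO (Omega : measurableType dO).
Variables (P : probability Omega R) (F : R -> set (set Omega)).
Variables (B : R -> R -> Omega -> R) (T eta : R) (H L : 'M[R[i]]_d).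
Variables (a : pair_kernel R d) (rho0 : 'M[R[i]]_d) (W : R -> R -> R).
Variable gamma : R -> R -> Omega -> 'M[R[i]]_d.
Hypothesis T0 : 0 < T.
Hypothesis FP : filtration_usual P F.
Hypothesis gW : graphon W.
Hypothesis S : is_solution P F B T eta H L a rho0 W gamma.

Local Notation mu := (@lebesgue_measure R).
Local Notation I := (unit_itv R).
Local Notation N := (#|coord d|%:R : R).

Definition mean_state (s v : R) : 'M[R[i]]_d := mxexpectation P (gamma v s).

Definition averaged_state (u s : R) : 'M[R[i]]_d :=
  mxintegral mu I (fun v => (W u v)%:C *: mean_state s v).

Lemma time_itvP (t s : R) : time_itv t s <-> 0 <= s <= t.
Proof. by rewrite /time_itv /= in_itv. Qed.

Lemma time_itv_measure (t : R) : 0 <= t -> mu (time_itv t) = t%:E.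
Proof.
move=> t0; rewrite /time_itv lebesgue_measure_itv/= lte_fin sube0.
by case: ltP => // t0'; congr _%:E; apply/eqP; rewrite eq_le t0 t0'.
Qed.

Lemma time_itv_fin (t : R) : 0 <= t -> (mu (time_itv t) < +oo)%E.
Proof. by move=> t0; rewrite time_itv_measure// ltry. Qed.

Lemma graphon_le1 u v : I u -> I v -> `|W u v| <= 1.
Proof. by move=> Iu Iv; have [_ _ /(_ u v Iu Iv)/andP[w0 w1]] := gW; rewrite ger0_norm. Qed.

Lemma graphon_section u : I u -> measurable_fun I (W u).
Proof.
move=> Iu; have [mW _ _] := gW.
apply: (@measurable_comp _ _ _ _ _ _ (I `*` I) (fun p : R * R => W p.1 p.2) _
  (fun v => (u, v))) => //.
- by apply: measurableX; exact: measurable_unit_itv.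
- by move=> _ [v Iv <-].
- by apply: measurable_funTS; exact: measurable_fun_pair.
Qed.

Lemma measurable_state u t c : I u -> 0 <= t <= T ->
  measurable_fun setT (fun w => comp c (gamma u t w)).
Proof.
case: c => [[i j] b] Iu tT; have /andP[t0 _] := tT.
have [h1 h2] := sol_adapted S i j Iu tT.
by case: b; apply: (wrt_measurable FP t0).
Qed.

Lemma state_le1 u t w c : I u -> 0 <= t <= T -> `|comp c (gamma u t w)| <= 1.
Proof. by move=> Iu tT; apply: density_comp_le1; exact: (sol_density S). Qed.

Lemma continuous_state u w c : I u ->
  {within time_itv T, continuous (fun t => comp c (gamma u t w))}.
Proof.
case: c => [[i j] b] Iu; have [h1 h2] := sol_continuous S w i j Iu.
by case: b.
Qed.

Lemma measurable_state_process u : I u ->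
  measurable_mx (time_itv T `*` [set: Omega]) (fun p : R * Omega => gamma u p.1 p.2).
Proof.
move=> Iu; apply/measurable_mxP => c.
apply: (continuous_process_measurable T0 (X := fun t w => comp c (gamma u t w))).
  by move=> w; exact: continuous_state.
by move=> t tT; exact: measurable_state.
Qed.

Lemma integrable_state u t c : I u -> 0 <= t <= T ->
  P.-integrable setT (EFin \o (fun w => comp c (gamma u t w))).
Proof.
move=> Iu tT; apply: bounded_integrable; split; first exact: measurable_state.
by exists 1 => w; exact: state_le1.
Qed.

Lemma comp_mean_state s v c :
  comp c (mean_state s v) = \int[P]_w comp c (gamma v s w).
Proof. exact: comp_mxintegral. Qed.

Lemma mean_state_le1 s v c : I v -> 0 <= s <= T -> `|comp c (mean_state s v)| <= 1.
Proof.
move=> Iv sT; rewrite comp_mean_state.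
have i := integrable_state c Iv sT.
apply: le_trans (le_normr_Rintegral _ i) _ => //.
apply: le_trans (le_Rintegral (f2 := fun=> 1) _ (integrable_norm i) _ _) _ => //.
- exact: finite_measure_integrable_cst.
- by move=> w _; exact: state_le1.
- by rewrite Rintegral_cst// mul1r [X in fine X]probability_setT.
Qed.

Lemma measurable_mean_state :
  measurable_mx (time_itv T `*` I) (fun p : R * R => mean_state p.1 p.2).
Proof. exact: (sol_mean_measurable S). Qed.

Lemma measurable_mean_section s : 0 <= s <= T -> measurable_mx I (mean_state s).
Proof.
move=> sT; apply/measurable_mxP => c.
have mm := (measurable_mxP _ _).1 measurable_mean_state c.
apply: (@measurable_comp _ _ _ _ _ _ (time_itv T `*` I)
  (fun p : R * R => comp c (mean_state p.1 p.2)) _ (fun v => (s, v))) => //.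
- apply: measurableX; [exact: measurable_time_itv|exact: measurable_unit_itv].
- by move=> _ [v Iv <-]; split => //=; exact/time_itvP.
- by apply: measurable_funTS; exact: measurable_fun_pair.
Qed.

Lemma comp_averaged_state u s c :
  comp c (averaged_state u s) = \int[mu]_(v in I) (W u v * comp c (mean_state s v)).
Proof.
by rewrite comp_mxintegral; apply: eq_Rintegral => v _; rewrite compZ.
Qed.

Lemma measurable_averaged_state u : I u ->
  measurable_mx (time_itv T) (averaged_state u).
Proof.
move=> Iu; apply/measurable_mxP => c; under eq_fun do rewrite comp_averaged_state.
have mm := (measurable_mxP _ _).1 measurable_mean_state c.
apply: (@measurable_Rintegral_snd _ _ _ _ R mu (time_itv T) I (measurable_time_itv T)
  (@measurable_unit_itv R) (fun p : R * R => W u p.2 * comp c (mean_state p.1 p.2))).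
apply: measurable_funM => //.
apply: (@measurable_comp _ _ _ _ _ _ I (W u)) => //.
- exact: measurable_unit_itv.
- by move=> _ [[s v] [/= _ Iv] <-].
- exact: graphon_section.
- by apply: measurable_funTS; exact: measurable_snd.
Qed.

Let finI : (mu I < +oo)%E.
Proof. by rewrite unit_itv_measure ltry. Qed.

Let averaged_integrand_le1 u s c v : I u -> 0 <= s <= T -> I v ->
  `|W u v * comp c (mean_state s v)| <= 1.
Proof.
by move=> Iu sT Iv; rewrite normrM mulr_ile1// ?graphon_le1// mean_state_le1.
Qed.

Lemma integrable_averaged u s c : I u -> 0 <= s <= T ->
  mu.-integrable I (EFin \o (fun v => W u v * comp c (mean_state s v))).
Proof.
move=> Iu sT; have mI := @measurable_unit_itv R.
have mm := (measurable_mxP _ _).1 (measurable_mean_section sT) c.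
apply: (@bounded_integrableR _ _ _ _ _ _ 1) => //.
  by apply: measurable_funM => //; exact: graphon_section.
by move=> v Iv; exact: averaged_integrand_le1.
Qed.

Lemma averaged_state_le1 u s c : I u -> 0 <= s <= T ->
  `|comp c (averaged_state u s)| <= 1.
Proof.
move=> Iu sT; rewrite comp_averaged_state; have mI := @measurable_unit_itv R.
have i := integrable_averaged c Iu sT.
apply: le_trans (@le_normr_Rintegral _ _ R mu I _ mI i) _.
have i1 : mu.-integrable I (EFin \o (fun=> 1 : R)).
  by apply: (@bounded_integrableR _ _ _ _ _ _ 1) => // v _; rewrite normr1.
apply: le_trans (@le_Rintegral _ _ R mu I _ (fun=> 1) mI (integrable_norm i) i1
  (fun v Iv => averaged_integrand_le1 c Iu sT Iv)) _.
by rewrite Rintegral_cst// mul1r [X in fine X]unit_itv_measure.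
Qed.

Lemma sqnorm_comp_le1 (X : 'M[R[i]]_d) : (forall c, `|comp c X| <= 1) -> sqnorm X <= N.
Proof.
move=> X1; rewrite -sum1_card natr_sum; apply: ler_sum => c _.
by rewrite -real_normK ?num_real// expr_le1.
Qed.

Local Notation ham u s := (hamiltonian H a W (mean_state s) u).

Lemma ham_averaged u s : I u -> 0 <= s <= T ->
  ham u s = H + mean_field a (averaged_state u s).
Proof.
move=> Iu sT; apply: (@hamiltonianE _ _ _ _ _ _ _ 1).
- exact: graphon_section.
- exact: measurable_mean_section.
- by move=> v Iv; exact: graphon_le1.
- by move=> v c Iv; exact: mean_state_le1.
Qed.

Definition ham_bound (nH nA : R) : R := 2 * nH ^+ 2 + 2 * (N ^+ 2 * nA ^+ 2 * N).

Lemma sqnorm_ham u s : I u -> 0 <= s <= T ->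
  sqnorm (ham u s) <= ham_bound (frobenius H) (pair_operator_norm a).
Proof.
move=> Iu sT; rewrite ham_averaged//; apply: le_trans (sqnormD _ _) _.
rewrite -frobenius_sqr lerD2l ler_wpM2l//.
apply: le_trans (sqnorm_mean_field _ _) _; rewrite ler_wpM2l//.
  by rewrite mulr_ge0 ?sqr_ge0.
by apply: sqnorm_comp_le1 => c; exact: averaged_state_le1.
Qed.

Definition drift_process (u s : R) (w : Omega) : 'M[R[i]]_d :=
  drift L (ham u s) (gamma u s w).

Lemma measurable_ham u : I u -> measurable_mx (time_itv T) (fun s => ham u s).
Proof.
move=> Iu.
have : measurable_mx (time_itv T) (fun s => H + mean_field a (averaged_state u s)).
  apply: measurable_mxD; first exact: measurable_mx_cst.
  by apply: measurable_mean_field; exact: measurable_averaged_state.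
move=> h i j; have [h1 h2] := h i j; split.
  by apply: eq_measurable_fun h1 => s; rewrite inE => /time_itvP sT; rewrite ham_averaged.
by apply: eq_measurable_fun h2 => s; rewrite inE => /time_itvP sT; rewrite ham_averaged.
Qed.

Lemma measurable_drift_process u : I u ->
  measurable_mx (time_itv T `*` [set: Omega]) (fun p : R * Omega => drift_process u p.1 p.2).
Proof.
move=> Iu; apply: measurable_drift; last exact: measurable_state_process.
apply/measurable_mxP => c; have mh := (measurable_mxP _ _).1 (measurable_ham Iu) c.
apply: (@measurable_comp _ _ _ _ _ _ (time_itv T) (fun s => comp c (ham u s))) => //.
- exact: measurable_time_itv.
- by move=> _ [[s w] [/= sT _] <-].
- by apply: measurable_funTS; exact: measurable_fst.
Qed.

(** Boundedness makes the time integral of the drift, in every coordinate and on every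
    path, the integral of an integrable function, hence additive. *)
Lemma drift_process_bounded u : exists M, forall s w c, I u -> 0 <= s <= T ->
  `|comp c (drift_process u s w)| <= M.
Proof.
pose k := ham_bound (frobenius H) (pair_operator_norm a).
exists (1 + drift_lip d (sqnorm L) k * N) => s w c Iu sT.
have bnd : comp c (drift_process u s w) ^+ 2 <= drift_lip d (sqnorm L) k * N.
  apply: le_trans (comp_sqr_le _ _) _.
  have dr := sol_density S w Iu sT.
  have := drift_lipschitz L (ham u s) (ham u s) 0 dr.
  have -> : drift L (ham u s) 0 = 0.
    rewrite /drift /commutator /anticommutator.
    by rewrite !(mulmx0, mul0mx, subr0, addr0, scaler0, oppr0).
  rewrite !subr0 subrr (_ : sqnorm 0 = 0); last first.
    by apply: big1 => c' _; rewrite /comp mxE/= if_same expr0n.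
  rewrite mulr0 add0r; move/le_trans; apply.
  apply: ler_pM; rewrite ?sqnorm_ge0//.
  - by rewrite addr_ge0// ?mulr_ge0// ?sqnorm_ge0// ?sqr_ge0.
  - by rewrite lerD2r ler_wpM2l ?mulr_ge0// sqnorm_ham.
  - exact: sqnorm_density.
have x0 := le_trans (sqr_ge0 _) bnd.
rewrite -ler_sqr ?nnegrE ?normr_ge0//; last exact: addr_ge0.
rewrite real_normK ?num_real//; apply: (le_trans bnd).
move: (_ * N) x0 => x x0; have := sqr_ge0 x; rewrite sqrrD expr1n mul1r; lra.
Qed.

Lemma integrable_drift_process u t w c : I u -> 0 <= t <= T ->
  mu.-integrable (time_itv t) (EFin \o (fun s => comp c (drift_process u s w))).
Proof.
move=> Iu /andP[t0 tT]; have [M dM] := drift_process_bounded u.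
have mt := measurable_time_itv t.
apply: (@bounded_integrableR _ _ _ _ _ _ M) => //.
- exact: time_itv_fin.
- have := (measurable_mxP _ _).1 (measurable_drift_process Iu) c.
  move=> /(measurable_processS tT (X := fun s w => comp c (drift_process u s w))) h.
  exact: (measurable_process_section (X := fun s w => comp c (drift_process u s w)) w h).
move=> s sI; have /andP[s0 st] := (time_itvP _ _).1 sI; apply: dM => //.
by rewrite s0 (le_trans st).
Qed.

(** The matrix equation becomes a finite family of real equations, each with its own
    Ito integral, to which [ito_doob] applies. *)
Lemma solution_comp u : I u -> exists2 Y : R -> Omega -> 'M[R[i]]_d,
  (forall c, is_ito_integral P F (B u) T
     (fun t w => comp c (diffusion eta L (gamma u t w))) (fun t w => comp c (Y t w)))
  & {ae P, forall w, forall t, 0 <= t <= T -> forall c,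
      comp c (gamma u t w) = comp c rho0
        + \int[mu]_(s in time_itv t) comp c (drift_process u s w) + comp c (Y t w)}.
Proof.
move=> Iu; have [Y iY eqY] := sol_equation S Iu; exists Y.
  by case=> [[i j] b]; have [h1 h2] := iY i j; case: b.
apply: filterS eqY => w eqw t tT c.
by rewrite eqw// !compD comp_mxintegral.
Qed.

End one_solution.

(** * Integrals over time and the sample space *)

Section iterated_integrals.
Context (R : realType) dO (Omega : measurableType dO) (P : probability Omega R).
Local Notation mu := (@lebesgue_measure R).
Variable t : R.
Implicit Types f g : R -> Omega -> R.

Definition iterated f : \bar R := (\int[P]_w \int[mu]_(s in time_itv t) (f s w)%:E)%E.

Let mt : measurable (time_itv t : set (measurableTypeR R)) := measurable_time_itv t.

Let inner_ge0 f w : (forall s w, 0 <= f s w) ->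
  (0 <= \int[mu]_(s in time_itv t) (f s w)%:E)%E.
Proof. by move=> f0; apply: integral_ge0 => s _; rewrite lee_fin. Qed.

Lemma measurable_section_EFin f w : measurable_process t f ->
  measurable_fun (time_itv t) (fun s => (f s w)%:E).
Proof. by move=> mf; apply/measurable_EFinP; exact: measurable_process_section. Qed.

Lemma measurable_inner f : measurable_process t f -> (forall s w, 0 <= f s w) ->
  measurable_fun setT (fun w => \int[mu]_(s in time_itv t) (f s w)%:E)%E.
Proof.
move=> mf f0; apply: (@measurable_integral_fst _ _ _ _ R mu (time_itv t) setT mt measurableT
  (fun p : R * Omega => (f p.1 p.2)%:E)).
- by move=> x y _ _; rewrite lee_fin.
- exact/measurable_EFinP.
Qed.

Lemma iteratedD f g : measurable_process t f -> measurable_process t g ->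
  (forall s w, 0 <= f s w) -> (forall s w, 0 <= g s w) ->
  iterated (fun s w => f s w + g s w) = (iterated f + iterated g)%E.
Proof.
move=> mf mg f0 g0; rewrite /iterated -ge0_integralD//; last 4 first.
- by move=> w _; exact: inner_ge0.
- exact: measurable_inner.
- by move=> w _; exact: inner_ge0.
- exact: measurable_inner.
apply: eq_integral => w _; rewrite -(@ge0_integralD _ _ R mu _ mt)//.
- by move=> s _; rewrite lee_fin.
- exact: measurable_section_EFin.
- by move=> s _; rewrite lee_fin.
- exact: measurable_section_EFin.
Qed.

Lemma iteratedZ (k : R) f : 0 <= k -> measurable_process t f ->
  (forall s w, 0 <= f s w) ->
  iterated (fun s w => k * f s w) = (k%:E * iterated f)%E.
Proof.
move=> k0 mf f0; rewrite /iterated -ge0_integralZl//; last 2 first.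
- exact: measurable_inner.
- by move=> w _; exact: inner_ge0.
apply: eq_integral => w _.
rewrite -(@ge0_integralZl _ _ R mu _ mt)//.
- exact: measurable_section_EFin.
- by move=> s _; rewrite lee_fin.
Qed.

Lemma iterated_sum (I : finType) (f : I -> R -> Omega -> R) :
  (forall i, measurable_process t (f i)) -> (forall i s w, 0 <= f i s w) ->
  iterated (fun s w => \sum_i f i s w) = (\sum_i iterated (f i))%E.
Proof.
move=> mf f0; rewrite /iterated -ge0_integral_sum//; last 2 first.
- by move=> i; exact: measurable_inner.
- by move=> i w _; exact: inner_ge0.
apply: eq_integral => w _; rewrite -(@ge0_integral_sum _ _ R mu _ mt)//.
- by apply: eq_integral => s _; rewrite sumEFin.
- by move=> i; exact: measurable_section_EFin.
- by move=> i s _; rewrite lee_fin.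
Qed.

Lemma le_iterated f g : measurable_process t f -> measurable_process t g ->
  (forall s w, 0 <= f s w) -> (forall s w, 0 <= g s w) ->
  (forall s w, 0 <= s <= t -> f s w <= g s w) ->
  (iterated f <= iterated g)%E.
Proof.
move=> mf mg f0 g0 fg; apply: ge0_le_integral => //.
- by move=> w _; exact: inner_ge0.
- exact: measurable_inner.
- exact: measurable_inner.
move=> w _; apply: (@ge0_le_integral _ _ R mu _ mt).
- by move=> s _; rewrite lee_fin.
- exact: measurable_section_EFin.
- exact: measurable_section_EFin.
- by move=> s /time_itvP st; rewrite lee_fin fg.
Qed.

Lemma iterated_swap f : measurable_process t f -> (forall s w, 0 <= f s w) ->
  iterated f = (\int[mu]_(s in time_itv t) \int[P]_w (f s w)%:E)%E.
Proof.
move=> mf f0.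
apply/esym; apply: (@tonelli_on _ _ _ _ R mu P (time_itv t) setT mt measurableT
  (fun p : R * Omega => (f p.1 p.2)%:E)).
- by move=> x y _ _; rewrite lee_fin.
- exact/measurable_EFinP.
Qed.

End iterated_integrals.

(** * Gronwall's inequality with a forcing term *)

Section gronwall_with_forcing.
Context (R : realType) (T : R).
Local Notation mu := (@lebesgue_measure R).
Let mT (t : R) : measurable (time_itv t : set (measurableTypeR R)) := measurable_time_itv t.

Lemma time_integrable (f : R -> R) (M t : R) : measurable_fun (time_itv T) f ->
  (forall s, 0 <= s <= T -> 0 <= f s <= M) -> 0 <= t <= T ->
  mu.-integrable (time_itv t) (EFin \o f).
Proof.
move=> mf fM /andP[t0 tT]; have mt := mT t.
apply: (@bounded_integrableR _ _ _ _ _ _ M) => //.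
- exact: time_itv_fin.
- by apply: (measurable_funS (mT T)) => //; exact: sub_time_itv.
move=> s /time_itvP/andP[s0 st].
have /fM/andP[f0 f1] : 0 <= s <= T by rewrite s0 (le_trans st).
by rewrite ger0_norm.
Qed.

Lemma time_integral_ge0 (f : R -> R) (t : R) : (forall s, 0 <= s <= t -> 0 <= f s) ->
  0 <= \int[mu]_(s in time_itv t) f s.
Proof. by move=> f0; apply: Rintegral_ge0 => s /time_itvP; exact: f0. Qed.

Lemma time_integral_mono (f : R -> R) (M s t : R) : measurable_fun (time_itv T) f ->
  (forall s, 0 <= s <= T -> 0 <= f s <= M) -> 0 <= s -> s <= t -> t <= T ->
  \int[mu]_(r in time_itv s) f r <= \int[mu]_(r in time_itv t) f r.
Proof.
move=> mf fM s0 st tT.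
have sT : 0 <= s <= T by rewrite s0 (le_trans st).
have tT' : 0 <= t <= T by rewrite tT (le_trans s0).
rewrite -lee_fin -(@integral_EFin _ _ R mu _ (mT s) _ (time_integrable mf fM sT)).
rewrite -(@integral_EFin _ _ R mu _ (mT t) _ (time_integrable mf fM tT')).
apply: (@ge0_subset_integral _ _ R mu _ _ (mT s) (mT t)).
- apply/measurable_EFinP; apply: (measurable_funS (mT T)) => //; exact: sub_time_itv.
- move=> r /time_itvP/andP[r0 rt]; rewrite lee_fin.
  by have /andP[] : 0 <= f r <= M by apply: fM; rewrite r0 (le_trans rt).
- exact: sub_time_itv.
Qed.

Lemma le_time_integral_cst (f : R -> R) (M c t : R) : measurable_fun (time_itv T) f ->
  (forall s, 0 <= s <= T -> 0 <= f s <= M) -> 0 <= t <= T ->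
  (forall s, 0 <= s <= t -> f s <= c) -> 0 <= c ->
  \int[mu]_(s in time_itv t) f s <= T * c.
Proof.
move=> mf fM tT fc c0; have /andP[t0 tleT] := tT; have mt := mT t.
have i := time_integrable mf fM tT.
have ic : mu.-integrable (time_itv t) (EFin \o (fun=> c : R)).
  apply: (@bounded_integrableR _ _ _ _ _ _ `|c|) => //; exact: time_itv_fin.
have h := @le_Rintegral _ _ R mu _ _ (fun=> c) mt i ic
  (fun s ts => fc s ((time_itvP _ _).1 ts)).
apply: (le_trans h); rewrite Rintegral_cst//.
have -> : fine (mu (time_itv t)) = t by rewrite time_itv_measure.
by rewrite mulrC ler_wpM2r.
Qed.

Variables (k M M' : R) (g f : R -> R).
Hypotheses (k0 : 0 < k) (T0 : 0 < T).
Hypotheses (mg : measurable_fun (time_itv T) g) (mf : measurable_fun (time_itv T) f).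
Hypothesis gM : forall s, 0 <= s <= T -> 0 <= g s <= M.
Hypothesis fM : forall s, 0 <= s <= T -> 0 <= f s <= M'.
Hypothesis gle : forall t, 0 <= t <= T ->
  ((g t)%:E <= k%:E * \int[mu]_(s in time_itv t) (g s + f s)%:E)%E.

Let gfE t : 0 <= t <= T -> (\int[mu]_(s in time_itv t) (g s + f s)%:E =
  (\int[mu]_(s in time_itv t) g s + \int[mu]_(s in time_itv t) f s)%:E)%E.
Proof.
move=> tT; have ig := time_integrable mg gM tT; have i_f := time_integrable mf fM tT.
rewrite -(@RintegralD _ _ R mu _ _ _ (mT t) ig i_f).
exact: (@integral_EFin _ _ R mu _ (mT t) _ (@integrableDR _ _ R mu _ (mT t) _ _ ig i_f)).
Qed.

(** On [0, t] the integral of the forcing up to [t] serves as the constant of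
    [gronwall]. *)
Lemma gronwall_forcing t : 0 <= t <= T ->
  g t <= 2 * k * expR (2 * k * T) * \int[mu]_(s in time_itv t) f s.
Proof.
move=> tT; have /andP[t0 tleT] := tT.
have F0 : 0 <= \int[mu]_(s in time_itv t) f s.
  apply: time_integral_ge0 => s /andP[s0 st].
  by have /fM/andP[] : 0 <= s <= T by rewrite s0 (le_trans st).
have h : g t <= 2 * (k * \int[mu]_(s in time_itv t) f s) * expR (2 * k * t).
  apply: (@gronwall _ k t (k * \int[mu]_(s in time_itv t) f s) M g) => //.
  - by rewrite mulr_ge0// ltW.
  - by apply: (measurable_funS (mT T)) => //; exact: sub_time_itv.
  - by move=> s /andP[s0 st]; apply: gM; rewrite s0 (le_trans st).
  - move=> s /andP[s0 st].
    have sT : 0 <= s <= T by rewrite s0 (le_trans st).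
    apply: le_trans (gle sT) _; rewrite gfE// -/(time_itv s).
    rewrite (@integral_EFin _ _ R mu _ (mT s) _ (time_integrable mg gM sT)).
    rewrite -!EFinM -EFinD lee_fin mulrDr addrC lerD2r ler_wpM2l ?(ltW k0)//.
    exact: (time_integral_mono mf fM).
  - by rewrite t0 lexx.
apply: (le_trans h).
have e : expR (2 * k * t) <= expR (2 * k * T).
  by rewrite ler_expR ler_wpM2l ?mulr_ge0 ?(ltW k0).
move: (expR _) (expR _) (\int[mu]_(s in _) _) e F0 => x y F xy F0.
have -> : 2 * (k * F) * y = 2 * k * F * y by ring.
have -> : 2 * k * x * F = 2 * k * F * x by ring.
by rewrite ler_wpM2l// !mulr_ge0// ltW.
Qed.

Lemma gronwall_forcing_integral :
  (k%:E * \int[mu]_(s in time_itv T) (g s + f s)%:E <=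
   (k * (T * (2 * k * expR (2 * k * T)) + 1) * \int[mu]_(s in time_itv T) f s)%:E)%E.
Proof.
have TT : 0 <= T <= T by rewrite lexx ltW.
rewrite gfE// -EFinM lee_fin -mulrA ler_wpM2l ?(ltW k0)// mulrDl mul1r lerD2r.
set F := \int[mu]_(s in time_itv T) f s.
have F0 : 0 <= F.
  by apply: time_integral_ge0 => s sT; have /andP[] := fM sT.
have K0 : 0 <= 2 * k * expR (2 * k * T) by rewrite !mulr_ge0 ?expR_ge0 ?(ltW k0).
rewrite -mulrA; apply: (le_time_integral_cst mg gM TT); last by rewrite mulr_ge0.
move=> s sT; apply: le_trans (gronwall_forcing sT) _; rewrite ler_wpM2l//.
by have /andP[s0 sleT] := sT; exact: (time_integral_mono mf fM).
Qed.

End gronwall_with_forcing.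

(** * Comparison of two solutions *)

Section two_solutions.
Context (R : realType) (d : nat) dO (Omega : measurableType dO).
Variables (P : probability Omega R) (F : R -> set (set Omega)).
Variables (B : R -> R -> Omega -> R) (T eta : R) (H L : 'M[R[i]]_d).
Variables (a : pair_kernel R d) (rho0 : 'M[R[i]]_d) (W1 W2 : R -> R -> R).
Variables gamma1 gamma2 : R -> R -> Omega -> 'M[R[i]]_d.
Hypothesis T0 : 0 < T.
Hypothesis eta01 : 0 < eta <= 1.
Hypothesis FP : filtration_usual P F.
Hypothesis BP : forall u, unit_itv R u -> brownian_motion P F (B u).
Hypotheses (gW1 : graphon W1) (gW2 : graphon W2).
Hypothesis S1 : is_solution P F B T eta H L a rho0 W1 gamma1.
Hypothesis S2 : is_solution P F B T eta H L a rho0 W2 gamma2.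

Local Notation mu := (@lebesgue_measure R).
Local Notation I := (unit_itv R).
Local Notation N := (#|coord d|%:R : R).
Local Notation q := (normal_moment2 R).
Local Notation mean1 := (mean_state P gamma1).
Local Notation mean2 := (mean_state P gamma2).
Local Notation ham1 u s := (hamiltonian H a W1 (mean1 s) u).
Local Notation ham2 u s := (hamiltonian H a W2 (mean2 s) u).
Local Notation nA := (pair_operator_norm a).

Let mI : measurable (I : set (measurableTypeR R)) := @measurable_unit_itv R.
Let mT (t : R) : measurable (time_itv t : set (measurableTypeR R)) := measurable_time_itv t.

Let finI : (mu I < +oo)%E.
Proof. by rewrite unit_itv_measure ltry. Qed.

Definition delta (u s : R) (w : Omega) : 'M[R[i]]_d := gamma1 u s w - gamma2 u s w.

Definition gap (u s : R) : R := \int[P]_w sqnorm (delta u s w).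

Definition graphon_gap (c : coord d) (u s : R) : R :=
  \int[mu]_(v in I) ((W1 u v - W2 u v) * comp c (mean1 s v)).

Definition mean_gap (s : R) : R := \int[mu]_(v in I) sqnorm (mean1 s v - mean2 s v).

Definition forcing (u s : R) : R := \sum_c graphon_gap c u s ^+ 2 + mean_gap s.

Lemma graphonB_le1 u v : I u -> I v -> `|W1 u v - W2 u v| <= 1.
Proof.
move=> Iu Iv; have [_ _ /(_ u v Iu Iv)/andP[a0 a1]] := gW1.
have [_ _ /(_ u v Iu Iv)/andP[b0 b1]] := gW2.
by rewrite ler_norml; apply/andP; split; lra.
Qed.

Lemma measurable_graphonB :
  measurable_fun (I `*` I) (fun p : R * R => W1 p.1 p.2 - W2 p.1 p.2).
Proof. by have [m1 _ _] := gW1; have [m2 _ _] := gW2; exact: measurable_funB. Qed.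

Lemma sqnorm_mean_gap_le s v : I v -> 0 <= s <= T ->
  sqnorm (mean1 s v - mean2 s v) <= 4 * N.
Proof.
move=> Iv sT; have h1 : sqnorm (mean1 s v) <= N.
  by apply: sqnorm_comp_le1 => c; exact: (mean_state_le1 FP S1).
have h2 : sqnorm (mean2 s v) <= N.
  by apply: sqnorm_comp_le1 => c; exact: (mean_state_le1 FP S2).
by have := sqnormB (mean1 s v) (mean2 s v); lra.
Qed.

Lemma sqnorm_delta_le u s w : I u -> 0 <= s <= T -> sqnorm (delta u s w) <= 4 * N.
Proof.
move=> Iu sT; have h1 := sqnorm_density (sol_density S1 w Iu sT).
have h2 := sqnorm_density (sol_density S2 w Iu sT).
by have := sqnormB (gamma1 u s w) (gamma2 u s w); rewrite /delta; lra.
Qed.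

Lemma measurable_delta u : I u ->
  measurable_mx (time_itv T `*` [set: Omega]) (fun p : R * Omega => delta u p.1 p.2).
Proof.
move=> Iu; apply: measurable_mxB.
  exact: (measurable_state_process T0 FP S1).
exact: (measurable_state_process T0 FP S2).
Qed.

Lemma measurable_mean_gap_joint :
  measurable_fun (time_itv T `*` I) (fun p : R * R => sqnorm (mean1 p.1 p.2 - mean2 p.1 p.2)).
Proof.
apply: measurable_sqnorm; apply: measurable_mxB.
  exact: (measurable_mean_state S1).
exact: (measurable_mean_state S2).
Qed.

Lemma measurable_mean_gap : measurable_fun (time_itv T) mean_gap.
Proof.
exact: (@measurable_Rintegral_snd _ _ _ _ R mu (time_itv T) I (mT T) mI _
  measurable_mean_gap_joint).
Qed.

Lemma measurable_mean_diff s : 0 <= s <= T ->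
  measurable_mx I (fun v => mean1 s v - mean2 s v).
Proof.
by move=> sT; apply: measurable_mxB; [exact: (measurable_mean_section S1)|
  exact: (measurable_mean_section S2)].
Qed.

Lemma integrable_mean_gap s : 0 <= s <= T ->
  mu.-integrable I (EFin \o (fun v => sqnorm (mean1 s v - mean2 s v))).
Proof.
move=> sT; apply: (@bounded_integrableR _ _ _ _ _ _ (4 * N)) => //.
  exact: (measurable_sqnorm (measurable_mean_diff sT)).
by move=> v Iv; rewrite ger0_norm ?sqnorm_ge0// sqnorm_mean_gap_le.
Qed.

Lemma mean_gap_ge0 s : 0 <= mean_gap s.
Proof. by apply: Rintegral_ge0 => v _; exact: sqnorm_ge0. Qed.

Lemma mean_gap_le s : 0 <= s <= T -> mean_gap s <= 4 * N.
Proof.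
move=> sT.
have i1 : mu.-integrable I (EFin \o (fun=> 4 * N : R)).
  by apply: (@bounded_integrableR _ _ _ _ _ _ `|4 * N|).
have := @le_Rintegral _ _ R mu I _ (fun=> 4 * N) mI (integrable_mean_gap sT) i1
  (fun v Iv => sqnorm_mean_gap_le Iv sT).
by rewrite Rintegral_cst// [X in fine X]unit_itv_measure mulr1.
Qed.

Lemma measurable_graphon_gap c :
  measurable_fun (I `*` time_itv T) (fun p : R * R => graphon_gap c p.1 p.2).
Proof.
pose f (p : R * R * R) := (W1 p.1.1 p.2 - W2 p.1.1 p.2) * comp c (mean1 p.1.2 p.2).
have mIT := measurableX mI (mT T).
apply: (@measurable_Rintegral_snd _ _ _ _ R mu (I `*` time_itv T) I mIT mI f).
apply: measurable_funM.
  apply: (@measurable_comp _ _ _ _ _ _ (I `*` I)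
    (fun p : R * R => W1 p.1 p.2 - W2 p.1 p.2) _ (fun p : R * R * R => (p.1.1, p.2))) => //.
  - exact: (measurableX mI mI).
  - by move=> _ [[[u s] v] [/= [Iu sT] Iv] <-].
  - exact: measurable_graphonB.
  - apply: measurable_funTS; apply: measurable_fun_pair; last exact: measurable_snd.
    by apply: measurableT_comp; [exact: measurable_fst|exact: measurable_fst].
apply: (@measurable_comp _ _ _ _ _ _ (time_itv T `*` I)
    (fun p : R * R => comp c (mean1 p.1 p.2)) _ (fun p : R * R * R => (p.1.2, p.2))) => //.
- exact: (measurableX (mT T) mI).
- by move=> _ [[[u s] v] [/= [Iu sT] Iv] <-].
- exact: ((measurable_mxP _ _).1 (measurable_mean_state S1)).
- apply: measurable_funTS; apply: measurable_fun_pair; last exact: measurable_snd.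
  by apply: measurableT_comp; [exact: measurable_snd|exact: measurable_fst].
Qed.

Let graphon_gap_integrand_le1 c u s v : I u -> 0 <= s <= T -> I v ->
  `|(W1 u v - W2 u v) * comp c (mean1 s v)| <= 1.
Proof.
move=> Iu sT Iv; rewrite normrM mulr_ile1// ?graphonB_le1//.
exact: (mean_state_le1 FP S1).
Qed.

Let integrable_graphon_gap c u s : I u -> 0 <= s <= T ->
  mu.-integrable I (EFin \o (fun v => (W1 u v - W2 u v) * comp c (mean1 s v))).
Proof.
move=> Iu sT; apply: (@bounded_integrableR _ _ _ _ _ _ 1) => //.
  have m1 := graphon_section gW1 Iu; have m2 := graphon_section gW2 Iu.
  have mm := (measurable_mxP _ _).1 (measurable_mean_section S1 sT) c.
  exact: (measurable_funM (measurable_funB m1 m2) mm).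
by move=> v; exact: graphon_gap_integrand_le1.
Qed.

Lemma graphon_gap_le1 c u s : I u -> 0 <= s <= T -> `|graphon_gap c u s| <= 1.
Proof.
move=> Iu sT; have i := integrable_graphon_gap c Iu sT.
apply: le_trans (@le_normr_Rintegral _ _ R mu I _ mI i) _.
have i1 : mu.-integrable I (EFin \o (fun=> 1 : R)).
  by apply: (@bounded_integrableR _ _ _ _ _ _ 1) => // v _; rewrite normr1.
apply: le_trans (@le_Rintegral _ _ R mu I _ (fun=> 1) mI (integrable_norm i) i1
  (fun v Iv => graphon_gap_integrand_le1 c Iu sT Iv)) _.
by rewrite Rintegral_cst// mul1r [X in fine X]unit_itv_measure.
Qed.

Lemma forcing_ge0 u s : 0 <= forcing u s.
Proof. by rewrite addr_ge0 ?mean_gap_ge0// sumr_ge0// => c _; exact: sqr_ge0. Qed.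

Lemma forcing_le u s : I u -> 0 <= s <= T -> forcing u s <= 5 * N.
Proof.
move=> Iu sT; have h1 := mean_gap_le sT.
suff : \sum_c graphon_gap c u s ^+ 2 <= N by rewrite /forcing; lra.
rewrite -sum1_card natr_sum; apply: ler_sum => c _.
by rewrite -real_normK ?num_real// expr_le1// graphon_gap_le1.
Qed.

Lemma measurable_forcing :
  measurable_fun (I `*` time_itv T) (fun p : R * R => forcing p.1 p.2).
Proof.
apply: measurable_funD.
  by apply: measurable_sum => c; apply: measurable_funX; exact: measurable_graphon_gap.
apply: (@measurable_comp _ _ _ _ _ _ (time_itv T) mean_gap) => //.
- exact: mT.
- by move=> _ [[u s] [/= _ sT] <-].
- exact: measurable_mean_gap.
- by apply: measurable_funTS; exact: measurable_snd.
Qed.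

Lemma measurable_forcing_section u : I u -> measurable_fun (time_itv T) (forcing u).
Proof.
move=> Iu; apply: (@measurable_comp _ _ _ _ _ _ (I `*` time_itv T)
  (fun p : R * R => forcing p.1 p.2) _ (fun s => (u, s))) => //.
- exact: (measurableX mI (mT T)).
- by move=> _ [s sT <-].
- exact: measurable_forcing.
- by apply: measurable_funTS; exact: measurable_fun_pair.
Qed.

(** The difference of the two averaged states splits into the effect of the
    graphons and the effect of the means. *)
Lemma averaged_gap u s : I u -> 0 <= s <= T ->
  sqnorm (averaged_state P W1 gamma1 u s - averaged_state P W2 gamma2 u s)
    <= 2 * forcing u s.
Proof.
move=> Iu sT.
pose psi c := \int[mu]_(v in I) (W2 u v * comp c (mean1 s v - mean2 s v)).
have md c := (measurable_mxP _ _).1 (measurable_mean_diff sT) c.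
have mW2 := graphon_section gW2 Iu.
have W2le v : I v -> `|W2 u v| <= 1 by exact: (graphon_le1 gW2).
have d_le v c : I v -> comp c (mean1 s v - mean2 s v) ^+ 2 <= 4 * N.
  by move=> Iv; apply: le_trans (comp_sqr_le _ _) _; exact: sqnorm_mean_gap_le.
have dle v c : I v -> `|comp c (mean1 s v - mean2 s v)| <= 2.
  move=> Iv; rewrite compB; apply: le_trans (ler_normB _ _) _.
  have := mean_state_le1 FP S1 c Iv sT; have := mean_state_le1 FP S2 c Iv sT; lra.
have ipsi c : mu.-integrable I (EFin \o (fun v => W2 u v * comp c (mean1 s v - mean2 s v))).
  apply: (@bounded_integrableR _ _ _ _ _ _ 2) => //.
    exact: (measurable_funM mW2 (md c)).
  by move=> v Iv; rewrite normrM -[leRHS]mul1r ler_pM// ?W2le ?dle.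
have id2 c : mu.-integrable I (EFin \o (fun v => comp c (mean1 s v - mean2 s v) ^+ 2)).
  apply: (@bounded_integrableR _ _ _ _ _ _ (4 * N)) => //.
    exact: (measurable_funX 2 (md c)).
  by move=> v Iv; rewrite ger0_norm ?sqr_ge0// d_le.
have Wd2 v c : I v -> (W2 u v * comp c (mean1 s v - mean2 s v)) ^+ 2 <=
    comp c (mean1 s v - mean2 s v) ^+ 2.
  move=> Iv; rewrite exprMn ler_piMl ?sqr_ge0//.
  by rewrite -real_normK ?num_real// expr_le1// W2le.
have ipsi2 c : mu.-integrable I
    (EFin \o (fun v => (W2 u v * comp c (mean1 s v - mean2 s v)) ^+ 2)).
  apply: (@bounded_integrableR _ _ _ _ _ _ (4 * N)) => //.
    exact: (measurable_funX 2 (measurable_funM mW2 (md c))).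
  by move=> v Iv; rewrite ger0_norm ?sqr_ge0//; apply: le_trans (Wd2 v c Iv) (d_le v c Iv).
have psi2 c : psi c ^+ 2 <= \int[mu]_(v in I) comp c (mean1 s v - mean2 s v) ^+ 2.
  have mu1 : (mu I <= 1%:E)%E by rewrite unit_itv_measure.
  apply: le_trans (@sqr_Rintegral_le _ _ R mu I mI 1 _ ltr01 mu1 (ipsi c) (ipsi2 c)) _.
  rewrite mul1r; apply: (@le_Rintegral _ _ R mu I) => // v Iv; exact: Wd2.
have split c : comp c (averaged_state P W1 gamma1 u s - averaged_state P W2 gamma2 u s) =
    graphon_gap c u s + psi c.
  have e1 := comp_averaged_state P W1 gamma1 u s c.
  have e2 := comp_averaged_state P W2 gamma2 u s c.
  have e3 := @RintegralB _ _ R mu I _ _ mI (integrable_averaged FP gW1 S1 c Iu sT)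
    (integrable_averaged FP gW2 S2 c Iu sT).
  have e4 : \int[mu]_(v in I) ((W1 u v - W2 u v) * comp c (mean1 s v) +
      W2 u v * comp c (mean1 s v - mean2 s v)) = graphon_gap c u s + psi c.
    exact: (@RintegralD _ _ R mu I _ _ mI (integrable_graphon_gap c Iu sT) (ipsi c)).
  apply: (etrans (compB c _ _)); apply: (etrans (congr2 (fun x y : R => x - y) e1 e2)).
  apply: (etrans (esym e3)); rewrite -e4.
  by apply: eq_Rintegral => v _; rewrite (compB c (mean1 s v)); ring.
have mgE : mean_gap s = \sum_c \int[mu]_(v in I) comp c (mean1 s v - mean2 s v) ^+ 2.
  by rewrite /mean_gap -(@Rintegral_sum _ _ R mu I mI _ _ _ id2).
rewrite {1}/sqnorm /forcing mgE -big_split/= mulr_sumr; apply: ler_sum => c _.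
rewrite split; have := psi2 c.
move: (graphon_gap c u s) (psi c) (\int[mu]_(v in I) _) => x y z yz.
by have := sqr_ge0 (x - y); rewrite sqrrB sqrrD; lra.
Qed.

(** * The maximal inequality for the distance of two solutions *)

Lemma ham_gap u s : I u -> 0 <= s <= T ->
  sqnorm (ham1 u s - ham2 u s) <= 2 * N ^+ 2 * nA ^+ 2 * forcing u s.
Proof.
move=> Iu sT.
have e1 := ham_averaged FP gW1 S1 Iu sT; have e2 := ham_averaged FP gW2 S2 Iu sT.
have e : ham1 u s - ham2 u s = mean_field a (averaged_state P W1 gamma1 u s
    - averaged_state P W2 gamma2 u s).
  apply: (etrans (congr2 (fun X Y : 'M[R[i]]_d => X - Y) e1 e2)).
  by rewrite mean_fieldB opprD addrACA subrr add0r.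
move: (ham1 u s - ham2 u s) e => Z ->.
apply: le_trans (sqnorm_mean_field _ _) _.
have h := averaged_gap Iu sT.
have x0 : 0 <= N ^+ 2 * nA ^+ 2 by rewrite mulr_ge0 ?sqr_ge0.
apply: (le_trans (ler_wpM2l x0 h)).
by rewrite mulrCA !mulrA.
Qed.

Definition drift_gap (u s : R) (w : Omega) : 'M[R[i]]_d :=
  drift_process P H L a W1 gamma1 u s w - drift_process P H L a W2 gamma2 u s w.

Definition diffusion_gap (u s : R) (w : Omega) : 'M[R[i]]_d :=
  diffusion eta L (gamma1 u s w) - diffusion eta L (gamma2 u s w).

(** The factor [2 * T'] comes from the Cauchy-Schwarz inequality in time for the drift,
    and 144 = 2 * 72 from [ito_doob]; the summand 1 makes the rate positive. *)
Definition gap_rate (T' nH nA' nL : R) : R :=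
  2 * T' * (16 * d%:R * N * (2 * N ^+ 2 * nA' ^+ 2)
            + drift_lip d (nL ^+ 2) (ham_bound d nH nA'))
  + 144 * q * diffusion_lip d (nL ^+ 2) + 1.

Local Notation k := (gap_rate T (frobenius H) nA (frobenius L)).

(** Path by path, both differences of coefficients are controlled by the quantities
    whose expectations are [gap] and [forcing]. *)
Lemma gap_rate_bound u s w : I u -> 0 <= s <= T ->
  2 * T * sqnorm (drift_gap u s w) + 144 * q * sqnorm (diffusion_gap u s w)
    <= k * (sqnorm (delta u s w) + forcing u s).
Proof.
move=> Iu sT.
have d1 := sol_density S1 w Iu sT; have d2 := sol_density S2 w Iu sT.
have eta1 : 0 <= eta <= 1 by have /andP[/ltW -> ->] := eta01.
have hS := diffusion_lipschitz L eta1 d1 d2.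
have hD := drift_lipschitz L (ham1 u s) (ham2 u s) (gamma2 u s w) d1.
rewrite -/(delta u s w) in hS hD.
have hg := ham_gap Iu sT.
have hb := sqnorm_ham FP gW2 S2 Iu sT.
rewrite -(frobenius_sqr L) in hS hD.
have f0 := forcing_ge0 u s.
have x0 := sqnorm_ge0 (delta u s w).
have q0 := normal_moment2_ge0 R.
have N0 : 0 <= N by [].
have d0 : 0 <= d%:R :> R by [].
have l0 : 0 <= frobenius L ^+ 2 by exact: sqr_ge0.
set hbd := ham_bound d (frobenius H) nA in hb.
have hbd0 : 0 <= hbd by apply: le_trans hb; exact: sqnorm_ge0.
pose ld := drift_lip d (frobenius L ^+ 2) hbd.
pose ls := diffusion_lip d (frobenius L ^+ 2).
have ld0 : 0 <= ld by exact: drift_lip_ge0.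
have ls0 : 0 <= ls by exact: diffusion_lip_ge0.
pose c1 := 16 * d%:R * N * (2 * N ^+ 2 * nA ^+ 2).
have c10 : 0 <= c1 by rewrite /c1; nonneg.
have e1 : sqnorm (drift_gap u s w) <= (c1 + ld) * (sqnorm (delta u s w) + forcing u s).
  apply: le_trans hD _.
  apply: (@le_trans _ _ (c1 * forcing u s + ld * sqnorm (delta u s w))).
    apply: lerD.
      rewrite /c1 -[leRHS]mulrA ler_wpM2l ?mulr_ge0//.
    rewrite ler_wpM2r// /ld /drift_lip lerD2r ler_wpM2l ?mulr_ge0//.
  move: c1 ld (sqnorm _) (forcing u s) c10 ld0 x0 f0 => c1' ld' x y c10 ld0 x0 f0.
  have := mulr_ge0 c10 x0; have := mulr_ge0 ld0 f0; lra.
have e2 : sqnorm (diffusion_gap u s w) <= ls * (sqnorm (delta u s w) + forcing u s).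
  by apply: le_trans hS _; rewrite ler_wpM2l// lerDl.
have y0 : 0 <= sqnorm (delta u s w) + forcing u s by exact: addr_ge0.
have kE : k = 2 * T * (c1 + ld) + 144 * q * ls + 1 by [].
have h1 := ler_wpM2l (mulr_ge0 (ler0n R 2) (ltW T0)) e1.
have h2 := ler_wpM2l (mulr_ge0 (ler0n R 144) q0) e2.
apply: (le_trans (lerD h1 h2)); rewrite kE.
move: (c1 + ld) (ls) (sqnorm (delta u s w) + _) y0 => x1 x2 y y0.
have -> : (2 * T * x1 + 144 * q * x2 + 1) * y = 2 * T * (x1 * y) + 144 * q * (x2 * y) + y.
  by ring.
by rewrite lerDl.
Qed.

Lemma gap_rate_gt0 : 0 < k.
Proof.
have q0 := normal_moment2_ge0 R; have T0' := ltW T0.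
have h : 0 <= ham_bound d (frobenius H) nA by rewrite /ham_bound; nonneg.
have h1 := drift_lip_ge0 d (frobenius L ^+ 2) h.
have h2 := diffusion_lip_ge0 d (sqr_ge0 (frobenius L)).
rewrite /gap_rate; move: (drift_lip _ _ _) (diffusion_lip _ _) h1 h2 => x y x0 y0.
by rewrite ltr_wpDl//; nonneg.
Qed.

Lemma measurable_drift_gap u : I u ->
  measurable_mx (time_itv T `*` [set: Omega]) (fun p : R * Omega => drift_gap u p.1 p.2).
Proof.
move=> Iu; apply: measurable_mxB.
  exact: (measurable_drift_process T0 FP gW1 S1).
exact: (measurable_drift_process T0 FP gW2 S2).
Qed.

Lemma comp_drift_gap u s w c : comp c (drift_gap u s w) =
  comp c (drift_process P H L a W1 gamma1 u s w)
  - comp c (drift_process P H L a W2 gamma2 u s w).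
Proof. exact: (compB c). Qed.

Let bounded_drift_gap u : exists M : R, forall s w c, I u -> 0 <= s <= T ->
  `|comp c (drift_gap u s w)| <= M.
Proof.
have [M1 h1] := drift_process_bounded FP gW1 S1 u.
have [M2 h2] := drift_process_bounded FP gW2 S2 u.
exists (M1 + M2) => s w c Iu sT; rewrite comp_drift_gap.
by apply: (le_trans (ler_normB _ _)); exact: (lerD (h1 s w c Iu sT) (h2 s w c Iu sT)).
Qed.

Let drift_gap_section u t w c : I u -> 0 <= t <= T ->
  measurable_fun (time_itv t) (fun s => comp c (drift_gap u s w)).
Proof.
move=> Iu /andP[t0 tT].
have := (measurable_mxP _ _).1 (measurable_drift_gap Iu) c.
move=> /(measurable_processS tT (X := fun s w => comp c (drift_gap u s w))) h.
exact: (measurable_process_section (X := fun s w => comp c (drift_gap u s w)) w h).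
Qed.

Let integrable_drift_gap u t w c : I u -> 0 <= t <= T ->
  mu.-integrable (time_itv t) (EFin \o (fun s => comp c (drift_gap u s w))).
Proof.
move=> Iu tT; have mt := mT t; have [M dM] := bounded_drift_gap u; have /andP[t0 tleT] := tT.
apply: (@bounded_integrableR _ _ _ _ _ _ M) => //.
- exact: time_itv_fin.
- exact: drift_gap_section.
move=> s sI; have /andP[s0 st] := (time_itvP _ _).1 sI; apply: dM => //.
by rewrite s0 (le_trans st).
Qed.

Let integrable_drift_gap_sqr u t w c : I u -> 0 <= t <= T ->
  mu.-integrable (time_itv t) (EFin \o (fun s => comp c (drift_gap u s w) ^+ 2)).
Proof.
move=> Iu tT; have mt := mT t; have [M dM] := bounded_drift_gap u; have /andP[t0 tleT] := tT.
apply: (@bounded_integrableR _ _ _ _ _ _ (M ^+ 2)) => //.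
- exact: time_itv_fin.
- exact: (measurable_funX 2 (drift_gap_section w c Iu tT)).
move=> s sI; have /andP[s0 st] := (time_itvP _ _).1 sI.
have sT : 0 <= s <= T by rewrite s0 (le_trans st).
have h := dM s w c Iu sT.
by rewrite normrX ler_pXn2r ?nnegrE// (le_trans _ h).
Qed.

Lemma sqr_integral_drift_gap u t w c : I u -> 0 <= t <= T ->
  (\int[mu]_(s in time_itv t) comp c (drift_gap u s w)) ^+ 2
   <= T * \int[mu]_(s in time_itv t) comp c (drift_gap u s w) ^+ 2.
Proof.
move=> Iu tT; have /andP[t0 tleT] := tT.
have mt : (mu (time_itv t) <= T%:E)%E by rewrite time_itv_measure// lee_fin.
exact: (@sqr_Rintegral_le _ _ R mu _ (mT t) T _ T0 mt (integrable_drift_gap w c Iu tT)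
  (integrable_drift_gap_sqr w c Iu tT)).
Qed.

(** The matrices [y1] and [y2] stand for the values of the two stochastic integrals.
    The Cauchy-Schwarz inequality in time bounds the drift part by an integral up to
    [tau], uniformly in [t]. *)
Lemma delta_sqnorm_le u t tau w (y1 y2 : 'M[R[i]]_d) :
  I u -> 0 <= t <= tau -> tau <= T ->
  (forall c, comp c (gamma1 u t w) = comp c rho0 +
     \int[mu]_(s in time_itv t) comp c (drift_process P H L a W1 gamma1 u s w) + comp c y1) ->
  (forall c, comp c (gamma2 u t w) = comp c rho0 +
     \int[mu]_(s in time_itv t) comp c (drift_process P H L a W2 gamma2 u s w) + comp c y2) ->
  ((sqnorm (delta u t w))%:E <=
    \int[mu]_(s in time_itv tau) (2 * T * sqnorm (drift_gap u s w))%:E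
    + (\sum_c 2 * (comp c y1 - comp c y2) ^+ 2)%:E)%E.
Proof.
move=> Iu /andP[t0 ttau] tauT h1 h2.
have tT : 0 <= t <= T by rewrite t0 (le_trans ttau).
have tauT' : 0 <= tau <= T by rewrite tauT (le_trans t0).
have aux (c0 x x' y y' D : R) : D = x - x' -> c0 + x + y - (c0 + x' + y') = D + (y - y').
  by move=> ->; ring.
have bnd : sqnorm (delta u t w) <=
    2 * T * \int[mu]_(s in time_itv t) sqnorm (drift_gap u s w)
    + \sum_c 2 * (comp c y1 - comp c y2) ^+ 2.
  rewrite (_ : \int[mu]_(s in _) _ =
      \sum_c \int[mu]_(s in time_itv t) comp c (drift_gap u s w) ^+ 2); last first.
    exact: (@Rintegral_sum _ _ R mu _ (mT t) _ _ _
      (fun c => integrable_drift_gap_sqr w c Iu tT)).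
  rewrite mulr_sumr -big_split/=; apply: ler_sum => c _.
  have e : comp c (delta u t w) =
      \int[mu]_(s in time_itv t) comp c (drift_gap u s w) + (comp c y1 - comp c y2).
    have e3 := @RintegralB _ _ R mu _ _ _ (mT t)
      (integrable_drift_process T0 FP gW1 S1 w c Iu tT)
      (integrable_drift_process T0 FP gW2 S2 w c Iu tT).
    have e4 : \int[mu]_(s in time_itv t) comp c (drift_gap u s w) =
        \int[mu]_(s in time_itv t) comp c (drift_process P H L a W1 gamma1 u s w)
        - \int[mu]_(s in time_itv t) comp c (drift_process P H L a W2 gamma2 u s w).
      by rewrite -e3; apply: eq_Rintegral => s _; rewrite comp_drift_gap.
    apply: (etrans (compB c _ _)); apply: (etrans (congr2 (fun x y : R => x - y) (h1 c) (h2 c))).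
    exact: (aux _ _ _ _ _ _ e4).
  rewrite e; have := sqr_integral_drift_gap w c Iu tT.
  move: (\int[mu]_(s in _) _) (\int[mu]_(s in _) _) (comp c y1 - comp c y2) => y x z xy.
  have xz := sqr_ge0 (x - z); rewrite sqrrB in xz; rewrite sqrrD; lra.
rewrite -lee_fin in bnd; apply: (le_trans bnd); rewrite EFinD leeD2r//.
have isq : mu.-integrable (time_itv t) (EFin \o (fun s => sqnorm (drift_gap u s w))).
  exact: (@integrable_sumR _ _ R mu _ (mT t) _ _ _
      (fun c => integrable_drift_gap_sqr w c Iu tT)).
rewrite -(@RintegralZl _ _ R mu _ _ (2 * T) (mT t) isq).
rewrite -(@integral_EFin _ _ R mu _ (mT t) _ (@integrableZR _ _ R mu _ (mT t) _ _ isq)).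
apply: (@ge0_subset_integral _ _ R mu _ _ (mT t) (mT tau)).
- apply/measurable_EFinP; apply: measurable_funM => //.
  apply: measurable_sum => c; apply: measurable_funX; exact: drift_gap_section.
- by move=> s _; rewrite lee_fin !mulr_ge0 ?sqnorm_ge0// ltW.
- exact: sub_time_itv.
Qed.

Lemma measurable_sqnorm_delta u s : I u -> 0 <= s <= T ->
  measurable_fun setT (fun w => sqnorm (delta u s w)).
Proof.
move=> Iu sT; apply: measurable_sum => c; apply: measurable_funX.
under eq_fun do rewrite compB.
by apply: measurable_funB; [exact: (measurable_state FP S1)|exact: (measurable_state FP S2)].
Qed.

Lemma integrable_sqnorm_delta u s : I u -> 0 <= s <= T ->
  P.-integrable setT (EFin \o (fun w => sqnorm (delta u s w))).
Proof.
move=> Iu sT; apply: bounded_integrable; split; first exact: measurable_sqnorm_delta.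
by exists (4 * N) => w; rewrite ger0_norm ?sqnorm_ge0//; exact: (sqnorm_delta_le).
Qed.

Lemma gap_EFin u s : I u -> 0 <= s <= T ->
  (\int[P]_w (sqnorm (delta u s w))%:E = (gap u s)%:E)%E.
Proof. by move=> Iu sT; rewrite integral_EFin//; exact: integrable_sqnorm_delta. Qed.

Lemma measurable_process_diffusion_gap u tau c : I u -> tau <= T ->
  measurable_process tau (fun s w => comp c (diffusion_gap u s w)).
Proof.
move=> Iu tauT; have [Y1 /(_ c)[m1 _ _ _ _] _] := solution_comp S1 Iu.
have [Y2 /(_ c)[m2 _ _ _ _] _] := solution_comp S2 Iu.
rewrite (_ : (fun s w => _) = fun s w => comp c (diffusion eta L (gamma1 u s w))
    - comp c (diffusion eta L (gamma2 u s w))).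
  exact: (measurable_processS tauT (measurable_processB m1 m2)).
by apply/funext => s; apply/funext => w; exact: (compB c).
Qed.

(** The central estimate: the drift part is uniform in time by [delta_sqnorm_le], and
    Doob's inequality [ito_doob] controls the stochastic part in each coordinate. *)
Lemma maximal_gap_le u (t : nat -> R) n :
  I u -> 0 <= t 0%N -> (forall i, t i <= t i.+1) -> (forall i, t i <= T) ->
  (\int[P]_w (runmax (fun i => sqnorm (delta u (t i) w)) n)%:E <=
    k%:E * \int[mu]_(s in time_itv (t n)) (gap u s + forcing u s)%:E)%E.
Proof.
move=> Iu t00 tS tT.
have t0 i : 0 <= t i by elim: i => // i IH; exact: le_trans (tS i).
have tmono i j : (i <= j)%N -> t i <= t j.
  by elim: j => [|j IH]; [rewrite leqn0 => /eqP ->|rewrite leq_eqVlt => /predU1P[->//|/IH h];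
     exact: le_trans h (tS j)].
have tiT i : 0 <= t i <= T by rewrite t0 tT.
have [Y1 iY1 eq1] := solution_comp S1 Iu; have [Y2 iY2 eq2] := solution_comp S2 Iu.
pose m c w := runmax (fun i => (comp c (Y1 (t i) w) - comp c (Y2 (t i) w)) ^+ 2) n.
pose r w := runmax (fun i => sqnorm (delta u (t i) w)) n.
pose f s w := 2 * T * sqnorm (drift_gap u s w).
pose g s w := 144 * q * sqnorm (diffusion_gap u s w).
have mY1 c i : measurable_fun setT (fun w => comp c (Y1 (t i) w)).
  by have [_ _ _ [_ aY] _] := iY1 c; apply: (wrt_measurable FP (t0 i)); exact: aY.
have mY2 c i : measurable_fun setT (fun w => comp c (Y2 (t i) w)).
  by have [_ _ _ [_ aY] _] := iY2 c; apply: (wrt_measurable FP (t0 i)); exact: aY.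
have mm c : measurable_fun setT (m c).
  apply: (measurable_runmax (M := fun i w => (comp c (Y1 (t i) w) - comp c (Y2 (t i) w)) ^+ 2)).
  by move=> i _; apply: measurable_funX; exact: measurable_funB.
have mr : measurable_fun setT r.
  apply: (measurable_runmax (M := fun i w => sqnorm (delta u (t i) w))) => i _.
  exact: (measurable_sqnorm_delta).
have m0 c w : 0 <= m c w by exact: runmax_ge0.
have f0 s w : 0 <= f s w by rewrite !mulr_ge0 ?sqnorm_ge0// ltW.
have q0 := normal_moment2_ge0 R.
have g0 s w : 0 <= g s w by rewrite !mulr_ge0 ?sqnorm_ge0.
have mf : measurable_process (t n) f.
  apply: (measurable_processS (tT n)); apply: measurable_funM => //.
  exact: (measurable_sqnorm (measurable_drift_gap Iu)).
have mdc c : measurable_process (t n) (fun s w => comp c (diffusion_gap u s w)).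
  exact: measurable_process_diffusion_gap.
have mg : measurable_process (t n) g.
  apply: measurable_funM => //; apply: measurable_sum => c.
  by apply: measurable_funX; exact: mdc.
have pathwise : {ae P, forall w, setT w -> ((r w)%:E <=
    \int[mu]_(s in time_itv (t n)) (f s w)%:E + (\sum_c 2 * m c w)%:E)%E}.
  apply: filterS2 eq1 eq2 => w e1 e2 _.
  have fin : (0 <= \int[mu]_(s in time_itv (t n)) (f s w)%:E)%E.
    by apply: integral_ge0 => s _; rewrite lee_fin.
  suff h i : (i <= n)%N -> ((sqnorm (delta u (t i) w))%:E <=
      \int[mu]_(s in time_itv (t n)) (f s w)%:E + (\sum_c 2 * m c w)%:E)%E.
    move: (\int[mu]_(s in _) _)%E fin h => [x| |] // x0 h.
      rewrite -EFinD lee_fin; apply: runmax_le.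
        by rewrite addr_ge0// sumr_ge0// => c _; rewrite mulr_ge0.
      by move=> i ilen; have := h i ilen; rewrite -EFinD lee_fin.
    by rewrite addye// leey.
  move=> ilen; apply: le_trans (delta_sqnorm_le (tau := t n) Iu _ _
     (e1 (t i) (tiT i)) (e2 (t i) (tiT i))) _.
  - by rewrite t0 tmono.
  - exact: tT.
  rewrite leeD2l// lee_fin; apply: ler_sum => c _; rewrite ler_wpM2l//.
  exact: (le_runmax (fun i => (comp c (Y1 (t i) w) - comp c (Y2 (t i) w)) ^+ 2)).
have noise : (\int[P]_w (\sum_c 2 * m c w)%:E <= iterated P (t n) g)%E.
  have -> : iterated P (t n) g = (\sum_c (144 * q)%:E *
      sq_process P (fun s w => comp c (diffusion eta L (gamma1 u s w))
         - comp c (diffusion eta L (gamma2 u s w)))%R (t n))%E.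
    rewrite /g iteratedZ ?mulr_ge0//; last 2 first.
    - by apply: measurable_sum => c; apply: measurable_funX; exact: mdc.
    - by move=> s w; exact: sqnorm_ge0.
    have -> := @iterated_sum _ _ _ P (t n) _ (fun c s w => comp c (diffusion_gap u s w) ^+ 2)
      (fun c => measurable_funX 2 (mdc c)) (fun c s w => sqr_ge0 _).
    rewrite ge0_sume_distrr; last first.
      move=> c _; apply: integral_ge0 => w _; apply: integral_ge0 => s _.
      by rewrite lee_fin sqr_ge0.
    apply: eq_bigr => c _; congr (_ * _)%E; apply: eq_integral => w _.
    by apply: eq_integral => s _; rewrite /diffusion_gap compB.
  under eq_integral do rewrite -sumEFin.
  rewrite ge0_integral_sum//; last 2 first.
  - by move=> c; apply/measurable_EFinP; exact: measurable_funM.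
  - by move=> c w _; rewrite lee_fin mulr_ge0.
  apply: lee_sum => c _; under eq_integral do rewrite EFinM.
  rewrite ge0_integralZl//; last 2 first.
  - exact/measurable_EFinP.
  - by move=> w _; rewrite lee_fin.
  have h := ito_doob FP (BP Iu) n (iY1 c) (iY2 c) t00 tS tT.
  have -> : 144 * q = 2 * (72 * q) by rewrite mulrA -natrM.
  by rewrite EFinM -muleA; apply: lee_wpmul2l.
apply: (@le_trans _ _ (iterated P (t n) f + iterated P (t n) g)%E).
  apply: le_trans (leeD2l _ noise).
  rewrite /iterated -ge0_integralD//; last 4 first.
  - by move=> w _; apply: integral_ge0 => s _; rewrite lee_fin.
  - exact: measurable_inner.
  - by move=> w _; rewrite lee_fin sumr_ge0// => c _; rewrite mulr_ge0.
  - by apply/measurable_EFinP; apply: measurable_sum => c; exact: measurable_funM.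
  apply: ae_ge0_le_integral => //.
  - by move=> w _; rewrite lee_fin runmax_ge0.
  - exact/measurable_EFinP.
  - move=> w _; apply: adde_ge0; first by apply: integral_ge0 => s _; rewrite lee_fin.
    by rewrite lee_fin sumr_ge0// => c _; rewrite mulr_ge0.
  - apply: emeasurable_funD; first exact: measurable_inner.
    by apply/measurable_EFinP; apply: measurable_sum => c; exact: measurable_funM.
rewrite -iteratedD//.
pose h s w := sqnorm (delta u s w) + forcing u s.
have mdl : measurable_process (t n) (fun s w => sqnorm (delta u s w)).
  exact: (measurable_processS (tT n) (measurable_sqnorm (measurable_delta Iu))).
have mh : measurable_process (t n) h.
  apply: measurable_funD => //.
  apply: (@measurable_comp _ _ _ _ _ _ (time_itv (t n)) (forcing u)) => //.
  - exact: mT.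
  - by move=> _ [[s w] [/= sT _] <-].
  - apply: (measurable_funS (mT T)); first exact: sub_time_itv.
    exact: (measurable_forcing_section Iu).
  - by apply: measurable_funTS; exact: measurable_fst.
have h0 s w : 0 <= h s w by rewrite addr_ge0 ?sqnorm_ge0 ?forcing_ge0.
have k0 : 0 <= k by exact: ltW gap_rate_gt0.
apply: (@le_trans _ _ (iterated P (t n) (fun s w => k * h s w))).
  apply: le_iterated => //.
  - by apply: measurable_funD; [exact: mf|exact: mg].
  - by apply: measurable_funM => //; exact: mh.
  - by move=> s w; rewrite addr_ge0.
  - by move=> s w; rewrite mulr_ge0.
  move=> s w /andP[s0 st]; apply: gap_rate_bound => //.
  by rewrite s0 (le_trans st).
rewrite iteratedZ// iterated_swap// lee_wpmul2l//.
  rewrite (@eq_integral _ _ _ mu _ (fun s => (gap u s + forcing u s)%:E))// => s.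
  rewrite inE => /time_itvP/andP[s0 st].
  have sT : 0 <= s <= T by rewrite s0 (le_trans st).
  have id := integrable_sqnorm_delta Iu sT.
  rewrite integral_EFin//; last first.
    apply: integrableDR => //; exact: finite_measure_integrable_cst.
  rewrite RintegralD//; last exact: finite_measure_integrable_cst.
  by rewrite Rintegral_cst// [X in fine X]probability_setT mulr1.
Qed.

Local Notation growth := (2 * k * expR (2 * k * T)).

Let TT : 0 <= T <= T.
Proof. by rewrite lexx ltW. Qed.

(** * Gronwall's inequality for each label *)

Lemma measurable_gap u : I u -> measurable_fun (time_itv T) (gap u).
Proof.
move=> Iu; exact: (@measurable_Rintegral_snd _ _ _ _ R P (time_itv T) setT (mT T) measurableT
  (fun p : R * Omega => sqnorm (delta u p.1 p.2))
  (measurable_sqnorm (measurable_delta Iu))).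
Qed.

Lemma gap_bounds u s : I u -> 0 <= s <= T -> 0 <= gap u s <= 4 * N.
Proof.
move=> Iu sT; apply/andP; split; first by apply: Rintegral_ge0 => w _; exact: sqnorm_ge0.
have ic : P.-integrable setT (EFin \o (fun=> 4 * N : R)) by exact: finite_measure_integrable_cst.
have := le_Rintegral measurableT (integrable_sqnorm_delta Iu sT) ic
  (fun w _ => sqnorm_delta_le w Iu sT).
by rewrite Rintegral_cst// [X in fine X]probability_setT mulr1.
Qed.

Let forcing_bounds u s : I u -> 0 <= s <= T -> 0 <= forcing u s <= 5 * N.
Proof.
move=> Iu sT; rewrite forcing_ge0/=; exact: (forcing_le).
Qed.

(** A constant grid turns the maximal inequality into an inequality at one time. *)
Lemma gap_integral_le u t : I u -> 0 <= t <= T ->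
  ((gap u t)%:E <= k%:E * \int[mu]_(s in time_itv t) (gap u s + forcing u s)%:E)%E.
Proof.
move=> Iu tT; have /andP[t0 tleT] := tT.
have := maximal_gap_le (t := fun=> t) 0 Iu t0
  (fun=> lexx t) (fun=> tleT).
apply: le_trans; rewrite -(gap_EFin Iu tT).
apply: ge0_le_integral => //.
- by move=> w _; rewrite lee_fin sqnorm_ge0.
- by apply/measurable_EFinP; exact: (measurable_sqnorm_delta).
- apply/measurable_EFinP.
  apply: (measurable_runmax (M := fun (i : nat) w => sqnorm (delta u t w))) => i _.
  exact: (measurable_sqnorm_delta).
- by move=> w _; rewrite lee_fin /= le_max lexx orbT.
Qed.

Lemma gap_le u t : I u -> 0 <= t <= T ->
  gap u t <= growth * \int[mu]_(s in time_itv t) forcing u s.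
Proof.
move=> Iu tT.
exact: (gronwall_forcing gap_rate_gt0 (measurable_gap Iu)
  (measurable_forcing_section Iu) (fun s => @gap_bounds u s Iu)
  (fun s => @forcing_bounds u s Iu) (fun s => @gap_integral_le u s Iu) tT).
Qed.

Lemma continuous_sqnorm_delta u w : I u ->
  {within time_itv T, continuous (fun t => sqnorm (delta u t w))}.
Proof.
move=> Iu; rewrite /sqnorm; elim: (index_enum _) => [|c r IH].
  rewrite (_ : (fun t => _) = fun=> 0); first by move=> x; exact: cvg_cst.
  by apply/funext => t; rewrite big_nil.
have cc : {within time_itv T, continuous (fun t => comp c (gamma1 u t w) - comp c (gamma2 u t w))}.
  move=> x; apply: cvgB; first exact: (continuous_state S1).
  exact: (continuous_state S2).
rewrite (_ : (fun t => _) = fun t =>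
  (comp c (gamma1 u t w) - comp c (gamma2 u t w)) * (comp c (gamma1 u t w) - comp c (gamma2 u t w))
  + \sum_(c <- r) comp c (delta u t w) ^+ 2).
  by move=> x; apply: cvgD; [apply: cvgM; exact: cc|exact: IH].
by apply/funext => t; rewrite big_cons /delta compB.
Qed.

Lemma expected_sup_le u : I u ->
  measurable_fun setT (sup_sq_dist T gamma1 gamma2 u) ->
  (\int[P]_w sup_sq_dist T gamma1 gamma2 u w <=
   (k * (T * growth + 1) * \int[mu]_(s in time_itv T) forcing u s)%:E)%E.
Proof.
move=> Iu.
have -> : sup_sq_dist T gamma1 gamma2 u =
    fun w => ereal_sup [set (sqnorm (delta u t w))%:E | t in time_itv T].
  apply/funext => w; congr ereal_sup; apply: eq_imagel => t _.
  by rewrite frobenius_sqr.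
move=> msup; apply: (integral_sup_le T0 (f := fun t w => sqnorm (delta u t w))) => //.
- by move=> w; exact: continuous_sqnorm_delta.
- by move=> t tT; exact: (measurable_sqnorm_delta).
- by move=> t w _; exact: sqnorm_ge0.
move=> n.
have t00 : 0 <= grid T n 0 by rewrite grid0.
apply: le_trans (maximal_gap_le n.+1 Iu t00
  (grid_mono T0 n) (grid_leT T n)) _.
rewrite grid_last.
exact: (gronwall_forcing_integral gap_rate_gt0 T0 (measurable_gap Iu)
  (measurable_forcing_section Iu) (fun s => @gap_bounds u s Iu)
  (fun s => @forcing_bounds u s Iu) (fun s => @gap_integral_le u s Iu)).
Qed.

Let growth_gt0 : 0 < growth.
Proof. by rewrite !mulr_gt0 ?expR_gt0//; exact: gap_rate_gt0. Qed.

(** * Gronwall's inequality for the means and the cut norm *)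

(** Jensen's inequality in each coordinate. *)
Lemma sqnorm_mean_diff_le v s : I v -> 0 <= s <= T ->
  sqnorm (mean1 s v - mean2 s v) <= gap v s.
Proof.
move=> Iv sT.
have i1 c := integrable_state FP S1 c Iv sT; have i2 c := integrable_state FP S2 c Iv sT.
have id c : P.-integrable setT (EFin \o (fun w => comp c (delta v s w))).
  rewrite (_ : (fun w => _) = fun w => comp c (gamma1 v s w) + - 1 * comp c (gamma2 v s w)).
    by apply: integrableDR => //; exact: integrableZR.
  by apply/funext => w; rewrite /delta compB mulN1r.
have d2 w c : comp c (delta v s w) ^+ 2 <= 4 * N.
  by apply: le_trans (comp_sqr_le _ _) _; exact: (sqnorm_delta_le).
have id2 c : P.-integrable setT (EFin \o (fun w => comp c (delta v s w) ^+ 2)).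
  apply: bounded_integrable; split; last by exists (4 * N) => w; rewrite ger0_norm ?sqr_ge0.
  apply: measurable_funX; under eq_fun do rewrite compB.
  by apply: measurable_funB; [exact: (measurable_state FP S1)|exact: (measurable_state FP S2)].
rewrite /gap /sqnorm Rintegral_sum//; apply: ler_sum => c _.
have -> : comp c (mean1 s v - mean2 s v) = \int[P]_w comp c (delta v s w).
  rewrite compB !comp_mean_state -RintegralB//.
  by apply: eq_Rintegral => w _; rewrite compB.
have P1 : (P setT <= 1%:E)%E by rewrite probability_setT.
apply: le_trans (sqr_Rintegral_le measurableT ltr01 P1 (id c) (id2 c)) _.
by rewrite mul1r.
Qed.

Definition graphon_forcing (u s : R) : R :=
  \sum_c graphon_gap c u s ^+ 2.

Definition total_forcing : R :=
  \int[mu]_(u in I) \int[mu]_(s in time_itv T) graphon_forcing u s.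

Lemma graphon_forcing_bounds u s : I u -> 0 <= s <= T -> 0 <= graphon_forcing u s <= N.
Proof.
move=> Iu sT; rewrite sumr_ge0/= => [|c _]; last exact: sqr_ge0.
rewrite -sum1_card natr_sum; apply: ler_sum => c _.
by rewrite -real_normK ?num_real// expr_le1// (graphon_gap_le1).
Qed.

Lemma measurable_graphon_forcing :
  measurable_fun (I `*` time_itv T) (fun p : R * R => graphon_forcing p.1 p.2).
Proof.
apply: measurable_sum => c; apply: measurable_funX.
exact: (measurable_graphon_gap).
Qed.

Let graphon_forcing_section u : I u -> measurable_fun (time_itv T) (graphon_forcing u).
Proof.
move=> Iu; apply: (@measurable_comp _ _ _ _ _ _ (I `*` time_itv T)
  (fun p : R * R => graphon_forcing p.1 p.2) _ (fun s => (u, s))) => //.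
- exact: (measurableX mI (mT T)).
- by move=> _ [s sT <-].
- exact: measurable_graphon_forcing.
- by apply: measurable_funTS; exact: measurable_fun_pair.
Qed.

Let finT : (mu (time_itv T) < +oo)%E.
Proof. by apply: time_itv_fin; exact: ltW. Qed.

Let graphon_forcing_abs u s : I u -> time_itv T s -> `|graphon_forcing u s| <= N.
Proof.
by move=> Iu /time_itvP sT; have /andP[h0 h1] := graphon_forcing_bounds Iu sT; rewrite ger0_norm.
Qed.

Let integrable_graphon_forcing :
  mu.-integrable I (EFin \o (fun u => \int[mu]_(s in time_itv T) graphon_forcing u s)).
Proof.
exact: (@integrable_Rintegral_snd _ _ _ _ R mu mu I (time_itv T)
  (fun p : R * R => graphon_forcing p.1 p.2) N mI (mT T) finI finT measurable_graphon_forcing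
  graphon_forcing_abs).
Qed.

Let mean_gap_bounds s : 0 <= s <= T -> 0 <= mean_gap s <= 4 * N.
Proof. by move=> sT; rewrite mean_gap_ge0 (mean_gap_le). Qed.

Let mmg : measurable_fun (time_itv T) mean_gap := measurable_mean_gap.

Lemma time_forcing_le u t : I u -> 0 <= t <= T ->
  \int[mu]_(s in time_itv t) forcing u s <=
  \int[mu]_(s in time_itv T) graphon_forcing u s + \int[mu]_(s in time_itv t) mean_gap s.
Proof.
move=> Iu tT; have /andP[t0 tleT] := tT.
have mG := graphon_forcing_section Iu.
have GB s (sT : 0 <= s <= T) := graphon_forcing_bounds Iu sT.
have iG := time_integrable mG GB tT.
have im := time_integrable mmg mean_gap_bounds tT.
have -> : \int[mu]_(s in time_itv t) forcing u s =
  \int[mu]_(s in time_itv t) graphon_forcing u s + \int[mu]_(s in time_itv t) mean_gap s.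
  exact: (@RintegralD _ _ R mu _ _ _ (mT t) iG im).
by rewrite lerD2r; exact: (time_integral_mono mG GB).
Qed.

Lemma unit_integral_le (f g : R -> R) (c : R) :
  mu.-integrable I (EFin \o f) -> mu.-integrable I (EFin \o g) ->
  (forall u, I u -> f u <= g u + c) ->
  \int[mu]_(u in I) f u <= \int[mu]_(u in I) g u + c.
Proof.
move=> i_f ig fg.
have ic : mu.-integrable I (EFin \o (fun=> c : R)).
  by apply: (@bounded_integrableR _ _ _ _ _ _ `|c|).
have -> : \int[mu]_(u in I) g u + c = \int[mu]_(u in I) (g u + c).
  rewrite (@RintegralD _ _ R mu I _ _ mI ig ic) Rintegral_cst//.
  by rewrite [X in fine X]unit_itv_measure mulr1.
exact: (@le_Rintegral _ _ R mu I _ _ mI i_f (@integrableDR _ _ R mu I mI _ _ ig ic)).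
Qed.

(** The means are closer than the states, and the mean part of the forcing of every
    label is again [mean_gap]: averaged over the labels, [gap_le] becomes a closed
    inequality. *)
Lemma mean_gap_integral_le t : 0 <= t <= T ->
  mean_gap t <= growth * (total_forcing + \int[mu]_(s in time_itv t) mean_gap s).
Proof.
move=> tT; rewrite mulrDr /total_forcing -(@RintegralZl _ _ R mu _ _ growth mI integrable_graphon_forcing).
apply: unit_integral_le.
- exact: (integrable_mean_gap).
- exact: (@integrableZR _ _ R mu I mI _ _ integrable_graphon_forcing).
move=> v Iv; apply: le_trans (sqnorm_mean_diff_le Iv tT) _.
apply: le_trans (gap_le Iv tT) _.
by rewrite -mulrDr ler_wpM2l ?(ltW growth_gt0)// time_forcing_le.
Qed.

Lemma total_forcing_ge0 : 0 <= total_forcing.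
Proof.
apply: Rintegral_ge0 => u Iu; apply: time_integral_ge0 => s sT.
by have /andP[] := graphon_forcing_bounds Iu sT.
Qed.

Lemma mean_gap_le_total t : 0 <= t <= T ->
  mean_gap t <= 2 * (growth * total_forcing) * expR (2 * growth * T).
Proof.
move=> tT.
apply: (@gronwall _ growth T (growth * total_forcing) (4 * N) mean_gap) => //.
- by rewrite mulr_ge0 ?total_forcing_ge0// ltW.
move=> s sT; rewrite -/(time_itv s).
rewrite (@integral_EFin _ _ R mu _ (mT s) _ (time_integrable mmg mean_gap_bounds sT)).
by rewrite -EFinM -EFinD lee_fin -mulrDr mean_gap_integral_le.
Qed.

Lemma forcing_integral_le u : I u ->
  \int[mu]_(s in time_itv T) forcing u s <=
  \int[mu]_(s in time_itv T) graphon_forcing u s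
  + T * (2 * (growth * total_forcing) * expR (2 * growth * T)).
Proof.
move=> Iu; apply: le_trans (time_forcing_le Iu TT) _; rewrite lerD2l.
apply: (le_time_integral_cst mmg mean_gap_bounds TT) => //.
  exact: mean_gap_le_total.
by rewrite mulr_ge0 ?expR_ge0// mulr_ge0// mulr_ge0 ?total_forcing_ge0// ltW.
Qed.

Local Notation feedback := (1 + T * (2 * growth * expR (2 * growth * T))).

Lemma sup_sq_dist_ge0 u w : (0 <= sup_sq_dist T gamma1 gamma2 u w)%E.
Proof.
apply: (@le_trans _ _ ((frobenius (gamma1 u 0 w - gamma2 u 0 w)) ^+ 2)%:E).
  by rewrite lee_fin sqr_ge0.
by apply: ereal_sup_ubound; exists 0 => //; apply/time_itvP; rewrite lexx ltW.
Qed.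

(** The hypothesis allows to take the expectation for each label first, where
    [expected_sup_le] applies. *)
Lemma expected_distance_le :
  integral_expectation_exchange P (sup_sq_dist T gamma1 gamma2) ->
  (\int[P]_w \int[mu]_(u in I) sup_sq_dist T gamma1 gamma2 u w <=
   (k * (T * growth + 1) * feedback * total_forcing)%:E)%E.
Proof.
move=> ex; rewrite (iee_exchange ex).
set K := k * (T * growth + 1).
pose b := T * (2 * (growth * total_forcing) * expR (2 * growth * T)).
pose acc u := \int[mu]_(s in time_itv T) graphon_forcing u s.
have k0 := gap_rate_gt0.
have K0 : 0 <= K by rewrite mulr_ge0 ?(ltW k0)// addr_ge0// mulr_ge0 ?(ltW growth_gt0)// ltW.
have iK := @integrableZR _ _ R mu I mI K _ integrable_graphon_forcing.
have ib : mu.-integrable I (EFin \o (fun=> K * b : R)).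
  by apply: (@bounded_integrableR _ _ _ _ _ _ `|K * b|).
have ig := @integrableDR _ _ R mu I mI _ _ iK ib.
apply: (@le_trans _ _ (\int[mu]_(u in I) (K * acc u + K * b)%:E)%E).
  apply: (@ge0_le_integral _ _ R mu I mI).
  - by move=> u _; apply: integral_ge0 => w _; exact: sup_sq_dist_ge0.
  - exact: iee_expectation ex.
  - exact: (measurable_int mu ig).
  move=> u Iu.
  apply: le_trans (expected_sup_le Iu (iee_random ex Iu)) _.
  by rewrite lee_fin -mulrDr ler_wpM2l// forcing_integral_le.
rewrite (@integral_EFin _ _ R mu I mI _ ig) lee_fin.
apply: le_trans (unit_integral_le (c := K * b) ig iK (fun u _ => lexx _)) _.
rewrite (@RintegralZl _ _ R mu _ _ K mI integrable_graphon_forcing) -/total_forcing.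
rewrite /b; move: (expR (2 * growth * T)) (growth) (K) (total_forcing) => x y z t.
by rewrite le_eqVlt; apply/orP; left; apply/eqP; ring.
Qed.

(** As [graphon_gap] is bounded by one, its square is at most its absolute value,
    and [operator_cut_bound] applies for each coordinate and time. *)
Lemma total_forcing_le (c : R) :
  (forall A A' : set R, measurable A -> measurable A' -> A `<=` I -> A' `<=` I ->
    (`| \int[(mu \x mu)%E]_(p in A `*` A') (W1 p.1 p.2 - W2 p.1 p.2)%:E | <= c%:E)%E) ->
  total_forcing <= T * (N * (4 * c)).
Proof.
move=> cut.
rewrite /total_forcing (@Rfubini_on _ _ _ _ R mu mu I (time_itv T)
  (fun p : R * R => graphon_forcing p.1 p.2) N mI (mT T) finI finT measurable_graphon_forcing
  graphon_forcing_abs).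
have bnd s : 0 <= s <= T ->
    0 <= \int[mu]_(u in I) graphon_forcing u s <= N * (4 * c).
  move=> sT; have sI := (time_itvP _ _).2 sT; apply/andP; split.
    by apply: Rintegral_ge0 => u Iu; have /andP[] := graphon_forcing_bounds Iu sT.
  have mc c' : measurable_fun I (fun u => graphon_gap c' u s).
    apply: (@measurable_comp _ _ _ _ _ _ (I `*` time_itv T)
      (fun p : R * R => graphon_gap c' p.1 p.2) _ (fun u => (u, s))) => //.
    - exact: (measurableX mI (mT T)).
    - by move=> _ [u Iu <-].
    - exact: (measurable_graphon_gap).
    - by apply: measurable_funTS; exact: measurable_fun_pair.
  have gle1 c' u : I u -> `|graphon_gap c' u s| <= 1.
    by move=> Iu; exact: (graphon_gap_le1).
  have i2 c' : mu.-integrable I (EFin \o (fun u => graphon_gap c' u s ^+ 2)).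
    apply: (@bounded_integrableR _ _ _ _ _ _ 1) => //.
      exact: (measurable_funX 2 (mc c')).
    by move=> u Iu; rewrite normrX expr_le1// gle1.
  have i1 c' : mu.-integrable I (EFin \o (fun u => `|graphon_gap c' u s|)).
    apply: (@bounded_integrableR _ _ _ _ _ _ 1) => //.
      by apply: measurableT_comp => //; exact: mc.
    by move=> u Iu; rewrite normr_id gle1.
  rewrite (@Rintegral_sum _ _ R mu I mI _ _ _ i2).
  rewrite (_ : N * (4 * c) = \sum_(c' : coord d) 4 * c); last first.
    by rewrite sumr_const mulr_natl.
  apply: ler_sum => c' _.
  apply: (@le_trans _ _ (\int[mu]_(u in I) `|graphon_gap c' u s|)).
    apply: (@le_Rintegral _ _ R mu I _ _ mI (i2 c') (i1 c')) => u Iu.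
    by rewrite -real_normK ?num_real// expr2 ler_piMl// gle1.
  apply: (@operator_cut_bound _ (fun u v => W1 u v - W2 u v)) => //.
  - exact: measurable_graphonB.
  - by move=> u v Iu Iv; exact: graphonB_le1.
  - exact: ((measurable_mxP _ _).1 (measurable_mean_section S1 sT) c').
  - by move=> v Iv; exact: (mean_state_le1 FP S1).
have c0 : 0 <= N * (4 * c) by have /andP[h1 h2] := bnd 0 ltac:(by rewrite lexx ltW); exact: le_trans h2.
apply: (le_time_integral_cst (M := N * (4 * c)) _ bnd TT) => //; last first.
  by move=> s /bnd/andP[].
exact: (@measurable_Rintegral_fst _ _ _ _ R mu I (time_itv T) mI (mT T)
  (fun p : R * R => graphon_forcing p.1 p.2) measurable_graphon_forcing).
Qed.

End two_solutions.

(** * The stability estimate *)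

Section final_constant.
Variable R : realType.

(** The factors come from the passage from the forcing to the supremum
    ([expected_sup_le]), from the feedback of the means ([mean_gap_le_total]) and from
    the cut norm ([total_forcing_le]); the summand 1 makes the constant positive. *)
Definition stability_constant (d : nat) (T nH nA nL : R) : R :=
  let k := gap_rate d T nH nA nL in
  let g := 2 * k * expR (2 * k * T) in
  k * (T * g + 1) * (1 + T * (2 * g * expR (2 * g * T))) * (T * (#|coord d|%:R * 4)) + 1.

Lemma cut_norm_ge (w : R -> R -> R) (A B : set R) :
  measurable A -> measurable B -> A `<=` unit_itv R -> B `<=` unit_itv R ->
  (`| \int[(@lebesgue_measure R \x @lebesgue_measure R)%E]_(p in A `*` B) (w p.1 p.2)%:E |
     <= cut_norm w)%E.
Proof. by move=> mA mB AI BI; apply: ereal_sup_ubound; exists A, B; split. Qed.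

End final_constant.

Theorem theorem3 (R : realType) (d : nat) (d_ge1 : (1 <= d)%N) :
  exists C : R -> R -> R -> R -> R -> R,
  forall (T eta : R) (H L : 'M[R[i]]_d) (a : pair_kernel R d)
    (rho0 : 'M[R[i]]_d),
  0 < T -> 0 < eta <= 1 -> H = H ^t* -> is_pair_kernel a ->
  density_matrix rho0 ->
  forall (dO : measure_display) (Omega : measurableType dO)
    (P : probability Omega R) (F : R -> set (set Omega))
    (B : R -> R -> Omega -> R),
  filtration_usual P F ->
  (forall u, unit_itv R u -> brownian_motion P F (B u)) ->
  forall (W1 W2 : R -> R -> R) (gamma1 gamma2 : R -> R -> Omega -> 'M[R[i]]_d),
  graphon W1 -> graphon W2 ->
  is_solution P F B T eta H L a rho0 W1 gamma1 ->
  is_solution P F B T eta H L a rho0 W2 gamma2 ->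
  integral_expectation_exchange P (sup_sq_dist T gamma1 gamma2) ->
  (\int[P]_w \int[@lebesgue_measure R]_(u in unit_itv R)
     sup_sq_dist T gamma1 gamma2 u w
   <= (C T eta (frobenius H) (pair_operator_norm a) (frobenius L))%:E
      * cut_norm (fun u v => (W1 u v - W2 u v)%R))%E.
Proof.
exists (fun T eta nH nA nL => stability_constant d T nH nA nL).
move=> T eta H L a rho0 T0 eta01 _ _ _ dO Omega P F B FP BP W1 W2 gamma1 gamma2.
move=> gW1 gW2 S1 S2 ex.
set w := fun u v : R => W1 u v - W2 u v.
have bnd := expected_distance_le T0 eta01 FP BP gW1 gW2 S1 S2 ex.
have tot := total_forcing_le T0 FP gW1 gW2 S1.
have k0 := gap_rate_gt0 H L a T0.
rewrite /stability_constant; move: bnd tot.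
set tf := total_forcing _ _ _ _ _.
set g := 2 * _ * expR _ => bnd tot.
have g0 : 0 < g by rewrite !mulr_gt0 ?expR_gt0.
set K := _ * (T * g + 1) * _ in bnd *.
have K0 : 0 <= K.
  rewrite !mulr_ge0 ?(ltW k0)// addr_ge0// mulr_ge0// ?(ltW T0) ?(ltW g0)//.
  by rewrite mulr_ge0 ?expR_ge0// mulr_ge0// ltW.
have C0 : 0 < K * (T * (#|coord d|%:R * 4)) + 1.
  by rewrite ltr_wpDl// mulr_ge0// mulr_ge0 ?(ltW T0)// mulr_ge0.
have cut0 : (0 <= cut_norm w)%E.
  by apply: le_trans (cut_norm_ge w measurable0 measurable0 _ _) => //; exact: abse_ge0.
(* If the cut norm is infinite, the bound is trivial as the constant is positive. *)
case cE : (cut_norm w) cut0 => [c| |] // c0; last by rewrite gt0_muley ?lte_fin// leey.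
apply: (le_trans bnd); rewrite -EFinM lee_fin.
rewrite lee_fin in c0.
have h : tf <= T * (#|coord d|%:R * (4 * c)).
  by apply: tot => A A' mA mA' AI AI'; rewrite -cE; exact: cut_norm_ge.
apply: (le_trans (ler_wpM2l K0 h)).
have -> : K * (T * (#|coord d|%:R * (4 * c))) = K * (T * (#|coord d|%:R * 4)) * c by ring.
by rewrite [leRHS]mulrDl mul1r lerDl.
Qed.
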